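(* Let $W:\mathbb{R}\to\mathbb{R}$ be $C^3$ and strictly convex (with $W''>0$), let $a,b\in\mathbb{R}$, $T>0$, $c>0$, and let $u\in C^3([0,1]\times[0,T])$ solve the Neumann problem $$\frac{u_t}{\sqrt{1+u_x^2}}=W''(u_x)\,u_{xx}\quad(0\le x\le 1),\qquad u(x,0)=u_0(x),\qquad u_x(0,t)=a,\quad u_x(1,t)=b .$$ Then there exist $m_0>0$ and $C_T$, independent of $m$ (they may depend on $u$, $W$, $T$, $c$), such that the following holds for every $0<m\le m_0$. Let $u^m$ be the crystalline evolution with Neumann boundary conditions (defined in the context) with slope set $S$ and compatible initial datum $u_0^m$ having $N_0$ faces, where $$N_0\le\frac{c}{m},\qquad \|(u_0^m)_x-(u_0)_x\|_{L^\infty([0,1])}\le m,$$ and $$\bigl|[(u_0^m)_x]_i-[(u_0^m)_x]_{i-1}\bigr|\le m\quad\text{for all } 1\le i\le N_0+1,$$ the slopes with indices $0$ and $N_0+1$ being the boundary extension slopes defined in the context. Then $$\sup_{0\le t\le T}\|u(\cdot,t)-u^m(\cdot,t)\|_{H^1([0,1])}\le C_T\,m^{1/2}.$$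
   Context: Slope set. $S\subset\mathbb{R}$ is a locally finite set of ''admissible slopes'' (the corners of a continuous piecewise linear function $\bar W$ that coincides with $W$ at the points of $S$), with $a,b\in S$ and with elements of $S$ on both sides of $a$ and on both sides of $b$. Two elements of $S$ are adjacent if they are distinct and no element of $S$ lies strictly between them. Admissible functions. An admissible function is a continuous piecewise linear function on $[0,1]$, made of finitely many linear pieces (''faces''), each with slope in $S$. Its corners have abscissas $0=x_0<x_1<\dots<x_N=1$; face $i$ lies over $(x_{i-1},x_i)$, has projected length $l_i=x_i-x_{i-1}$ and slope $p_i=(u^m_x)_i\in S$. Compatible initial datum. $u_0^m$ is admissible with at least two faces (so that the slopes $p_2$ and $p_{N-1}$ used below exist), its first face has slope $a$, its last face has slope $b$, and the slopes of any two consecutive faces are adjacent elements of $S$. Boundary extension slopes. At each time, $p_0$ is the element of $S$ adjacent to $p_1=a$ such that $p_1$ lies between $p_0$ and $p_2$; $p_{N+1}$ is the element of $S$ adjacent to $p_N=b$ such that $p_N$ lies between $p_{N-1}$ and $p_{N+1}$. For the initial datum, $[(u_0^m)_x]_i$ denotes $p_i$ at time $0$. Crystalline evolution, Neumann conditions. $u^m(\cdot,t)$ is a family of admissible functions, continuous in $t$, with $u^m(\cdot,0)=u_0^m$. Each face keeps its slope $p_i$ and moves with vertical velocity $v_i=(u^m_t)_i$ (so $u^m_t=v_i$ on face $i$), where for $1\le i\le N$ $$v_i=\sqrt{1+p_i^2}\;\frac{\Delta_i}{l_i}\,r_i,\qquad \Delta_i=\frac{W(p_{i+1})-W(p_i)}{p_{i+1}-p_i}-\frac{W(p_i)-W(p_{i-1})}{p_i-p_{i-1}},$$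 with $r_i=1$ for $2\le i\le N-1$ and $$r_1=\frac{p_2-p_1}{p_2-p_0},\qquad r_N=\frac{p_N-p_{N-1}}{p_{N+1}-p_{N-1}} .$$ Since $u^m$ stays continuous, the corners move by $$\dot x_i=-\frac{v_{i+1}-v_i}{p_{i+1}-p_i}\ (1\le i\le N-1),\qquad x_0=0,\ x_N=1,$$ which is a system of ODEs for the lengths $l_i$. When one or more lengths reach zero, the corresponding faces are removed (the first and the last face never disappear), consecutive remaining faces of equal slope are merged into one face, the faces are renumbered from left to right ($N$ is the current number of faces), the slopes $p_0,p_{N+1}$ and the ratios $r_1,r_N$ are updated, and the evolution continues by the same rules. No new faces are ever created.
   Formalization: It is also assumed that the L^2 norm of u_0^m - u_0 is at most c m^{1/2}; without this, adding a constant to u^m refutes the claim. When only one face remains (N = 1), where r_1 and r_N conflict, the face is taken to be stationary. *)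

(* Defs.v *)
(* Stdlib reals with Coquelicot *)
From Stdlib Require Import Reals Lra Lia Arith List.
From Coquelicot Require Import Coquelicot.
Open Scope R_scope.

Definition C3 (W : R -> R) : Prop :=
  (forall (n : nat) (x : R), (n <= 3)%nat -> ex_derive_n W n x) /\
  (forall x : R, continuous (Derive_n W 3) x).

Definition strictly_convex (W : R -> R) : Prop :=
  forall x y l : R, x <> y -> 0 < l < 1 ->
    W (l * x + (1 - l) * y) < l * W x + (1 - l) * W y.

(* Derivative relative to the interval [lo,hi]: one-sided at its end points. *)
Definition is_derive_within (lo hi : R) (f : R -> R) (x l : R) : Prop :=
  filterlim (fun y => (f y - f x) / (y - x))
    (within (fun y => lo <= y <= hi) (locally' x)) (locally l).

Definition rect (T : R) (z : R * R) : Prop :=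
  0 <= fst z <= 1 /\ 0 <= snd z <= T.

(* u is C^3 on the closed rectangle [0,1] x [0,T], and D i j is its partial
   derivative of order i in x and j in t, for i + j <= 3. *)
Definition C3_rect (T : R) (u : R -> R -> R) (D : nat -> nat -> R -> R -> R)
  : Prop :=
  (forall x t, rect T (x, t) -> D 0%nat 0%nat x t = u x t) /\
  (forall i j, (i + j <= 3)%nat ->
     continuous_on (rect T) (fun z : R * R => D i j (fst z) (snd z))) /\
  (forall i j x t, (i + j < 3)%nat -> rect T (x, t) ->
     is_derive_within 0 1 (fun y => D i j y t) x (D (S i) j x t) /\
     is_derive_within 0 T (fun r => D i j x r) t (D i (S j) x t)).

Definition null_set (E : R -> Prop) : Prop :=
  forall eps : R, 0 < eps ->
    exists lo hi : nat -> R,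
      (forall n, lo n <= hi n) /\
      (forall x, E x -> exists n, lo n < x < hi n) /\
      (forall n, sum_n (fun k => hi k - lo k) n <= eps).

Definition Linf_norm_le (f : R -> R) (M : R) : Prop :=
  null_set (fun x => 0 <= x <= 1 /\ ~ Rabs (f x) <= M).

(* These two norms are applied only to functions that are continuous on [0,1]
   and piecewise C^1, so Riemann integrals suffice, and [Derive] agrees with
   the weak derivative away from finitely many points. *)
Definition L2_norm (f : R -> R) : R := sqrt (RInt (fun x => f x ^ 2) 0 1).

Definition H1_norm (f : R -> R) : R :=
  sqrt (RInt (fun x => f x ^ 2) 0 1 + RInt (fun x => Derive f x ^ 2) 0 1).

Definition neumann_solution (W : R -> R) (a b T : R) (u0 : R -> R)
    (u : R -> R -> R) (D : nat -> nat -> R -> R -> R) : Prop :=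
  C3_rect T u D /\
  (forall x t, 0 <= x <= 1 -> 0 <= t <= T ->
     D 0%nat 1%nat x t / sqrt (1 + D 1%nat 0%nat x t ^ 2) =
     Derive_n W 2 (D 1%nat 0%nat x t) * D 2%nat 0%nat x t) /\
  (forall x, 0 <= x <= 1 -> u x 0 = u0 x) /\
  (forall t, 0 <= t <= T -> D 1%nat 0%nat 0 t = a) /\
  (forall t, 0 <= t <= T -> D 1%nat 0%nat 1 t = b).

Definition locally_finite (S : R -> Prop) : Prop :=
  forall M : R, exists l : list R, forall s, S s -> Rabs s <= M -> In s l.

Definition slope_set (S : R -> Prop) (a b : R) : Prop :=
  locally_finite S /\ S a /\ S b /\
  (exists s, S s /\ s < a) /\ (exists s, S s /\ a < s) /\
  (exists s, S s /\ s < b) /\ (exists s, S s /\ b < s).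

Definition adjacent (S : R -> Prop) (p q : R) : Prop :=
  S p /\ S q /\ p <> q /\ forall s, S s -> ~ (Rmin p q < s < Rmax p q).

Definition strictly_between (p q r : R) : Prop := p < q < r \/ r < q < p.

(* A configuration consists of a number [N] of faces, slopes [p 1 .. p N] and
   corners [X 0 .. X N]; face i lies over (X (i-1), X i).  The boundary
   extension slopes are stored as [p 0] and [p (N+1)]; values at other indices
   are irrelevant. *)

Definition admissible (S : R -> Prop) (N : nat) (p X : nat -> R) (f : R -> R)
  : Prop :=
  (1 <= N)%nat /\ X 0%nat = 0 /\ X N = 1 /\
  (forall i, (1 <= i <= N)%nat ->
     X (i - 1)%nat < X i /\ S (p i) /\
     forall y, X (i - 1)%nat <= y <= X i ->
       f y = f (X (i - 1)%nat) + p i * (y - X (i - 1)%nat)).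

Definition boundary_slopes (S : R -> Prop) (N : nat) (p : nat -> R) : Prop :=
  adjacent S (p 0%nat) (p 1%nat) /\
  strictly_between (p 0%nat) (p 1%nat) (p 2%nat) /\
  adjacent S (p (N + 1)%nat) (p N) /\
  strictly_between (p (N - 1)%nat) (p N) (p (N + 1)%nat).

Definition compatible_datum (S : R -> Prop) (a b : R)
    (N : nat) (p X : nat -> R) (f : R -> R) : Prop :=
  admissible S N p X f /\ (2 <= N)%nat /\ p 1%nat = a /\ p N = b /\
  (forall i, (1 <= i < N)%nat -> adjacent S (p i) (p (i + 1)%nat)) /\
  boundary_slopes S N p.

Definition Delta (W : R -> R) (p : nat -> R) (i : nat) : R :=
  (W (p (i + 1)%nat) - W (p i)) / (p (i + 1)%nat - p i) -
  (W (p i) - W (p (i - 1)%nat)) / (p i - p (i - 1)%nat).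

(* A single face (which can only arise when a = b, after removal of faces) is
   both first and last: each end removes from [1] the outer half of [Delta],
   i.e. (p1 - p0)/(p2 - p0) and (p2 - p1)/(p2 - p0), so the ratio is 0. *)
Definition ratio (N : nat) (p : nat -> R) (i : nat) : R :=
  if (N =? 1)%nat then 0
  else if (i =? 1)%nat then
    (p 2%nat - p 1%nat) / (p 2%nat - p 0%nat)
  else if (i =? N)%nat then
    (p N - p (N - 1)%nat) / (p (N + 1)%nat - p (N - 1)%nat)
  else 1.

Definition velocity (W : R -> R) (N : nat) (p X : nat -> R) (i : nat) : R :=
  sqrt (1 + p i ^ 2) * (Delta W p i / (X i - X (i - 1)%nat)) * ratio N p i.

(* Motion on [s,e] with a fixed set of faces; [x i t] is the i-th corner at
   time t.  Lengths are positive on [s,e) but may vanish at time e, except for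
   those of the first and last faces. *)
Record phase (W : R -> R) (S : R -> Prop) (um : R -> R -> R) (s e : R)
    (N : nat) (p : nat -> R) (x : nat -> R -> R) : Prop := {
  phase_admissible : forall t, s <= t < e ->
    admissible S N p (fun i => x i t) (fun y => um y t);
  phase_boundary : boundary_slopes S N p;
  phase_continuous : forall i, (i <= N)%nat ->
    continuous_on (fun t => s <= t <= e) (x i);
  phase_ends : x 0%nat e < x 1%nat e /\ x (N - 1)%nat e < x N e;
  phase_velocity : forall i t y, (1 <= i <= N)%nat -> s < t < e ->
    x (i - 1)%nat t < y < x i t ->
    is_derive (fun r => um y r) t (velocity W N p (fun j => x j t) i);
  phase_corners : forall i t, (1 <= i <= N - 1)%nat -> s < t < e ->
    is_derive (x i) t
      (- ((velocity W N p (fun j => x j t) (i + 1)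
           - velocity W N p (fun j => x j t) i)
          / (p (i + 1)%nat - p i)))
}.

(* Faces from left to right, as pairs (slope, projected length). *)
Definition faces (N : nat) (p X : nat -> R) : list (R * R) :=
  map (fun i => (p i, X i - X (i - 1)%nat)) (List.seq 1 N).

Definition remove_vanished (l : list (R * R)) : list (R * R) :=
  filter (fun f => if Rlt_dec 0 (snd f) then true else false) l.

Fixpoint merge_faces (l : list (R * R)) : list (R * R) :=
  match l with
  | nil => nil
  | (p, d) :: l' =>
      match merge_faces l' with
      | (q, d') :: l'' =>
          if Req_EM_T p q then (p, d + d') :: l'' else (p, d) :: (q, d') :: l''
      | nil => (p, d) :: nil
      end
  end.

(* [evolves W S um T s N p X]: um follows the crystalline evolution on [s,T],
   starting at time s from the configuration (N, p, X). *)
Inductive evolves (W : R -> R) (S : R -> Prop) (um : R -> R -> R) (T : R) :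
    R -> nat -> (nat -> R) -> (nat -> R) -> Prop :=
| evolves_last : forall s N p X x,
    s < T ->
    (forall i, (i <= N)%nat -> x i s = X i) ->
    phase W S um s T N p x ->
    evolves W S um T s N p X
| evolves_event : forall s e N p X x N' p' X',
    s < e < T ->
    (forall i, (i <= N)%nat -> x i s = X i) ->
    phase W S um s e N p x ->
    (exists i, (1 <= i <= N)%nat /\ x i e = x (i - 1)%nat e) ->
    faces N' p' X' =
      merge_faces (remove_vanished (faces N p (fun i => x i e))) ->
    evolves W S um T e N' p' X' ->
    evolves W S um T s N p X.

Definition crystalline_evolution (W : R -> R) (S : R -> Prop) (T : R)
    (N0 : nat) (p0 X0 : nat -> R) (u0m : R -> R) (um : R -> R -> R) : Prop :=
  continuous_on (rect T) (fun z : R * R => um (fst z) (snd z)) /\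
  (forall y, 0 <= y <= 1 -> um y 0 = u0m y) /\
  evolves W S um T 0 N0 p0 X0.

(* Main.v *)
Require Import Defs.
From Stdlib Require Import Reals Lra Lia Arith List Sorted ClassicalEpsilon.
From Coquelicot Require Import Coquelicot.
Open Scope R_scope.

(** The proof is a relative energy (Gronwall) estimate.  Write [g p] for
    [sqrt (1 + p^2)], [q = W' (u_x)] for the exact flux, so that the equation
    reads [u_t = g (u_x) * q_x], and define the discrete flux [sigma] as the
    continuous function, affine on every face, equal to the divided difference
    of [W] at each interior corner, to [W' a] at [0] and to [W' b] at [1].  On
    an interior face the crystalline law is exactly [v = g (p) * sigma_x]; on
    the first and on the last face the ratios [r_1] and [r_N] make it true up to
    a relative error of order [m] ([boundary_flux_ratio], [velocity_flux]).
    The energy is the integral of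

      [W (p) - W (u_x) - W' (u_x) * (p - u_x) + eps * (um - u)^2],

    where [p] is the slope of [um].  In its time derivative the contributions of
    the moving corners and an integration by parts combine into terms that
    telescope from face to face ([energy_derive]), since [sigma] is the divided
    difference of [W] at a corner and agrees with [q] at both ends.  What
    remains is [- g (p) * (sigma_x - q_x)^2] plus errors controlled by
    [|p - u_x|], [|um - u|] and [|sigma - W' (p)| = O(m)].  The negative term
    absorbs everything that contains [sigma_x], which has no a priori bound, so
    that the derivative is at most a constant times the energy plus [m]
    ([rate_pointwise_bound], [phase_energy_bound]).

    The energy depends only on the graph of [um], hence does not jump when faces
    disappear ([energy_after_event]).  It is at most of order [m] initially and
    controls the square of the H1 distance ([initial_energy_bound],
    [H1_norm_energy]), whence the rate [m^(1/2)].

    The bound [|sigma - W' (p)| = O(m)] requires that consecutive slopes remain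
    adjacent, at distance at most [m].  This follows from the fact that a face
    can only disappear when its two neighbours have the same slope
    ([vanishing_face_flat]): a vanishing block of faces whose end faces are not
    of this kind would expand at an unbounded rate.  Removal of the flat faces
    then creates no new pair of consecutive slopes ([merge_remove_chain]). *)

(** * Joint continuity and integrals with a parameter *)

(** Joint continuity on the whole plane of a function of time and space. *)
Definition cont2 (f : R -> R -> R) : Prop :=
  forall z : R * R, continuous (fun z : R * R => f (fst z) (snd z)) z.

Lemma cont2_pt f t y : cont2 f -> continuity_2d_pt f t y.
Proof. intros Hf. apply continuity_2d_pt_filterlim. apply (Hf (t, y)). Qed.

Lemma cont2_comp f (al be : R -> R) t :
  cont2 f -> continuous al t -> continuous be t ->
  continuous (fun r => f (al r) (be r)) t.
Proof.
intros Hf Ha Hb. apply (continuous_comp_2 al be f t Ha Hb). apply Hf.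
Qed.

Lemma cont2_slice f t y : cont2 f -> continuous (f t) y.
Proof.
intros Hf. apply (cont2_comp f (fun _ => t) (fun y => y)); auto.
apply continuous_const. apply continuous_id.
Qed.

Lemma cont2_ex_RInt f t a b : cont2 f -> ex_RInt (f t) a b.
Proof.
intros Hf. apply (ex_RInt_continuous (V := R_CompleteNormedModule)).
intros z _. now apply cont2_slice.
Qed.

Lemma cont2_const c : cont2 (fun _ _ => c).
Proof. intros z. apply continuous_const. Qed.

Lemma cont2_fst (f : R -> R) : (forall t, continuous f t) -> cont2 (fun t _ => f t).
Proof.
intros Hf z. apply (continuous_comp fst f). apply continuous_fst. apply Hf.
Qed.

Lemma cont2_snd (f : R -> R) : (forall t, continuous f t) -> cont2 (fun _ y => f y).
Proof.
intros Hf z. apply (continuous_comp snd f). apply continuous_snd. apply Hf.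
Qed.

Lemma cont2_app (g : R -> R) f :
  (forall t, continuous g t) -> cont2 f -> cont2 (fun t y => g (f t y)).
Proof.
intros Hg Hf z.
apply (continuous_comp (fun z : R * R => f (fst z) (snd z)) g); auto.
Qed.

Lemma cont2_plus f g : cont2 f -> cont2 g -> cont2 (fun t y => f t y + g t y).
Proof. intros Hf Hg z. apply (continuous_plus (V := R_NormedModule)); auto. Qed.

Lemma cont2_opp f : cont2 f -> cont2 (fun t y => - f t y).
Proof. intros Hf z. apply (continuous_opp (V := R_NormedModule)); auto. Qed.

Lemma cont2_minus f g : cont2 f -> cont2 g -> cont2 (fun t y => f t y - g t y).
Proof. intros Hf Hg. apply cont2_plus; auto. now apply cont2_opp. Qed.

Lemma cont2_mult f g : cont2 f -> cont2 g -> cont2 (fun t y => f t y * g t y).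
Proof. intros Hf Hg z. apply (continuous_mult (K := R_AbsRing)); auto. Qed.

Lemma cont2_pow f n : cont2 f -> cont2 (fun t y => f t y ^ n).
Proof.
intros Hf. induction n; simpl. apply cont2_const. now apply cont2_mult.
Qed.

Lemma cont2_bounded f a b c d :
  cont2 f -> exists M, 0 < M /\
    forall t y, a <= t <= b -> c <= y <= d -> Rabs (f t y) <= M.
Proof.
intros Hf.
(* A gauge below the inverse of [|f t y| + 1] turns the uniform lower bound on
   the gauge into a uniform upper bound on [|f|]. *)
assert (H : forall t y, exists del : posreal,
  (forall u v, Rabs (u - t) < del -> Rabs (v - y) < del ->
     Rabs (f u v - f t y) < 1) /\ del <= / (Rabs (f t y) + 1)).
{ intros t y. destruct (cont2_pt f t y Hf (mkposreal 1 Rlt_0_1)) as [del Hd].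
  assert (P : 0 < Rmin del (/ (Rabs (f t y) + 1))).
  { apply Rmin_pos. apply cond_pos. apply Rinv_0_lt_compat.
    generalize (Rabs_pos (f t y)); lra. }
  exists (mkposreal _ P). simpl. split.
  - intros u v Hu Hv. apply Hd; eapply Rlt_le_trans; eauto; apply Rmin_l.
  - apply Rmin_r. }
set (del := fun t y => proj1_sig (constructive_indefinite_description _ (H t y))).
assert (Hdel : forall t y,
  (forall u v, Rabs (u - t) < del t y -> Rabs (v - y) < del t y ->
     Rabs (f u v - f t y) < 1) /\ del t y <= / (Rabs (f t y) + 1)).
{ intros t y. unfold del.
  now destruct (constructive_indefinite_description _ (H t y)). }
clearbody del.
destruct (compactness_value_2d a b c d del) as [e He].
exists (/ e + 1).
assert (Pe := Rinv_0_lt_compat _ (cond_pos e)).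
split. lra.
intros t y Ht Hy. apply Rnot_lt_le. intros Hlt.
apply (He t y Ht Hy). intros (u & v & Hu & Hv & Hu' & Hv' & Hle).
destruct (Hdel u v) as [H1 H2].
assert (H3 := H1 t y Hu' Hv').
assert (H4 : Rabs (f u v) + 1 <= / e).
{ rewrite <- (Rinv_inv (Rabs (f u v) + 1)).
  apply Rinv_le_contravar. apply cond_pos. lra. }
assert (H5 : Rabs (f t y) <= Rabs (f t y - f u v) + Rabs (f u v)).
{ replace (f t y) with ((f t y - f u v) + f u v) at 1 by ring. apply Rabs_triang. }
lra.
Qed.

Lemma continuous_RInt_param_01 g t0 :
  cont2 g -> continuous (fun t => RInt (g t) 0 1) t0.
Proof.
intros Hg. apply continuity_pt_filterlim. intros eps Heps.
assert (P : 0 < eps / 2) by lra.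
destruct (uniform_continuity_2d g (t0 - 1) (t0 + 1) 0 1
  (fun x y _ _ => cont2_pt g x y Hg) (mkposreal _ P)) as [del Hd].
exists (Rmin 1 del). split.
{ apply Rmin_pos. lra. apply cond_pos. }
intros t [_ Ht]. simpl in Ht |- *. unfold R_dist in *.
assert (Ht1 : Rabs (t - t0) < 1) by (eapply Rlt_le_trans; [exact Ht|apply Rmin_l]).
assert (Ht2 : Rabs (t - t0) < del) by (eapply Rlt_le_trans; [exact Ht|apply Rmin_r]).
apply Rabs_def2 in Ht1.
replace (RInt (g t) 0 1 - RInt (g t0) 0 1)
  with (RInt (fun y => minus (g t y) (g t0 y)) 0 1).
2:{ rewrite (RInt_minus (V := R_CompleteNormedModule)). reflexivity.
    now apply cont2_ex_RInt. now apply cont2_ex_RInt. }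
apply Rle_lt_trans with ((1 - 0) * (eps / 2)); [|lra].
apply abs_RInt_le_const. lra.
{ apply (ex_RInt_minus (V := R_NormedModule)); now apply cont2_ex_RInt. }
intros y Hy. left. apply Hd; try lra; simpl.
replace (y - y) with 0 by ring. rewrite Rabs_R0. apply cond_pos.
Qed.

Lemma continuous_RInt_bounds_param f al be t0 :
  cont2 f -> (forall t, continuous al t) -> (forall t, continuous be t) ->
  continuous (fun t => RInt (f t) (al t) (be t)) t0.
Proof.
intros Hf Ha Hb.
assert (Hd : forall t, continuous (fun t => be t - al t) t).
{ intros t. apply (continuous_minus (V := R_NormedModule)); auto. }
(* an affine change of variable reduces to fixed bounds *)
apply continuous_ext with
  (fun t => RInt (fun th => (be t - al t) * f t ((be t - al t) * th + al t)) 0 1).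
{ intros t.
  etransitivity.
  apply (RInt_comp_lin (V := R_CompleteNormedModule) (f t) (be t - al t) (al t) 0 1).
  - now apply cont2_ex_RInt.
  - f_equal; ring. }
apply (continuous_RInt_param_01
  (fun t th => (be t - al t) * f t ((be t - al t) * th + al t))).
apply cont2_mult. now apply cont2_fst with (f := fun t => be t - al t).
intros z.
apply (continuous_comp_2 (fun z : R * R => fst z)
  (fun z : R * R => (be (fst z) - al (fst z)) * snd z + al (fst z)) f z).
apply continuous_fst.
2: apply Hf.
apply (continuous_plus (V := R_NormedModule)).
apply (continuous_mult (K := R_AbsRing)).
apply (cont2_fst _ Hd z). apply continuous_snd. apply (cont2_fst _ Ha z).
Qed.

(** Differentiation of an integral whose bounds and integrand depend on time. *)
Lemma is_derive_RInt_moving f ft al be s e t da db :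
  s < t < e ->
  (forall r y, s < r < e -> is_derive (fun r => f r y) r (ft r y)) ->
  (forall r y, s < r < e -> continuity_2d_pt f r y) ->
  (forall r y, s < r < e -> continuity_2d_pt ft r y) ->
  is_derive al t da -> is_derive be t db ->
  is_derive (fun r => RInt (f r) (al r) (be r)) t
    (RInt (ft t) (al t) (be t) + f t (be t) * db - f t (al t) * da).
Proof.
intros Ht Hd Hc Hct Ha Hb.
assert (Hloc : locally t (fun r => s < r < e)).
{ apply (open_and (fun r => s < r) (fun r => r < e)).
  apply open_gt. apply open_lt. exact Ht. }
assert (Hslice : forall r y, s < r < e -> continuous (f r) y).
{ intros r y Hr.
  apply (continuous_comp_2 (fun _ => r) (fun y : R => y) f y).
  apply continuous_const. apply continuous_id.
  apply (proj1 (continuity_2d_pt_filterlim f r y)). now apply Hc. }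
assert (Hex : forall a b, locally t (fun r => ex_RInt (fun y => f r y) a b)).
{ intros a b. generalize Hloc. apply filter_imp. intros r Hr.
  apply (ex_RInt_continuous (V := R_CompleteNormedModule)). intros y _. now apply Hslice. }
assert (Hdl : forall y, locally_2d
  (fun r y => continuity_2d_pt (fun u v => Derive (fun z => f z v) u) r y) t y).
{ intros y.
  destruct Hloc as [del Hdel].
  assert (P : 0 < del / 2) by (generalize (cond_pos del); lra).
  exists (mkposreal _ P). intros u v Hu _. simpl in Hu.
  apply continuity_2d_pt_ext_loc with ft.
  - exists (mkposreal _ P). intros u' v' Hu' _. simpl in Hu'.
    symmetry. apply is_derive_unique. apply Hd. apply Hdel.
    replace (pos del) with (del / 2 + del / 2) by lra.
    apply ball_triangle with u.
    exact Hu. exact Hu'.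
  - apply Hct. apply Hdel. unfold ball; simpl; unfold AbsRing_ball, abs, minus; simpl.
    unfold plus, opp; simpl. fold (u - t). lra. }
assert (P1 : 0 < 1) by lra.
evar_last.
apply (is_derive_RInt_param_bound_comp f al be t da db).
- apply Hex.
- exists (mkposreal 1 P1). apply Hex.
- exists (mkposreal 1 P1). apply Hex.
- exact Ha.
- exact Hb.
- exists (mkposreal 1 P1). generalize Hloc. apply filter_imp. intros r Hr y _.
  exists (ft r y). now apply Hd.
- intros y _. apply (locally_2d_singleton _ _ _ (Hdl y)).
- apply Hdl.
- apply Hdl.
- apply continuity_pt_filterlim. now apply Hslice.
- apply continuity_pt_filterlim. now apply Hslice.
- rewrite (RInt_ext (fun y => Derive (fun u => f u y) t) (ft t)). ring.
  intros y _. apply is_derive_unique. now apply Hd.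
Qed.

(** Fundamental theorem of calculus, with differentiability required only in
    the open interval. *)
Lemma RInt_derive_interior (f df : R -> R) (a b : R) :
  a <= b ->
  (forall x, a < x < b -> is_derive f x (df x)) ->
  (forall x, continuous f x) -> (forall x, continuous df x) ->
  RInt df a b = f b - f a.
Proof.
intros Hab Hd Hf Hdf.
destruct (MVT_gen (fun x => RInt df a x - f x) a b (fun _ => 0)) as (c & _ & Hc).
- rewrite Rmin_left, Rmax_right by lra. intros x Hx.
  evar_last. apply (is_derive_minus (V := R_NormedModule)).
  apply (is_derive_RInt df (RInt df a) a).
  apply filter_forall. intros y. apply (RInt_correct (V := R_CompleteNormedModule)).
  apply (ex_RInt_continuous (V := R_CompleteNormedModule)). intros; apply Hdf. apply Hdf.
  apply Hd; lra. unfold minus, plus, opp; simpl. ring.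
- intros x _. apply continuity_pt_filterlim.
  apply (continuous_minus (V := R_NormedModule)); [|apply Hf].
  apply (filterdiff_continuous (U := R_NormedModule) (V := R_NormedModule)). eexists.
  apply (is_derive_RInt df (RInt df a) a).
  apply filter_forall. intros y. apply (RInt_correct (V := R_CompleteNormedModule)).
  apply (ex_RInt_continuous (V := R_CompleteNormedModule)). intros; apply Hdf. apply Hdf.
- rewrite RInt_point in Hc. unfold zero in Hc; simpl in Hc. lra.
Qed.

(** Gronwall's inequality in differential form. *)
Lemma gronwall (f df : R -> R) (C K a b : R) :
  a <= b ->
  (forall x, a < x < b -> is_derive f x (df x)) ->
  (forall x, a < x < b -> df x <= C * f x + C * K) ->
  (forall x, continuous f x) ->
  f b + K <= (f a + K) * exp (C * (b - a)).
Proof.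
intros Hab Hd Hle Hf.
(* Outside the open interval the derivative is set to zero, so that the
   intermediate point may be an end point. *)
destruct (MVT_gen (fun x => (f x + K) * exp (- C * (x - a))) a b
  (fun x => if Rlt_dec a x then if Rlt_dec x b then
     (df x - C * (f x + K)) * exp (- C * (x - a)) else 0 else 0)) as (c & Hc & E).
- rewrite Rmin_left, Rmax_right by lra. intros x Hx.
  destruct (Rlt_dec a x); [|lra]. destruct (Rlt_dec x b); [|lra].
  auto_derive. exists (df x). now apply Hd.
  replace (Derive (fun x0 : R => f x0) x) with (df x)
    by (symmetry; now apply is_derive_unique, Hd). unfold Rminus. ring.
- intros x _. apply continuity_pt_mult.
  apply continuity_pt_plus. apply continuity_pt_filterlim, Hf.
  apply continuity_pt_const. intros ? ?; reflexivity.
  apply derivable_continuous_pt. apply ex_derive_Reals_0. auto_derive. auto.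
- replace (a - a) with 0 in E by ring. rewrite Rmult_0_r, exp_0, Rmult_1_r in E.
  assert (G : (f b + K) * exp (- C * (b - a)) <= f a + K).
  { assert (N : (if Rlt_dec a c then if Rlt_dec c b then
       (df c - C * (f c + K)) * exp (- C * (c - a)) else 0 else 0) <= 0).
    { destruct (Rlt_dec a c); [|lra]. destruct (Rlt_dec c b); [|lra].
      assert (H1 := exp_pos (- C * (c - a))). assert (H2 := Hle c (conj r r0)).
      nra. }
    nra. }
  replace (f b + K) with ((f b + K) * exp (- C * (b - a)) * exp (C * (b - a))).
  apply Rmult_le_compat_r; [left; apply exp_pos|exact G].
  rewrite Rmult_assoc, <- exp_plus.
  replace (- C * (b - a) + C * (b - a)) with 0 by ring. rewrite exp_0. ring.
Qed.

(** * Extension of functions given on a closed interval or rectangle *)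

(** Projection of the real line onto the interval [lo, hi]. *)
Definition clamp (lo hi x : R) : R := Rmax lo (Rmin hi x).

Lemma clamp_in lo hi x : lo <= hi -> lo <= clamp lo hi x <= hi.
Proof.
intros H. unfold clamp. split. apply Rmax_l. apply Rmax_lub; auto. apply Rmin_l.
Qed.

Lemma clamp_id lo hi x : lo <= x <= hi -> clamp lo hi x = x.
Proof.
intros H. unfold clamp. rewrite Rmin_right by lra. apply Rmax_right. lra.
Qed.

Lemma clamp_continuous lo hi x : continuous (clamp lo hi) x.
Proof.
apply continuity_pt_filterlim. intros eps Heps. exists eps. split; auto.
intros y [_ Hy]. simpl in *. unfold R_dist in *. apply Rle_lt_trans with (2 := Hy).
unfold clamp, Rmax, Rmin.
repeat destruct Rle_dec; unfold Rabs; repeat destruct Rcase_abs; lra.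
Qed.

Lemma continuous_on_comp {U V X : UniformSpace} (P : V -> Prop)
  (f : V -> X) (g : U -> V) (z : U) :
  continuous_on P f -> (forall z, P (g z)) -> continuous g z ->
  continuous (fun z => f (g z)) z.
Proof.
intros Hf Hg Hc. apply filterlim_comp with (within P (locally (g z))).
2: apply Hf, Hg.
intros Q HQ. specialize (Hc _ HQ). unfold filtermap in *. revert Hc. apply filter_imp.
intros y Hy. exact (Hy (Hg y)).
Qed.

Lemma continuous_clamp_time (f : R -> R) s e t :
  s <= e -> continuous_on (fun t => s <= t <= e) f ->
  continuous (fun r => f (clamp s e r)) t.
Proof.
intros Hse Hf.
apply (continuous_on_comp (U := R_UniformSpace) (V := R_UniformSpace)
  (fun t => s <= t <= e) f (clamp s e)).
exact Hf. intros z. now apply clamp_in. apply clamp_continuous.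
Qed.

Lemma is_derive_within_interior lo hi f x l :
  lo < x < hi -> is_derive_within lo hi f x l -> is_derive f x l.
Proof.
intros Hx H. apply is_derive_Reals. intros eps Heps.
destruct (H (fun z => Rabs (z - l) < eps)) as [del Hdel].
{ exists (mkposreal eps Heps). intros z Hz. exact Hz. }
assert (P : 0 < Rmin del (Rmin (x - lo) (hi - x))).
{ repeat apply Rmin_pos; try lra. apply cond_pos. }
exists (mkposreal _ P). simpl. intros h Hh Hlt.
assert (L1 := Rlt_le_trans _ _ _ Hlt (Rmin_l _ _)).
assert (L2 := Rlt_le_trans _ _ _ Hlt (Rmin_r _ _)).
assert (L3 := Rlt_le_trans _ _ _ L2 (Rmin_l _ _)).
assert (L4 := Rlt_le_trans _ _ _ L2 (Rmin_r _ _)).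
apply Rabs_def2 in L3. apply Rabs_def2 in L4.
specialize (Hdel (x + h)). replace (x + h - x) with h in Hdel by ring.
apply Hdel; try lra.
unfold ball; simpl; unfold AbsRing_ball, abs, minus, plus, opp; simpl.
replace (x + h + - x) with h by ring. exact L1.
Qed.

(** Extension to all times and positions of a function of position and time
    given on the rectangle, constant outside of it; time becomes the first
    argument. *)
Definition extend (T : R) (f : R -> R -> R) (t y : R) : R :=
  f (clamp 0 1 y) (clamp 0 T t).

Lemma extend_id T f t y : 0 <= t <= T -> 0 <= y <= 1 -> extend T f t y = f y t.
Proof. intros Ht Hy. unfold extend. now rewrite !clamp_id. Qed.

Lemma cont2_extend T f :
  0 <= T -> continuous_on (rect T) (fun z : R * R => f (fst z) (snd z)) ->
  cont2 (extend T f).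
Proof.
intros HT Hf z.
apply (continuous_on_comp (U := prod_UniformSpace R_UniformSpace R_UniformSpace)
  (V := prod_UniformSpace R_UniformSpace R_UniformSpace) (rect T)
  (fun z : R * R => f (fst z) (snd z))
  (fun z => (clamp 0 1 (snd z), clamp 0 T (fst z))) z).
- exact Hf.
- intros [t y]. split; simpl; apply clamp_in; lra.
- apply (continuous_comp_2 (fun z : R * R => clamp 0 1 (snd z))
    (fun z : R * R => clamp 0 T (fst z)) (fun x y => (x, y))).
  apply (cont2_snd (clamp 0 1)), clamp_continuous.
  apply (cont2_fst (clamp 0 T)), clamp_continuous.
  apply continuous_ext with (fun z => z). now intros []. apply continuous_id.
Qed.

Lemma extend_derive_t T f ft t y :
  (forall x t, rect T (x, t) -> is_derive_within 0 T (fun r => f x r) t (ft x t)) ->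
  0 < t < T -> is_derive (fun r => extend T f r y) t (extend T ft t y).
Proof.
intros H Ht. unfold extend.
assert (Hy := clamp_in 0 1 y Rle_0_1).
rewrite (clamp_id 0 T t) by lra.
apply is_derive_ext_loc with (fun r => f (clamp 0 1 y) r).
- apply (locally_interval _ t 0 T); try apply Ht.
  intros r H1 H2; simpl in H1, H2. rewrite (clamp_id 0 T r) by lra; reflexivity.
- apply (is_derive_within_interior 0 T). exact Ht. apply H. split; simpl; lra.
Qed.

Lemma extend_derive_y T f fx t y :
  0 <= T ->
  (forall x t, rect T (x, t) -> is_derive_within 0 1 (fun z => f z t) x (fx x t)) ->
  0 < y < 1 -> is_derive (extend T f t) y (extend T fx t y).
Proof.
intros HT H Hy. unfold extend.
assert (Ht := clamp_in 0 T t HT).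
rewrite (clamp_id 0 1 y) by lra.
apply is_derive_ext_loc with (fun z => f z (clamp 0 T t)).
- apply (locally_interval _ y 0 1); try apply Hy.
  intros r H1 H2; simpl in H1, H2. rewrite (clamp_id 0 1 r) by lra; reflexivity.
- apply (is_derive_within_interior 0 1 (fun z => f z (clamp 0 T t))).
  exact Hy. apply H. split; simpl; lra.
Qed.

(** * Intervals are not null sets *)

(** If [lo, hi] is covered by countably many open intervals, its length does
    not exceed every upper bound of the partial sums of their lengths. *)
Lemma interval_cover_length (lo hi : nat -> R) al be K :
  al <= be -> (forall n, lo n <= hi n) ->
  (forall x, al <= x <= be -> exists n, lo n < x < hi n) ->
  (forall n, sum_n (fun k => hi k - lo k) n <= K) ->
  be - al <= K.
Proof.
intros Hab Hlh Hcov HK.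
(* [part x n] is the total length of the first [n] intervals to the left of [x];
   the points [x] such that [x - al <= part x n] for some [n] reach up to [be]. *)
set (part := fun (x : R) (n : nat) => (sum_n (fun k => Rmax 0 (Rmin x (hi k) - lo k)) n) : R).
assert (Hterm : forall x k, Rmax 0 (Rmin x (hi k) - lo k) <= hi k - lo k).
{ intros x k. apply Rmax_lub. specialize (Hlh k); lra.
  generalize (Rmin_r x (hi k)); lra. }
assert (Hmono : forall x y k, x <= y ->
  Rmax 0 (Rmin x (hi k) - lo k) <= Rmax 0 (Rmin y (hi k) - lo k)).
{ intros x y k Hxy. apply Rle_max_compat_l.
  unfold Rmin; repeat destruct Rle_dec; lra. }
assert (Hsum : forall f g n, (forall k, f k <= g k) -> sum_n f n <= sum_n g n).
{ intros f g n H. apply sum_n_m_le. exact H. }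
assert (Hn : forall x n n', (n <= n')%nat -> part x n <= part x n').
{ intros x n n' H. induction H. lra.
  unfold part in *. rewrite sum_Sn. unfold plus; simpl.
  generalize (Rmax_l 0 (Rmin x (hi (S m)) - lo (S m))). lra. }
set (E := fun x => al <= x <= be /\ exists n, x - al <= part x n).
assert (Eal : E al).
{ split. lra. exists 0%nat. unfold part. rewrite sum_O.
  replace (al - al) with 0 by ring. apply Rmax_l. }
destruct (completeness E) as [m [Hub Hlub]].
{ exists be. intros x [Hx _]. lra. }
{ now exists al. }
assert (Hm : al <= m <= be).
{ split. now apply Hub. apply Hlub. intros x [Hx _]. lra. }
destruct (Hcov m Hm) as [n [Hn1 Hn2]].
destruct (Classical_Prop.classic (exists x, E x /\ lo n < x)) as [[x [[Hx [n1 Hx1]] Hlx]]|Hno].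
2:{ exfalso. assert (m <= lo n); [|lra].
  apply Hlub. intros x Hx. apply Rnot_lt_le. intros Hlt. apply Hno. now exists x. }
assert (Hxm : x <= m) by (apply Hub; split; [exact Hx|now exists n1]).
set (y := Rmin be ((m + hi n) / 2)).
assert (Hy : x <= y /\ y <= be /\ y <= hi n /\ m <= y).
{ unfold y, Rmin. destruct Rle_dec; lra. }
assert (Hstep : forall N, (n <= N)%nat -> y - x <= part y N - part x N).
{ intros N HN. unfold part.
  assert (G : forall N, 0 <= sum_n (fun k => Rmax 0 (Rmin y (hi k) - lo k)) N
     - sum_n (fun k => Rmax 0 (Rmin x (hi k) - lo k)) N).
  { intros N'. apply Rge_le, Rge_minus, Rle_ge. apply Hsum. intros k. now apply Hmono. }
  assert (Hnn : y - x <= Rmax 0 (Rmin y (hi n) - lo n) - Rmax 0 (Rmin x (hi n) - lo n)).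
  { rewrite (Rmin_left y) by lra. rewrite (Rmin_left x) by lra.
    rewrite (Rmax_right 0 (x - lo n)) by lra. rewrite Rmax_right by lra. lra. }
  induction HN.
  - destruct n as [|n']. rewrite !sum_O. exact Hnn.
    rewrite !sum_Sn. unfold plus; simpl. specialize (G n'). lra.
  - rewrite !sum_Sn. unfold plus; simpl.
    assert (Hm' := Hmono x y (S m0) (proj1 Hy)). lra. }
assert (Ey : exists N, y - al <= part y N).
{ exists (Nat.max n n1). assert (S1 := Hstep _ (Nat.le_max_l n n1)).
  assert (S2 := Hn x _ _ (Nat.le_max_r n n1)). lra. }
assert (Hym : y <= m). { apply Hub. split. lra. exact Ey. }
assert (Hyb : y = be).
{ unfold y, Rmin in *. destruct Rle_dec; lra. }
destruct Ey as [N HN]. rewrite Hyb in HN.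
apply Rle_trans with (1 := HN). apply Rle_trans with (2 := HK N).
apply Hsum. intros k. apply Hterm.
Qed.

Lemma interval_not_null E al be :
  al < be -> (forall x, al < x < be -> E x) -> ~ null_set E.
Proof.
intros Hab HE Hnull.
destruct (Hnull ((be - al) / 4)) as (lo & hi & Hlh & Hcov & Hsum). lra.
assert (H : (al + 3 * be) / 4 - (3 * al + be) / 4 <= (be - al) / 4).
{ apply (interval_cover_length lo hi); auto. lra.
  intros x Hx. apply Hcov, HE. lra. }
lra.
Qed.

(** An essential bound on a function that is continuous near [x] holds at [x]. *)
Lemma Linf_bound_pointwise f g M al be x :
  0 <= al -> be <= 1 -> al < x < be ->
  Linf_norm_le f M -> (forall y, al < y < be -> f y = g y) -> continuous g x ->
  Rabs (g x) <= M.
Proof.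
intros Ha Hb Hx HL Hfg Hg. apply Rnot_lt_le. intros Hlt.
assert (P : 0 < Rabs (g x) - M) by lra.
assert (Hl : locally x (fun y => al < y < be /\ Rabs (g y - g x) < Rabs (g x) - M)).
{ apply filter_and.
  apply (locally_interval _ x al be); try apply Hx. intros y H1 H2. now split.
  apply (Hg (fun z => Rabs (z - g x) < Rabs (g x) - M)).
  exists (mkposreal _ P). intros z Hz. exact Hz. }
destruct Hl as [del Hdel].
apply (interval_not_null (fun x => 0 <= x <= 1 /\ ~ Rabs (f x) <= M) (x - del) (x + del)).
- generalize (cond_pos del); lra.
- intros y Hy. destruct (Hdel y) as [H1 H2].
  { unfold ball; simpl; unfold AbsRing_ball, abs, minus, plus, opp; simpl.
    apply Rabs_def1; lra. }
  split. lra. rewrite Hfg by exact H1. intros H3.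
  assert (H4 := Rabs_triang_inv (g x) (g x - g y)).
  replace (g x - (g x - g y)) with (g y) in H4 by ring.
  rewrite (Rabs_minus_sym (g x)) in H4. lra.
- exact HL.
Qed.

(** * Finite sums over the faces *)

(** The sum [f 1 + ... + f n]. *)
Fixpoint fsum (f : nat -> R) (n : nat) : R :=
  match n with O => 0 | S k => fsum f k + f (S k) end.

Lemma fsum_ext f g n :
  (forall i, (1 <= i <= n)%nat -> f i = g i) -> fsum f n = fsum g n.
Proof.
induction n as [|n IH]; intros H; simpl; auto.
rewrite IH by (intros; apply H; lia). rewrite H by lia. reflexivity.
Qed.

Lemma fsum_le f g n :
  (forall i, (1 <= i <= n)%nat -> f i <= g i) -> fsum f n <= fsum g n.
Proof.
induction n as [|n IH]; intros H; simpl. lra.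
apply Rplus_le_compat. apply IH; intros; apply H; lia. apply H; lia.
Qed.

Lemma fsum_plus f g n : fsum (fun i => f i + g i) n = fsum f n + fsum g n.
Proof. induction n as [|n IH]; simpl; [lra|rewrite IH; lra]. Qed.

Lemma fsum_scal c f n : fsum (fun i => c * f i) n = c * fsum f n.
Proof. induction n as [|n IH]; simpl; [lra|rewrite IH; lra]. Qed.

Lemma fsum_telescope (A : nat -> R) n :
  fsum (fun i => A i - A (i - 1)%nat) n = A n - A 0%nat.
Proof.
induction n as [|n IH]; simpl. lra. rewrite IH, Nat.sub_0_r. lra.
Qed.

(** Telescoping of terms attached to the right and left ends of the faces. *)
Lemma fsum_telescope_ends (r l : nat -> R) n :
  (1 <= n)%nat -> (forall i, (1 <= i < n)%nat -> l (i + 1)%nat = r i) ->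
  fsum (fun i => r i - l i) n = r n - l 1%nat.
Proof.
induction n as [|n IH]; intros Hn H. lia.
destruct n as [|n]. simpl; lra.
simpl fsum in *. rewrite IH; try lia.
assert (E := H (S n)). replace (S n + 1)%nat with (S (S n)) in E by lia.
rewrite E by lia. lra.
intros i Hi. apply H; lia.
Qed.

Lemma is_derive_fsum (f df : nat -> R -> R) n t :
  (forall i, (1 <= i <= n)%nat -> is_derive (f i) t (df i t)) ->
  is_derive (fun r => fsum (fun i => f i r) n) t (fsum (fun i => df i t) n).
Proof.
induction n as [|n IH]; intros H; simpl. apply (is_derive_const (V := R_NormedModule)).
apply (is_derive_plus (V := R_NormedModule)).
apply IH; intros; apply H; lia. apply H; lia.
Qed.

Lemma continuous_fsum (f : nat -> R -> R) n t :
  (forall i, (1 <= i <= n)%nat -> continuous (f i) t) ->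
  continuous (fun r => fsum (fun i => f i r) n) t.
Proof.
induction n as [|n IH]; intros H; simpl. apply continuous_const.
apply (continuous_plus (V := R_NormedModule)).
apply IH; intros; apply H; lia. apply H; lia.
Qed.

Lemma fsum_RInt_Chasles (f : R -> R) (X : nat -> R) n :
  (forall i, (1 <= i <= n)%nat -> ex_RInt f (X (i - 1)%nat) (X i)) ->
  is_RInt f (X 0%nat) (X n) (fsum (fun i => RInt f (X (i - 1)%nat) (X i)) n).
Proof.
induction n as [|n IH]; intros H; simpl.
apply (is_RInt_point (V := R_NormedModule)).
rewrite Nat.sub_0_r. apply (is_RInt_Chasles (V := R_NormedModule)) with (X n).
apply IH; intros; apply H; lia.
apply (RInt_correct (V := R_CompleteNormedModule)).
specialize (H (S n)). simpl in H. rewrite Nat.sub_0_r in H. apply H; lia.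
Qed.

(** * Taylor estimates for the energy density *)

Lemma mean_value_bound (f df : R -> R) p q B :
  (forall x, is_derive f x (df x)) ->
  (forall x, Rmin q p <= x <= Rmax q p -> Rabs (df x) <= B) ->
  Rabs (f p - f q) <= B * Rabs (p - q).
Proof.
intros Hd HB. destruct (MVT_gen f q p df) as (c & Hc & E).
- intros x _. apply Hd.
- intros x _. apply continuity_pt_filterlim.
  apply (filterdiff_continuous (U := R_NormedModule) (V := R_NormedModule)).
  eexists. apply Hd.
- rewrite E, Rabs_mult. apply Rmult_le_compat_r. apply Rabs_pos. now apply HB.
Qed.

Lemma between_abs p q c K :
  Rabs p <= K -> Rabs q <= K -> Rmin q p <= c <= Rmax q p ->
  Rabs c <= K /\ Rabs (c - q) <= Rabs (p - q).
Proof.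
unfold Rmin, Rmax; destruct Rle_dec; unfold Rabs; repeat destruct Rcase_abs; lra.
Qed.

(** Taylor estimates for [W] and [W'] on [-K, K] with a common constant [La],
    and uniform convexity with constant [la]. *)
Definition taylor_bounds (W : R -> R) (K la La : R) : Prop :=
  0 < la /\ 0 < La /\ forall p q, Rabs p <= K -> Rabs q <= K ->
    la * (p - q) ^ 2 <= W p - W q - Derive W q * (p - q) <= La * (p - q) ^ 2 /\
    Rabs (Derive W p - Derive W q - Derive_n W 2 q * (p - q)) <= La * (p - q) ^ 2 /\
    Rabs (W p - W q - Derive W q * (p - q) - Derive_n W 2 q / 2 * (p - q) ^ 2)
      <= La * Rabs (p - q) ^ 3.

Lemma is_derive_linear (c x : R) : is_derive (fun x => c * x) x c.
Proof. auto_derive; auto; ring. Qed.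

Lemma is_derive_square (c q x : R) :
  is_derive (fun x => c / 2 * (x - q) ^ 2) x (c * (x - q)).
Proof. auto_derive; auto; field. Qed.

Section Energy_density.

Variables (W : R -> R) (W_C3 : C3 W) (W_pos : forall x, 0 < Derive_n W 2 x).

Lemma W_derive x : is_derive W x (Derive W x).
Proof. apply Derive_correct. apply (proj1 W_C3 1%nat x). lia. Qed.

Lemma W_derive2 x : is_derive (Derive W) x (Derive_n W 2 x).
Proof. apply (Derive_correct (Derive W) x). apply (proj1 W_C3 2%nat x). lia. Qed.

Lemma W_derive3 x : is_derive (Derive_n W 2) x (Derive_n W 3 x).
Proof. apply (Derive_correct (Derive_n W 2) x). apply (proj1 W_C3 3%nat x). lia. Qed.

Lemma is_derive_continuous (f : R -> R) x l : is_derive f x l -> continuous f x.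
Proof.
intros H. apply (filterdiff_continuous (U := R_NormedModule) (V := R_NormedModule)).
eexists. exact H.
Qed.

Lemma W_continuous x : continuous W x.
Proof. eapply is_derive_continuous, W_derive. Qed.
Lemma W1_continuous x : continuous (Derive W) x.
Proof. eapply is_derive_continuous, W_derive2. Qed.
Lemma W2_continuous x : continuous (Derive_n W 2) x.
Proof. eapply is_derive_continuous, W_derive3. Qed.

Lemma taylor_bounds_exist K : 0 <= K -> exists la La, taylor_bounds W K la La.
Proof.
intros HK.
destruct (continuity_ab_min (Derive_n W 2) (- K) K) as (x0 & Hmin & _). lra.
{ intros; apply continuity_pt_filterlim, W2_continuous. }
destruct (bounded_continuity (V := R_NormedModule) (Derive_n W 2) (- K) K) as (M2 & HM2).
{ intros; apply W2_continuous. }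
destruct (bounded_continuity (V := R_NormedModule) (Derive_n W 3) (- K) K) as (M3 & HM3).
{ intros; apply (proj2 W_C3). }
assert (HM2' : forall x, Rabs x <= K -> Rabs (Derive_n W 2 x) <= M2).
{ intros x Hx. left. apply HM2. now apply Rabs_le_between. }
assert (HM3' : forall x, Rabs x <= K -> Rabs (Derive_n W 3 x) <= M3).
{ intros x Hx. left. apply HM3. now apply Rabs_le_between. }
assert (H0 : Rabs 0 <= K) by (rewrite Rabs_R0; lra).
assert (M2p := Rle_trans _ _ _ (Rabs_pos _) (HM2' 0 H0)).
assert (M3p := Rle_trans _ _ _ (Rabs_pos _) (HM3' 0 H0)).
(* each estimate is the mean value bound, with an earlier one for the derivative *)
assert (L2 : forall p q, Rabs p <= K -> Rabs q <= K ->
  Rabs (Derive_n W 2 p - Derive_n W 2 q) <= M3 * Rabs (p - q)).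
{ intros p q Hp Hq. apply mean_value_bound with (Derive_n W 3). apply W_derive3.
  intros x Hx. apply HM3'. now apply (between_abs p q). }
assert (L1 : forall p q, Rabs p <= K -> Rabs q <= K ->
  Rabs (Derive W p - Derive W q) <= M2 * Rabs (p - q)).
{ intros p q Hp Hq. apply mean_value_bound with (Derive_n W 2). apply W_derive2.
  intros x Hx. apply HM2'. now apply (between_abs p q). }
assert (Q1 : forall p q, Rabs p <= K -> Rabs q <= K ->
  Rabs (Derive W p - Derive W q - Derive_n W 2 q * (p - q)) <= M3 * (p - q) ^ 2).
{ intros p q Hp Hq. rewrite <- pow2_abs.
  replace (Derive W p - Derive W q - Derive_n W 2 q * (p - q)) with
   ((Derive W p - Derive_n W 2 q * p) - (Derive W q - Derive_n W 2 q * q)) by ring.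
  replace (M3 * Rabs (p - q) ^ 2) with (M3 * Rabs (p - q) * Rabs (p - q)) by ring.
  apply mean_value_bound with (f := fun x => Derive W x - Derive_n W 2 q * x)
    (df := fun x => Derive_n W 2 x - Derive_n W 2 q).
  - intros x. apply (is_derive_minus (V := R_NormedModule)). apply W_derive2.
    apply is_derive_linear.
  - intros x Hx. destruct (between_abs p q x K) as [B1 B2]; auto.
    eapply Rle_trans. apply L2; auto. apply Rmult_le_compat_l; auto. }
assert (Q0 : forall p q, Rabs p <= K -> Rabs q <= K ->
  Rabs (W p - W q - Derive W q * (p - q)) <= M2 * (p - q) ^ 2).
{ intros p q Hp Hq. rewrite <- pow2_abs.
  replace (W p - W q - Derive W q * (p - q)) with
   ((W p - Derive W q * p) - (W q - Derive W q * q)) by ring.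
  replace (M2 * Rabs (p - q) ^ 2) with (M2 * Rabs (p - q) * Rabs (p - q)) by ring.
  apply mean_value_bound with (f := fun x => W x - Derive W q * x)
    (df := fun x => Derive W x - Derive W q).
  - intros x. apply (is_derive_minus (V := R_NormedModule)). apply W_derive.
    apply is_derive_linear.
  - intros x Hx. destruct (between_abs p q x K) as [B1 B2]; auto.
    eapply Rle_trans. apply L1; auto. apply Rmult_le_compat_l; auto. }
assert (C0 : forall p q, Rabs p <= K -> Rabs q <= K ->
  Rabs (W p - W q - Derive W q * (p - q) - Derive_n W 2 q / 2 * (p - q) ^ 2)
   <= M3 * Rabs (p - q) ^ 3).
{ intros p q Hp Hq.
  replace (W p - W q - Derive W q * (p - q) - Derive_n W 2 q / 2 * (p - q) ^ 2) with
   ((W p - Derive W q * p - Derive_n W 2 q / 2 * (p - q) ^ 2) -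
    (W q - Derive W q * q - Derive_n W 2 q / 2 * (q - q) ^ 2)) by field.
  replace (M3 * Rabs (p - q) ^ 3) with (M3 * Rabs (p - q) ^ 2 * Rabs (p - q)) by ring.
  apply mean_value_bound with
    (f := fun x => W x - Derive W q * x - Derive_n W 2 q / 2 * (x - q) ^ 2)
    (df := fun x => (Derive W x - Derive W q) - Derive_n W 2 q * (x - q)).
  - intros x. apply (is_derive_minus (V := R_NormedModule)).
    apply (is_derive_minus (V := R_NormedModule)). apply W_derive.
    apply is_derive_linear. apply is_derive_square.
  - intros x Hx. destruct (between_abs p q x K) as [B1 B2]; auto.
    eapply Rle_trans. apply Q1; auto. apply Rmult_le_compat_l; auto.
    rewrite <- (pow2_abs (x - q)). apply pow_incr. split; auto. apply Rabs_pos. }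
assert (Lpos := W_pos x0).
exists (Derive_n W 2 x0 / 2), (M2 + M3 + 1).
split; [lra|split; [lra|]]. intros p q Hp Hq.
assert (Psq := pow2_ge_0 (p - q)).
repeat split.
- assert (Hd : forall x : R, is_derive
    (fun x : R => W x - Derive W q * x - Derive_n W 2 x0 / 2 * (x - q) ^ 2) x
    (Derive W x - Derive W q - Derive_n W 2 x0 * (x - q))).
  { intros x. apply (is_derive_minus (V := R_NormedModule)).
    2: apply is_derive_square.
    apply (is_derive_minus (V := R_NormedModule)). apply W_derive.
    apply is_derive_linear. }
  destruct (MVT_gen (fun x => W x - Derive W q * x - Derive_n W 2 x0 / 2 * (x - q) ^ 2) q p
    (fun x => Derive W x - Derive W q - Derive_n W 2 x0 * (x - q))) as (c & Hc & E).
  + intros x _. apply Hd.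
  + intros x _. apply continuity_pt_filterlim. exact (is_derive_continuous _ _ _ (Hd x)).
  + destruct (MVT_gen (Derive W) q c (Derive_n W 2)) as (d & Hdc & E2).
    * intros; apply W_derive2.
    * intros; apply continuity_pt_filterlim, W1_continuous.
    * destruct (between_abs p q c K) as [Bc _]; auto.
      destruct (between_abs c q d K) as [Bd _]; auto.
      assert (Hm := Hmin d (proj1 (Rabs_le_between _ _) Bd)).
      assert (S : 0 <= (c - q) * (p - q)).
      { revert Hc. unfold Rmin, Rmax; destruct Rle_dec; intros; nra. }
      rewrite E2 in E.
      replace (W p - W q - Derive W q * (p - q)) with
        (Derive_n W 2 x0 / 2 * (p - q) ^ 2 +
         (Derive_n W 2 d - Derive_n W 2 x0) * ((c - q) * (p - q))).
      2:{ replace (q - q) with 0 in E by ring. ring_simplify in E. ring_simplify. lra. }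
      assert (0 <= (Derive_n W 2 d - Derive_n W 2 x0) * ((c - q) * (p - q))).
      { apply Rmult_le_pos; lra. }
      lra.
- assert (G := Rle_trans _ _ _ (Rle_abs _) (Q0 p q Hp Hq)). nra.
- eapply Rle_trans. now apply Q1. apply Rmult_le_compat_r; lra.
- eapply Rle_trans. now apply C0. apply Rmult_le_compat_r; try lra.
  apply pow_le, Rabs_pos.
Qed.

End Energy_density.

(** The divided difference of [W] between [p] and [q]: the flux at a corner
    with slopes [p] and [q]. *)
Definition divdiff (W : R -> R) (p q : R) : R := (W q - W p) / (q - p).

Lemma divdiff_sym W p q : p <> q -> divdiff W p q = divdiff W q p.
Proof. intros H. unfold divdiff. field. lra. Qed.

Lemma divdiff_close W K la La p q :
  taylor_bounds W K la La -> p <> q -> Rabs p <= K -> Rabs q <= K ->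
  Rabs (divdiff W p q - Derive W p) <= La * Rabs (q - p).
Proof.
intros (Pl & PL & H) Hne Hp Hq. destruct (H q p Hq Hp) as ([H1 H2] & _).
unfold divdiff.
replace ((W q - W p) / (q - p) - Derive W p) with
  ((W q - W p - Derive W p * (q - p)) / (q - p)) by (field; lra).
unfold Rdiv. rewrite Rabs_mult, Rabs_inv.
assert (P : 0 < Rabs (q - p)) by (apply Rabs_pos_lt; lra).
apply Rmult_le_reg_r with (Rabs (q - p)). exact P.
rewrite Rmult_assoc, Rinv_l, Rmult_1_r by lra.
rewrite Rabs_pos_eq.
2:{ assert (0 <= la * (q - p) ^ 2) by (apply Rmult_le_pos; [lra|apply pow2_ge_0]).
    lra. }
replace (La * Rabs (q - p) * Rabs (q - p)) with (La * Rabs (q - p) ^ 2) by ring.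
rewrite pow2_abs. exact H2.
Qed.

(** The velocity ratio of the first face makes its flux difference equal, up to
    a relative error of order [m], to the difference between the flux at its
    inner corner and the exact boundary flux. *)
Lemma boundary_flux_ratio W K la La m p0 p1 p2 :
  taylor_bounds W K la La ->
  Rabs p0 <= K -> Rabs p1 <= K -> Rabs p2 <= K ->
  strictly_between p0 p1 p2 -> Rabs (p1 - p0) <= m ->
  Rabs ((p2 - p1) / (p2 - p0) * (divdiff W p1 p2 - divdiff W p0 p1)
        - (divdiff W p1 p2 - Derive W p1))
    <= La / la * m * Rabs (divdiff W p1 p2 - Derive W p1).
Proof.
intros (Pl & PL & H) H0 H1 H2 Hb Hm.
destruct (H p2 p1 H2 H1) as ([L2 _] & _ & C2).
destruct (H p0 p1 H0 H1) as (_ & _ & C0).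
set (A := Derive_n W 2 p1 / 2) in *. set (w := Derive W p1) in *.
set (R2 := W p2 - W p1 - w * (p2 - p1) - A * (p2 - p1) ^ 2) in *.
set (R0 := W p0 - W p1 - w * (p0 - p1) - A * (p0 - p1) ^ 2) in *.
assert (N : p2 - p1 <> 0 /\ p1 - p0 <> 0 /\ p2 - p0 <> 0).
{ unfold strictly_between in Hb. lra. }
destruct N as (N2 & N0 & N20).
assert (P2 : 0 < Rabs (p2 - p1)) by now apply Rabs_pos_lt.
assert (P0 : 0 < Rabs (p1 - p0)) by now apply Rabs_pos_lt.
assert (P20 : Rabs (p2 - p0) = Rabs (p1 - p0) + Rabs (p2 - p1)).
{ unfold strictly_between in Hb. unfold Rabs; repeat destruct Rcase_abs; lra. }
assert (B : la * Rabs (p2 - p1) <= Rabs (divdiff W p1 p2 - w)).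
{ unfold divdiff.
  replace ((W p2 - W p1) / (p2 - p1) - w) with
    ((W p2 - W p1 - w * (p2 - p1)) / (p2 - p1)) by (field; lra).
  unfold Rdiv. rewrite Rabs_mult, Rabs_inv.
  apply Rmult_le_reg_r with (Rabs (p2 - p1)). exact P2.
  rewrite (Rmult_assoc (Rabs _) (/ _)), Rinv_l, Rmult_1_r by lra.
  apply Rle_trans with (2 := Rle_abs _).
  replace (la * Rabs (p2 - p1) * Rabs (p2 - p1)) with (la * Rabs (p2 - p1) ^ 2) by ring.
  rewrite pow2_abs. exact L2. }
replace ((p2 - p1) / (p2 - p0) * (divdiff W p1 p2 - divdiff W p0 p1)
        - (divdiff W p1 p2 - w))
  with ((p2 - p1) * (R0 / (p1 - p0)) / (p2 - p0) -
        (p1 - p0) * (R2 / (p2 - p1)) / (p2 - p0)).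
2:{ unfold R0, R2, divdiff. field. repeat split; lra. }
rewrite (Rabs_minus_sym p0 p1) in C0.
apply Rle_trans with (La * m * Rabs (p2 - p1)).
2:{ replace (La / la * m * Rabs (divdiff W p1 p2 - w)) with
      (La * m * (/ la * Rabs (divdiff W p1 p2 - w))) by (field; lra).
    apply Rmult_le_compat_l. apply Rmult_le_pos; lra.
    apply Rmult_le_reg_l with la. exact Pl.
    rewrite <- Rmult_assoc, Rinv_r, Rmult_1_l by lra. exact B. }
apply Rle_trans with (La * Rabs (p1 - p0) * Rabs (p2 - p1)).
2:{ apply Rmult_le_compat_r. lra. apply Rmult_le_compat_l; lra. }
eapply Rle_trans. apply Rabs_triang. rewrite Rabs_Ropp.
unfold Rdiv. rewrite !Rabs_mult, !Rabs_inv, P20.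
set (x := Rabs (p1 - p0)) in *. set (y := Rabs (p2 - p1)) in *.
replace (y * (Rabs R0 * / x) * / (x + y) + x * (Rabs R2 * / y) * / (x + y)) with
  ((y ^ 2 * Rabs R0 + x ^ 2 * Rabs R2) / (x * y * (x + y))) by (field; lra).
apply Rle_div_l. apply Rmult_lt_0_compat; [apply Rmult_lt_0_compat|]; lra.
apply Rle_trans with (y ^ 2 * (La * x ^ 3) + x ^ 2 * (La * y ^ 3)).
apply Rplus_le_compat; apply Rmult_le_compat_l; auto; apply pow_le; lra.
right; ring.
Qed.

Lemma sqrt_1_sq_lipschitz p q :
  Rabs (sqrt (1 + p ^ 2) - sqrt (1 + q ^ 2)) <= Rabs (p - q).
Proof.
assert (Pp : 0 <= 1 + p ^ 2) by nra. assert (Pq : 0 <= 1 + q ^ 2) by nra.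
assert (Ap : Rabs p <= sqrt (1 + p ^ 2)).
{ rewrite <- sqrt_Rsqr_abs. apply sqrt_le_1_alt. unfold Rsqr. lra. }
assert (Aq : Rabs q <= sqrt (1 + q ^ 2)).
{ rewrite <- sqrt_Rsqr_abs. apply sqrt_le_1_alt. unfold Rsqr. lra. }
assert (Sp := pow2_sqrt _ Pp). assert (Sq := pow2_sqrt _ Pq).
assert (Lp := sqrt_lt_R0 (1 + p ^ 2)). assert (Lq := sqrt_lt_R0 (1 + q ^ 2)).
set (x := sqrt (1 + p ^ 2)) in *. set (y := sqrt (1 + q ^ 2)) in *.
assert (Lx : 0 < x) by (apply Lp; nra). assert (Ly : 0 < y) by (apply Lq; nra).
apply Rmult_le_reg_r with (x + y). lra.
rewrite <- (Rabs_pos_eq (x + y)) at 1 by lra. rewrite <- Rabs_mult.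
replace ((x - y) * (x + y)) with ((p - q) * (p + q)) by (ring_simplify; lra).
rewrite Rabs_mult. apply Rmult_le_compat_l. apply Rabs_pos.
eapply Rle_trans. apply Rabs_triang. lra.
Qed.

Lemma sqrt_1_sq_bounds p K :
  Rabs p <= K -> 1 <= sqrt (1 + p ^ 2) <= 1 + K.
Proof.
intros H. split.
rewrite <- sqrt_1 at 1. apply sqrt_le_1_alt. nra.
rewrite <- (sqrt_pow2 (1 + K)). apply sqrt_le_1_alt.
rewrite <- (pow2_abs p). generalize (Rabs_pos p). nra.
generalize (Rabs_pos p); lra.
Qed.

(** * The pointwise dissipation estimate *)

(** Here [e] is the slope error, [z] the error in [u], [s] the slope of the
    discrete flux on a face and [v] the velocity of the face; [sg] and [q] are
    the discrete and the exact flux, [kap * m] the relative error in the law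
    [v = gp * s].  The term [- gp * (s - qx)^2] contained in
    [(ut - v) * (s - qx)] absorbs all the other terms that contain [s]; for the
    square of [v - ut] this is where [eps] has to be small. *)
Lemma rate_pointwise_bound B La G kap m eps gp gu qx ut uxt w2 e z v s sg q :
  0 <= La -> 0 <= kap -> 0 <= m <= 1 -> kap * m <= 1 / 2 ->
  0 < eps <= 1 -> eps * (3 * (G + 1) ^ 2) <= 1 / 4 ->
  1 <= gp <= G -> Rabs (gp - gu) <= Rabs e -> Rabs qx <= B -> ut = gu * qx ->
  Rabs uxt <= B -> Rabs (sg - q - w2 * e) <= La * (m + e ^ 2) ->
  Rabs (v - gp * s) <= kap * m * Rabs s ->
  - (w2 * uxt * e) + eps * (2 * z * (v - ut)) + (uxt * (sg - q) + (ut - v) * (s - qx))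
   <= (B * La + 5 * B ^ 2) * e ^ 2 + (B * La + 5 * kap ^ 2 * B ^ 2) * m + eps * z ^ 2.
Proof.
intros PL Pk Hm Hkm Heps HG Hgp Hg Hqx Hut Huxt Hsg Hv.
assert (PB := Rle_trans _ _ _ (Rabs_pos _) Hqx).
set (d := s - qx). set (rho := v - ut - gp * d).
assert (Pd := Rabs_pos d). assert (Pe := Rabs_pos e).
assert (Hrho : Rabs rho <= kap * m * (Rabs d + B) + B * Rabs e).
{ unfold rho. replace (v - ut - gp * d) with ((v - gp * s) + (gp - gu) * qx)
    by (unfold d; rewrite Hut; ring).
  eapply Rle_trans. apply Rabs_triang. rewrite Rabs_mult. apply Rplus_le_compat.
  - eapply Rle_trans. apply Hv. apply Rmult_le_compat_l. apply Rmult_le_pos; lra.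
    replace s with (d + qx) by (unfold d; ring). eapply Rle_trans. apply Rabs_triang. lra.
  - rewrite (Rmult_comm B). apply Rmult_le_compat; auto; apply Rabs_pos. }
set (E := B * Rabs e + kap * B * m).
assert (PE : 0 <= E).
{ unfold E. apply Rplus_le_le_0_compat. now apply Rmult_le_pos.
  apply Rmult_le_pos; [apply Rmult_le_pos|]; lra. }
assert (Hrho2 : Rabs rho <= Rabs d / 2 + E).
{ assert (kap * m * Rabs d <= 1 / 2 * Rabs d) by (apply Rmult_le_compat_r; lra).
  unfold E. lra. }
assert (HE : E ^ 2 <= 2 * B ^ 2 * e ^ 2 + 2 * kap ^ 2 * B ^ 2 * m).
{ unfold E. apply Rle_trans with (2 * (B * Rabs e) ^ 2 + 2 * (kap * B * m) ^ 2).
  generalize (pow2_ge_0 (B * Rabs e - kap * B * m)). intros; nra.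
  rewrite !Rpow_mult_distr, pow2_abs.
  assert (m ^ 2 <= m) by nra.
  assert (0 <= kap ^ 2 * B ^ 2) by (apply Rmult_le_pos; apply pow2_ge_0).
  nra. }
assert (Hd2 := pow2_abs d).
assert (D1 : (ut - v) * d <= - (1 / 4) * d ^ 2 + E ^ 2).
{ replace (ut - v) with (- (gp * d) - rho) by (unfold rho; ring).
  assert (- rho * d <= (Rabs d / 2 + E) * Rabs d).
  { apply Rle_trans with (Rabs (- rho * d)). apply Rle_abs.
    rewrite Rabs_mult, Rabs_Ropp. apply Rmult_le_compat_r; auto. }
  assert (d ^ 2 <= gp * d ^ 2) by (generalize (pow2_ge_0 d); nra).
  generalize (pow2_ge_0 (Rabs d / 2 - E)). intros. nra. }
assert (D2 : eps * (2 * z * (v - ut)) <= eps * z ^ 2 + (1 / 4 * d ^ 2 + 3 / 2 * E ^ 2)).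
{ assert (S : (v - ut) ^ 2 <= 3 * (G + 1) ^ 2 * d ^ 2 + 3 / 2 * E ^ 2).
  { assert (A : Rabs (v - ut) <= (G + 1 / 2) * Rabs d + E).
    { replace (v - ut) with (gp * d + rho) by (unfold rho; ring).
      eapply Rle_trans. apply Rabs_triang. rewrite Rabs_mult, (Rabs_pos_eq gp) by lra.
      assert (gp * Rabs d <= G * Rabs d) by (apply Rmult_le_compat_r; lra). lra. }
    rewrite <- (pow2_abs (v - ut)).
    apply Rle_trans with (((G + 1 / 2) * Rabs d + E) ^ 2).
    apply pow_incr. split; auto; apply Rabs_pos.
    rewrite <- Hd2.
    assert (0 <= (2 * ((G + 1 / 2) * Rabs d) - E) ^ 2) by apply pow2_ge_0.
    assert (0 <= (G + 1 - (G + 1 / 2)) * (G + 1 + (G + 1 / 2)) * Rabs d ^ 2).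
    { apply Rmult_le_pos. nra. apply pow2_ge_0. }
    nra. }
  assert (eps * (v - ut) ^ 2 <= 1 / 4 * d ^ 2 + 3 / 2 * E ^ 2).
  { apply Rle_trans with (eps * (3 * (G + 1) ^ 2 * d ^ 2 + 3 / 2 * E ^ 2)).
    apply Rmult_le_compat_l; lra.
    assert (eps * (3 * (G + 1) ^ 2) * d ^ 2 <= 1 / 4 * d ^ 2)
      by (apply Rmult_le_compat_r; auto; apply pow2_ge_0).
    assert (eps * E ^ 2 <= 1 * E ^ 2) by (apply Rmult_le_compat_r; try apply pow2_ge_0; lra).
    nra. }
  assert (0 <= eps * (z - (v - ut)) ^ 2) by (apply Rmult_le_pos; [lra|apply pow2_ge_0]).
  nra. }
assert (D3 : uxt * (sg - q) - w2 * uxt * e <= B * La * (m + e ^ 2)).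
{ replace (uxt * (sg - q) - w2 * uxt * e) with (uxt * (sg - q - w2 * e)) by ring.
  eapply Rle_trans. apply Rle_abs. rewrite Rabs_mult, Rmult_assoc.
  apply Rmult_le_compat; auto; apply Rabs_pos. }
fold d. nra.
Qed.

(** * Removal and merging of faces *)

(** [P] holds for every three consecutive elements of the list. *)
Fixpoint triples {A : Type} (P : A -> A -> A -> Prop) (l : list A) : Prop :=
  match l with
  | nil => True
  | x :: l' => match l' with y :: z :: _ => P x y z | _ => True end /\ triples P l'
  end.

Lemma triples_seq {A : Type} (P : A -> A -> A -> Prop) (f : nat -> A) n k :
  (forall i, (k <= i)%nat -> (i + 2 < k + n)%nat -> P (f i) (f (i + 1)%nat) (f (i + 2)%nat)) ->
  triples P (map f (List.seq k n)).
Proof.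
revert k; induction n as [|n IH]; intros k H; simpl; auto. split.
- destruct n as [|[|n]]; simpl; auto.
  specialize (H k). replace (S k) with (k + 1)%nat by lia.
  replace (S (k + 1)) with (k + 2)%nat by lia. apply H; lia.
- apply IH. intros i H1 H2. apply H; lia.
Qed.

Lemma Sorted_seq {A : Type} (Q : A -> A -> Prop) (f : nat -> A) n k :
  Sorted Q (map f (List.seq k n)) <->
  (forall i, (k <= i)%nat -> (i + 1 < k + n)%nat -> Q (f i) (f (i + 1)%nat)).
Proof.
revert k; induction n as [|n IH]; intros k; simpl.
- split; intros; [lia|constructor].
- split.
  + intros H i H1 H2. inversion H as [|x l Hs Hh E]; subst.
    destruct (Nat.eq_dec i k) as [->|Hne].
    * destruct n as [|n]; [lia|]. simpl in Hh. inversion Hh; subst.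
      now replace (k + 1)%nat with (S k) by lia.
    * apply (proj1 (IH (S k)) Hs); lia.
  + intros H. constructor. apply IH. intros; apply H; lia.
    destruct n as [|n]; simpl; constructor.
    replace (S k) with (k + 1)%nat by lia. apply H; lia.
Qed.

Lemma last_map_seq {A : Type} (f : nat -> A) n d :
  (1 <= n)%nat -> last (map f (List.seq 1 n)) d = f n.
Proof.
intros Hn. destruct n as [|n]; [lia|].
rewrite seq_S, map_app. simpl map. now rewrite last_last.
Qed.

Lemma merge_faces_same p d d' k l :
  merge_faces k = (p, d') :: l -> merge_faces ((p, d) :: k) = (p, d + d') :: l.
Proof. intros E. simpl. rewrite E. now destruct (Req_EM_T p p). Qed.

Lemma merge_faces_distinct p q d d' k l :
  p <> q -> merge_faces k = (q, d') :: l ->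
  merge_faces ((p, d) :: k) = (p, d) :: (q, d') :: l.
Proof. intros Hpq E. simpl. rewrite E. now destruct (Req_EM_T p q). Qed.

(** If the neighbours of every vanishing face have equal slopes, removing and
    merging keeps the first and the last slope and every relation that holds
    between the slopes of consecutive faces. *)
Lemma merge_remove_chain (Q : R -> R -> Prop) f l dflt :
  (forall p q, Q p q -> p <> q) ->
  0 < snd f -> 0 < snd (last (f :: l) dflt) ->
  Sorted (fun x y => Q (fst x) (fst y)) (f :: l) ->
  triples (fun x y z : R * R => ~ 0 < snd y -> fst x = fst z) (f :: l) ->
  exists d' l', merge_faces (remove_vanished (f :: l)) = (fst f, d') :: l' /\
    Sorted (fun x y => Q (fst x) (fst y)) ((fst f, d') :: l') /\
    fst (last ((fst f, d') :: l') dflt) = fst (last (f :: l) dflt).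
Proof.
intros HQ.
assert (G : forall n f l, (length l <= n)%nat -> 0 < snd f ->
  0 < snd (last (f :: l) dflt) ->
  Sorted (fun x y => Q (fst x) (fst y)) (f :: l) ->
  triples (fun x y z : R * R => ~ 0 < snd y -> fst x = fst z) (f :: l) ->
  exists d' l', merge_faces (remove_vanished (f :: l)) = (fst f, d') :: l' /\
    Sorted (fun x y => Q (fst x) (fst y)) ((fst f, d') :: l') /\
    fst (last ((fst f, d') :: l') dflt) = fst (last (f :: l) dflt)).
2:{ apply (G (length l)). lia. }
clear f l. induction n as [n IH] using lt_wf_ind.
intros [pf df] l Hlen Hf Hlast Hs Ht.
assert (Rkeep : forall x k, 0 < snd x ->
  remove_vanished (x :: k) = x :: remove_vanished k).
{ intros x k H. unfold remove_vanished. simpl. now destruct (Rlt_dec 0 (snd x)). }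
assert (Rdrop : forall x k, ~ 0 < snd x ->
  remove_vanished (x :: k) = remove_vanished k).
{ intros x k H. unfold remove_vanished. simpl. now destruct (Rlt_dec 0 (snd x)). }
simpl in Hf.
destruct l as [|g l].
{ rewrite Rkeep by exact Hf. exists df, nil. repeat split; auto. }
assert (Hlast' : forall x y k, last (x :: y :: k) dflt = last (y :: k) dflt) by reflexivity.
rewrite Hlast' in Hlast |- *. simpl length in Hlen.
inversion Hs as [|? ? Hs1 Hh1]; subst. inversion Hh1 as [|? ? Hfg]; subst.
simpl fst in Hfg.
destruct (Rlt_dec 0 (snd g)) as [Hg|Hg].
- destruct (IH (length l)) with (f := g) (l := l) as (d' & l' & E & Hs' & Hl'); auto; try lia.
  { apply Ht. }
  rewrite Rkeep by exact Hf.
  exists df, ((fst g, d') :: l'). split; [|split; auto].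
  apply merge_faces_distinct; auto.
- destruct l as [|h l]; [now elim Hg|].
  assert (Hfh : pf = fst h) by now apply Ht.
  rewrite Hlast' in Hlast |- *. simpl length in Hlen.
  inversion Hs1 as [|? ? Hs2 Hh2]; subst.
  destruct (Rlt_dec 0 (snd h)) as [Hh|Hh].
  + destruct (IH (length l)) with (f := h) (l := l) as (d' & l' & E & Hs' & Hl'); auto; try lia.
    { apply Ht. }
    rewrite Rkeep by exact Hf. rewrite Rdrop by exact Hg.
    exists (df + d'), l'. split; [|split].
    * now apply merge_faces_same.
    * inversion Hs' as [|? ? Hs3 Hh3]; subst. constructor; auto.
      inversion Hh3; constructor; auto.
    * transitivity (fst (last ((fst h, d') :: l') dflt)); [|exact Hl'].
      destruct l'; reflexivity.
  + destruct l as [|k l]; [now elim Hh|].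
    assert (Hgk : fst g = fst k) by now apply Ht.
    rewrite Hlast' in Hlast |- *. simpl length in Hlen.
    inversion Hs2 as [|? ? Hs3 Hh3]; subst.
    (* two consecutive vanishing faces are dropped together: the faces [f] and
       [h] have the same slope, and so have [g] and [k] *)
    destruct (IH (S (length l))) with (f := (fst h, df)) (l := k :: l)
      as (d' & l' & E & Hs' & Hl'); auto; try (simpl; lia).
    { constructor; auto. constructor. simpl. now rewrite <- Hgk. }
    { split. 2: apply Ht. destruct l as [|k2 l]; auto. simpl. apply Ht. }
    rewrite Rkeep in E by exact Hf. rewrite Rkeep by exact Hf. rewrite Rdrop by exact Hg.
    rewrite Rdrop by exact Hh. exists d', l'. split; auto.
Qed.

(** Integral over the faces of a density that depends on the slope; the list
    of faces starts at the point [z]. *)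
Fixpoint faces_integral (phi : R -> R -> R) (z : R) (l : list (R * R)) : R :=
  match l with
  | nil => 0
  | (p, d) :: l' => RInt (phi p) z (z + d) + faces_integral phi (z + d) l'
  end.

Lemma faces_integral_remove phi l z :
  List.Forall (fun f : R * R => 0 <= snd f) l ->
  faces_integral phi z (remove_vanished l) = faces_integral phi z l.
Proof.
intros H. revert z. induction H as [|[p d] l Hd Hl IH]; intros z; auto.
simpl. destruct (Rlt_dec 0 d) as [H1|H1]; simpl.
- now rewrite IH.
- simpl in Hd. replace d with 0 by lra. rewrite Rplus_0_r, RInt_point, IH.
  unfold zero; simpl. ring.
Qed.

Lemma faces_integral_merge phi l z :
  (forall p y, continuous (phi p) y) ->
  faces_integral phi z (merge_faces l) = faces_integral phi z l.
Proof.
intros Hphi. revert z. induction l as [|[p d] l IH]; intros z; auto.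
simpl. rewrite <- (IH (z + d)). destruct (merge_faces l) as [|[q d'] l']; auto.
destruct (Req_EM_T p q) as [->|Hne]; auto.
simpl. rewrite <- (RInt_Chasles (V := R_CompleteNormedModule) (phi q) z (z + d) (z + (d + d'))).
2, 3: apply (ex_RInt_continuous (V := R_CompleteNormedModule)); intros; apply Hphi.
unfold plus; simpl. replace (z + (d + d')) with (z + d + d') by ring. ring.
Qed.

Lemma faces_integral_faces phi N p X :
  faces_integral phi (X 0%nat) (faces N p X) =
  fsum (fun i => RInt (phi (p i)) (X (i - 1)%nat) (X i)) N.
Proof.
unfold faces.
assert (G : forall n k, faces_integral phi (X k)
   (map (fun i => (p i, X i - X (i - 1)%nat)) (List.seq (S k) n)) =
   fsum (fun i => RInt (phi (p i)) (X (i - 1)%nat) (X i)) (k + n) -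
   fsum (fun i => RInt (phi (p i)) (X (i - 1)%nat) (X i)) k).
{ induction n as [|n IH]; intros k; simpl. rewrite Nat.add_0_r. ring.
  rewrite Nat.sub_0_r. replace (X k + (X (S k) - X k)) with (X (S k)) by ring.
  rewrite IH. replace (S k + n)%nat with (k + S n)%nat by lia.
  simpl. rewrite Nat.sub_0_r. ring. }
rewrite G. simpl. ring.
Qed.

(** * Adjacent slopes *)

Lemma adjacent_sym S p q : adjacent S p q -> adjacent S q p.
Proof.
intros (Hp & Hq & Hne & H). repeat split; auto.
intros s Hs. rewrite Rmin_comm, Rmax_comm. now apply H.
Qed.

Lemma adjacent_dichotomy S p q r :
  adjacent S p q -> adjacent S q r -> p <> r -> strictly_between p q r.
Proof.
intros (Hp & _ & Hpq & H1) (_ & Hr & Hqr & H2) Hpr.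
assert (G1 := H1 r Hr). assert (G2 := H2 p Hp). unfold strictly_between.
revert G1 G2. unfold Rmin, Rmax. repeat destruct Rle_dec; intros; lra.
Qed.

(** An element has only one adjacent element on each side. *)
Lemma adjacent_same_side S p q r x :
  adjacent S q p -> adjacent S q r -> strictly_between p q x ->
  strictly_between r q x -> p = r.
Proof.
intros Hp Hr H1 H2. destruct (Req_dec p r) as [|Hne]; auto.
assert (H := adjacent_dichotomy S p q r (adjacent_sym _ _ _ Hp) Hr Hne).
unfold strictly_between in *. lra.
Qed.

Lemma divdiff_increasing W p q r :
  strictly_convex W -> p < q < r -> divdiff W p q < divdiff W q r.
Proof.
intros HW Hpq. unfold divdiff.
assert (H := HW p r ((r - q) / (r - p))).
replace ((r - q) / (r - p) * p + (1 - (r - q) / (r - p)) * r) with q in H by (field; lra).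
assert (Hl : 0 < (r - q) / (r - p) < 1).
{ split. apply Rdiv_lt_0_compat; lra. apply Rlt_div_l; lra. }
specialize (H ltac:(lra) Hl).
apply Rlt_div_l. lra.
replace ((W r - W q) / (r - q) * (q - p)) with ((W r - W q) * (q - p) / (r - q)) by (field; lra).
apply Rlt_div_r. lra.
assert (H' : W q * (r - p) < (r - q) * W p + (q - p) * W r).
{ replace ((r - q) * W p + (q - p) * W r) with
   (((r - q) / (r - p) * W p + (1 - (r - q) / (r - p)) * W r) * (r - p)) by (field; lra).
  apply Rmult_lt_compat_r; lra. }
lra.
Qed.

(** On a face whose slope lies strictly between those of its neighbours, the
    velocity and the slope increments have the same sign. *)
Lemma Delta_sign W p i :
  strictly_convex W ->
  strictly_between (p (i - 1)%nat) (p i) (p (i + 1)%nat) ->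
  0 < Defs.Delta W p i / (p (i + 1)%nat - p i) /\
  0 < Defs.Delta W p i / (p i - p (i - 1)%nat).
Proof.
intros HW H. change (Defs.Delta W p i) with
  (divdiff W (p i) (p (i + 1)%nat) - divdiff W (p (i - 1)%nat) (p i)).
destruct H as [H|H].
- assert (G := divdiff_increasing W _ _ _ HW H). split; apply Rdiv_lt_0_compat; lra.
- assert (G := divdiff_increasing W _ _ _ HW H).
  rewrite (divdiff_sym W (p i)), (divdiff_sym W (p (i - 1)%nat)) by lra.
  split.
  + replace (_ / _) with ((divdiff W (p i) (p (i - 1)%nat) - divdiff W (p (i + 1)%nat) (p i))
      / (p i - p (i + 1)%nat)) by (field; lra). apply Rdiv_lt_0_compat; lra.
  + replace (_ / _) with ((divdiff W (p i) (p (i - 1)%nat) - divdiff W (p (i + 1)%nat) (p i))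
      / (p (i - 1)%nat - p i)) by (field; lra). apply Rdiv_lt_0_compat; lra.
Qed.

(** * A phase up to its closing time *)

Lemma nonneg_at_closing_time (f : R -> R) s e :
  s < e -> (forall t, continuous f t) -> (forall t, s <= t < e -> 0 <= f t) ->
  forall t, s <= t <= e -> 0 <= f t.
Proof.
intros Hse Hf H t Ht. destruct (Rle_lt_or_eq_dec t e) as [Hlt| ->]; try lra.
{ apply H; lra. }
apply Rnot_lt_le. intros Hneg.
destruct (Hf e (fun z => z < 0)) as [del Hdel].
{ apply (open_lt 0). exact Hneg. }
assert (P : 0 < Rmin (del / 2) (e - s)).
{ apply Rmin_pos. generalize (cond_pos del); lra. lra. }
set (t := e - Rmin (del / 2) (e - s)).
assert (H1 := Rmin_l (del / 2) (e - s)). assert (H2 := Rmin_r (del / 2) (e - s)).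
assert (G := H t). assert (Pd := cond_pos del).
assert (f t < 0).
{ apply Hdel. unfold ball; simpl; unfold AbsRing_ball, abs, minus, plus, opp; simpl.
  apply Rabs_def1; unfold t; lra. }
assert (0 <= f t) by (apply G; unfold t; lra). lra.
Qed.

Lemma zero_at_closing_time (f : R -> R) s e :
  s < e -> (forall t, continuous f t) -> (forall t, s <= t < e -> f t = 0) ->
  forall t, s <= t <= e -> f t = 0.
Proof.
intros Hse Hf H t Ht.
assert (0 <= f t).
{ apply (nonneg_at_closing_time f s e); auto. intros r Hr. rewrite H; lra. }
assert (0 <= - f t).
{ apply (nonneg_at_closing_time (fun t => - f t) s e); auto.
  intros r. apply (continuous_opp (V := R_NormedModule)), Hf.
  intros r Hr. rewrite H; lra. }
lra.
Qed.

(** A piecewise affine function whose faces may have vanishing length. *)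
Definition closed_config (N : nat) (p X : nat -> R) (f : R -> R) : Prop :=
  X 0%nat = 0 /\ X N = 1 /\
  forall i, (1 <= i <= N)%nat -> X (i - 1)%nat <= X i /\
    forall y, X (i - 1)%nat <= y <= X i ->
      f y = f (X (i - 1)%nat) + p i * (y - X (i - 1)%nat).

Lemma closed_config_range N p X f i :
  closed_config N p X f -> (i <= N)%nat -> 0 <= X i <= 1.
Proof.
intros (H0 & HN & H) Hi. split.
- induction i as [|i IH]. lra.
  destruct (H (S i)) as [G _]. lia. simpl in G. rewrite Nat.sub_0_r in G.
  apply Rle_trans with (2 := G). apply IH; lia.
- assert (G : forall k, (k <= N)%nat -> X (N - k)%nat <= 1).
  { induction k as [|k IH]; intros Hk. rewrite Nat.sub_0_r; lra.
    destruct (H (N - k)%nat) as [G _]. lia.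
    replace (N - S k)%nat with (N - k - 1)%nat by lia.
    apply Rle_trans with (1 := G). apply IH; lia. }
  replace i with (N - (N - i))%nat by lia. apply G; lia.
Qed.

Section Phase.

Variables (W : R -> R) (Sl : R -> Prop) (um : R -> R -> R) (T s e : R)
  (N : nat) (p : nat -> R) (x : nat -> R -> R).
Hypotheses (W_convex : strictly_convex W) (s_pos : 0 <= s) (s_lt_e : s < e)
  (e_le_T : e <= T)
  (um_continuous : continuous_on (rect T) (fun z : R * R => um (fst z) (snd z)))
  (Hphase : phase W Sl um s e N p x).

(** Corners with time projected onto the interval of the phase. *)
Definition xc (i : nat) (t : R) : R := x i (clamp s e t).

Lemma xc_id i t : s <= t <= e -> xc i t = x i t.
Proof. intros H. unfold xc. now rewrite clamp_id. Qed.

Lemma xc_continuous i t : (i <= N)%nat -> continuous (xc i) t.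
Proof.
intros Hi. apply continuous_clamp_time. lra. now apply (phase_continuous _ _ _ _ _ _ _ _ Hphase).
Qed.

Lemma xc_derive i t l : s < t < e -> is_derive (x i) t l -> is_derive (xc i) t l.
Proof.
intros Ht H. apply is_derive_ext_loc with (x i); auto.
apply (locally_interval _ t s e); try apply Ht.
intros r H1 H2; simpl in H1, H2. symmetry. apply xc_id; lra.
Qed.

(** The configuration at the final time of a phase is the limit of the
    preceding ones. *)
Lemma phase_closed t : s <= t <= e ->
  closed_config N p (fun i => x i t) (fun y => um y t).
Proof.
assert (Hadm := phase_admissible _ _ _ _ _ _ _ _ Hphase).
assert (HT : 0 <= T) by lra.
intros Ht. split; [|split].
- rewrite <- (xc_id 0 t Ht).
  apply (zero_at_closing_time (xc 0) s e); auto.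
  intros r; apply xc_continuous; lia.
  intros r Hr. rewrite xc_id by lra. apply Hadm; auto.
- apply Rminus_diag_uniq. rewrite <- (xc_id N t Ht).
  apply (zero_at_closing_time (fun t => xc N t - 1) s e); auto.
  { intros r. apply (continuous_minus (V := R_NormedModule)).
    apply xc_continuous; lia. apply continuous_const. }
  intros r Hr. rewrite xc_id by lra.
  destruct (Hadm r Hr) as (_ & _ & E & _). lra.
- intros i Hi.
  assert (Hl : forall r, continuous (fun r => xc i r - xc (i - 1) r) r).
  { intros r. apply (continuous_minus (V := R_NormedModule)); apply xc_continuous; lia. }
  assert (Hle : x (i - 1)%nat t <= x i t).
  { apply Rminus_le_0. rewrite <- (xc_id i t Ht), <- (xc_id (i - 1) t Ht).
    apply (nonneg_at_closing_time (fun r => xc i r - xc (i - 1) r) s e); auto.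
    intros r Hr. rewrite !xc_id by lra. apply Rminus_le_0.
    destruct (Hadm r Hr) as (_ & _ & _ & E). destruct (E i Hi) as (E1 & _). lra. }
  split; auto. intros y Hy.
  destruct (Req_dec (x (i - 1)%nat t) (x i t)) as [Heq|Hne].
  { replace y with (x (i - 1)%nat t) by lra. ring. }
  (* follow the point that divides the face in a constant proportion *)
  set (th := (y - x (i - 1)%nat t) / (x i t - x (i - 1)%nat t)).
  assert (Hth : 0 <= th <= 1).
  { unfold th. split. apply Rdiv_le_0_compat; lra. apply Rle_div_l; lra. }
  set (yy := fun r => xc (i - 1) r + th * (xc i r - xc (i - 1) r)).
  assert (Hyy : yy t = y).
  { unfold yy. rewrite !xc_id by lra. unfold th. field. lra. }
  assert (Hyc : forall r, continuous yy r).
  { intros r. apply (continuous_plus (V := R_NormedModule)). apply xc_continuous; lia.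
    apply (continuous_mult (K := R_AbsRing)). apply continuous_const. apply Hl. }
  assert (Hin : forall r, s <= r < e -> xc (i - 1) r <= yy r <= xc i r /\
    0 <= xc (i - 1) r <= 1 /\ 0 <= yy r <= 1).
  { intros r Hr.
    assert (Hcl : forall j, (j <= N)%nat -> 0 <= x j r <= 1).
    { intros j Hj. apply (closed_config_range N p (fun j => x j r) (fun y => um y r)); auto.
      destruct (Hadm r Hr) as (_ & E0 & E1 & E). split; [auto|split; auto].
      intros k Hk. destruct (E k Hk) as (E2 & _ & E3). split. lra. apply E3. }
    destruct (Hadm r Hr) as (_ & _ & _ & E). destruct (E i Hi) as (E1 & _).
    unfold yy. rewrite !xc_id by lra.
    assert (B1 := Hcl i ltac:(lia)). assert (B2 := Hcl (i - 1)%nat ltac:(lia)).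
    nra. }
  assert (Z : extend T um t (yy t) - extend T um t (xc (i - 1) t)
    - p i * (yy t - xc (i - 1) t) = 0).
  { apply (zero_at_closing_time (fun t => extend T um t (yy t) - extend T um t (xc (i - 1) t)
    - p i * (yy t - xc (i - 1) t)) s e); auto.
    - intros r. assert (HU := cont2_extend T um HT um_continuous).
      repeat apply (continuous_minus (V := R_NormedModule)).
      apply (cont2_comp _ (fun t => t)); auto. apply continuous_id.
      apply (cont2_comp _ (fun t => t)); auto. apply continuous_id. apply xc_continuous; lia.
      apply (continuous_mult (K := R_AbsRing)). apply continuous_const.
      apply (continuous_minus (V := R_NormedModule)); auto. apply xc_continuous; lia.
    - intros r Hr. destruct (Hin r Hr) as (I1 & I2 & I3).
      rewrite !extend_id by lra.
      destruct (Hadm r Hr) as (_ & _ & _ & E). destruct (E i Hi) as (_ & _ & E1).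
      rewrite !xc_id in * by lra. rewrite E1 by lra. ring. }
  rewrite Hyy in Z. rewrite xc_id in Z by lra.
  assert (R1 : 0 <= x (i - 1)%nat t <= 1 /\ 0 <= y <= 1).
  { assert (G : forall f : R -> R, (forall r, continuous f r) ->
       (forall r, s <= r < e -> 0 <= f r <= 1) -> 0 <= f t <= 1).
    { intros f Hf Hb. split. apply (nonneg_at_closing_time f s e); auto. apply Hb.
      apply Rminus_le_0.
      apply (nonneg_at_closing_time (fun r => 1 - f r) s e); auto.
      intros r. apply (continuous_minus (V := R_NormedModule)); auto. apply continuous_const.
      intros r Hr. generalize (Hb r Hr). lra. }
    split. rewrite <- (xc_id (i - 1) t Ht). apply G. intros; apply xc_continuous; lia.
    apply Hin. rewrite <- Hyy. apply G; auto. apply Hin. }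
  rewrite !extend_id in Z by lra. lra.
Qed.

(** * Only flat faces vanish *)

(** For a fixed set of faces each velocity is inversely proportional to the
    length of the face. *)
Definition velocity_coeff (i : nat) : R :=
  sqrt (1 + p i ^ 2) * Defs.Delta W p i * ratio N p i.

Lemma velocity_coeffE i t :
  velocity W N p (fun j => x j t) i = velocity_coeff i / (x i t - x (i - 1)%nat t).
Proof. unfold velocity, velocity_coeff, Rdiv. ring. Qed.

Hypothesis adjacent_faces :
  forall i, (1 <= i < N)%nat -> adjacent Sl (p i) (p (i + 1)%nat).

(** A face that vanishes at time [e] although its neighbours have different
    slopes. *)
Let degenerate (k : nat) : Prop :=
  x k e = x (k - 1)%nat e /\ p (k - 1)%nat <> p (k + 1)%nat.

Lemma degenerate_interior k : (1 <= k <= N)%nat -> degenerate k -> (2 <= k <= N - 1)%nat.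
Proof.
intros Hk [H _]. destruct (phase_ends _ _ _ _ _ _ _ _ Hphase) as [H1 H2].
destruct (Nat.eq_dec k 1) as [->|]; [simpl in H; lra|].
destruct (Nat.eq_dec k N) as [->|]; [lra|]. lia.
Qed.

(** The velocity of a face that vanishes between equal neighbours is zero, and
    that of a face of positive final length is bounded. *)
Lemma velocity_bounded_at_end k :
  (1 <= k <= N)%nat -> ~ degenerate k ->
  exists B, 0 <= B /\ locally e (fun t => s < t < e ->
    Rabs (velocity W N p (fun j => x j t) k) <= B).
Proof.
intros Hk Hnd.
destruct (Req_dec (x k e) (x (k - 1)%nat e)) as [Heq|Hne].
- assert (Hflat : p (k - 1)%nat = p (k + 1)%nat).
  { destruct (Req_dec (p (k - 1)%nat) (p (k + 1)%nat)); auto.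
    elim Hnd. split; auto. }
  exists 0. split. lra. apply filter_forall. intros t Ht.
  destruct (phase_ends _ _ _ _ _ _ _ _ Hphase) as [H1 H2].
  assert (Hk1 : k <> 1%nat). { intros ->. simpl in Heq. lra. }
  assert (HkN : k <> N). { intros ->. lra. }
  assert (A := adjacent_faces k ltac:(lia)). destruct A as (_ & _ & A & _).
  rewrite velocity_coeffE. unfold velocity_coeff, Defs.Delta. rewrite Hflat.
  replace (_ - _) with 0 by (field; lra).
  rewrite Rmult_0_r, Rmult_0_l. unfold Rdiv. rewrite Rmult_0_l, Rabs_R0. lra.
- destruct (phase_closed e ltac:(lra)) as (_ & _ & Hcl).
  destruct (Hcl k Hk) as [Hle _].
  set (l := x k e - x (k - 1)%nat e) in *.
  assert (Pl : 0 < l) by (unfold l; lra).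
  assert (Hloc : locally e (fun t => l / 2 < xc k t - xc (k - 1) t)).
  { assert (C : continuous (fun t => xc k t - xc (k - 1) t) e).
    { apply (continuous_minus (V := R_NormedModule)); apply xc_continuous; lia. }
    apply (C (fun z => l / 2 < z)). apply (open_gt (l / 2)). rewrite !xc_id by lra.
    unfold l in *; lra. }
  exists (Rabs (velocity_coeff k) * (2 / l)). split.
  { apply Rmult_le_pos. apply Rabs_pos. apply Rdiv_le_0_compat; lra. }
  revert Hloc. apply filter_imp. intros t Hl Ht. rewrite !xc_id in Hl by lra.
  rewrite velocity_coeffE. unfold Rdiv at 1. rewrite Rabs_mult.
  apply Rmult_le_compat_l. apply Rabs_pos.
  rewrite Rabs_inv, Rabs_pos_eq by lra. replace (2 / l) with (/ (l / 2)) by (field; lra).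
  apply Rinv_le_contravar; lra.
Qed.

Lemma degenerate_block_left i :
  (1 <= i <= N)%nat -> degenerate i -> exists j, (2 <= j <= i)%nat /\
    (forall k, (j <= k <= i)%nat -> degenerate k) /\ ~ degenerate (j - 1).
Proof.
induction i as [|i IH]; intros Hi Hd. lia.
assert (G := degenerate_interior _ Hi Hd).
destruct (excluded_middle_informative (degenerate i)) as [Hd'|Hd'].
- destruct IH as (j & Hj & Hall & Hn); auto; try lia.
  exists j. split; [lia|split; auto].
  intros k Hk. destruct (Nat.eq_dec k (S i)) as [->|]. apply Hd. apply Hall; lia.
- exists (S i). split; [lia|split].
  intros k Hk. replace k with (S i) by lia; apply Hd.
  now replace (S i - 1)%nat with i by lia.
Qed.

Lemma degenerate_block_right i :
  (1 <= i <= N)%nat -> degenerate i -> exists j, (i <= j <= N - 1)%nat /\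
    (forall k, (i <= k <= j)%nat -> degenerate k) /\ ~ degenerate (j + 1).
Proof.
intros Hi. remember (N - i)%nat as n eqn:En. revert i Hi En.
induction n as [|n IH]; intros i Hi En Hd.
{ assert (G := degenerate_interior _ Hi Hd). lia. }
assert (G := degenerate_interior _ Hi Hd).
destruct (excluded_middle_informative (degenerate (i + 1))) as [Hd'|Hd'].
- destruct (IH (i + 1)%nat) as (j & Hj & Hall & Hn); auto; try lia.
  exists j. split; [lia|split; auto].
  intros k Hk. destruct (Nat.eq_dec k i) as [->|]. apply Hd. apply Hall; lia.
- exists i. split; [lia|split; auto].
  intros k Hk. replace k with i by lia; apply Hd.
Qed.

(** A face can only disappear with equal neighbours: otherwise it would belong
    to a block of degenerate faces between two faces with bounded velocities.
    Each face of the block has its slope strictly between those of its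
    neighbours, so the velocities of the first and of the last face of the block
    make its length increase, at an unbounded rate since these faces shrink to
    zero length; but the length of the block vanishes at time [e]. *)
Lemma vanishing_face_flat i :
  (2 <= i <= N - 1)%nat -> x i e = x (i - 1)%nat e ->
  p (i - 1)%nat = p (i + 1)%nat.
Proof.
intros Hi Hvan. destruct (Req_dec (p (i - 1)%nat) (p (i + 1)%nat)) as [|Hnflat]; auto.
exfalso. assert (Hd : degenerate i) by (split; auto).
destruct (degenerate_block_left i) as (j & Hj & Hjall & Hjn); auto. lia.
destruct (degenerate_block_right i) as (k & Hk & Hkall & Hkn); auto. lia.
assert (Hall : forall h, (j <= h <= k)%nat -> degenerate h).
{ intros h Hh. destruct (le_lt_dec h i). apply Hjall; lia. apply Hkall; lia. }
clear Hjall Hkall.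
destruct (velocity_bounded_at_end (j - 1)) as (B1 & PB1 & HB1); auto. lia.
destruct (velocity_bounded_at_end (k + 1)) as (B2 & PB2 & HB2); auto. lia.
assert (Hsb : forall h, (j <= h <= k)%nat ->
  strictly_between (p (h - 1)%nat) (p h) (p (h + 1)%nat)).
{ intros h Hh. apply adjacent_dichotomy with Sl.
  assert (A := adjacent_faces (h - 1)%nat ltac:(lia)).
  now replace (h - 1 + 1)%nat with h in A by lia.
  apply adjacent_faces; lia. apply Hall; lia. }
destruct (Delta_sign W p j W_convex (Hsb j ltac:(lia))) as [_ Sj].
destruct (Delta_sign W p k W_convex (Hsb k ltac:(lia))) as [Sk _].
assert (Hratio : forall h, (j <= h <= k)%nat -> ratio N p h = 1).
{ intros h Hh. unfold ratio. destruct (Nat.eqb_spec N 1); [lia|].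
  destruct (Nat.eqb_spec h 1); [lia|]. destruct (Nat.eqb_spec h N); [lia|]. auto. }
set (dj := p j - p (j - 1)%nat) in *. set (dk := p (k + 1)%nat - p k) in *.
assert (Ndj : dj <> 0). { generalize (Hsb j ltac:(lia)). unfold strictly_between, dj. lra. }
assert (Ndk : dk <> 0). { generalize (Hsb k ltac:(lia)). unfold strictly_between, dk. lra. }
assert (Pcj : 0 < velocity_coeff j / dj).
{ unfold velocity_coeff. rewrite Hratio by lia.
  replace (_ / _) with (sqrt (1 + p j ^ 2) * (Defs.Delta W p j / dj)) by (field; auto).
  apply Rmult_lt_0_compat; auto. apply sqrt_lt_R0. nra. }
assert (Pck : 0 < velocity_coeff k / dk).
{ unfold velocity_coeff. rewrite Hratio by lia.
  replace (_ / _) with (sqrt (1 + p k ^ 2) * (Defs.Delta W p k / dk)) by (field; auto).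
  apply Rmult_lt_0_compat; auto. apply sqrt_lt_R0. nra. }
set (M := B1 * Rabs (/ dj) + B2 * Rabs (/ dk)).
assert (PM : 0 <= M).
{ unfold M. apply Rplus_le_le_0_compat; apply Rmult_le_pos; auto; apply Rabs_pos. }
set (del := velocity_coeff j / dj / (M + 1)).
assert (Pdel : 0 < del) by (apply Rdiv_lt_0_compat; lra).
assert (HL : locally e (fun t => xc j t - xc (j - 1) t < del)).
{ assert (C : continuous (fun t => xc j t - xc (j - 1) t) e).
  { apply (continuous_minus (V := R_NormedModule)); apply xc_continuous; lia. }
  apply (C (fun z => z < del)). apply (open_lt del). rewrite !xc_id by lra.
  destruct (Hall j ltac:(lia)) as [E _]. rewrite E. lra. }
destruct (filter_and _ _ HL (filter_and _ _ HB1 HB2)) as [eps Heps].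
set (t0 := e - Rmin (eps / 2) ((e - s) / 2)).
assert (Ht0 : s < t0 < e /\ e - t0 < eps).
{ assert (Pe := cond_pos eps). unfold t0, Rmin. destruct Rle_dec; lra. }
set (dL := fun t =>
  - ((velocity W N p (fun j => x j t) (k + 1) - velocity W N p (fun j => x j t) k) / dk)
  - - ((velocity W N p (fun j => x j t) j - velocity W N p (fun j => x j t) (j - 1)) / dj)).
assert (HdL : forall t, t0 <= t < e -> 0 < dL t).
{ intros t Ht.
  assert (Hst : s < t < e) by lra.
  destruct (Heps t) as (G1 & G2 & G3).
  { unfold ball; simpl; unfold AbsRing_ball, abs, minus, plus, opp; simpl.
    apply Rabs_def1; lra. }
  specialize (G2 Hst). specialize (G3 Hst). rewrite !xc_id in G1 by lra.
  assert (Hlen : forall h, (1 <= h <= N)%nat -> 0 < x h t - x (h - 1)%nat t).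
  { intros h Hh. destruct (phase_admissible _ _ _ _ _ _ _ _ Hphase t ltac:(lra)) as (_ & _ & _ & E).
    destruct (E h Hh). lra. }
  assert (Lj := Hlen j ltac:(lia)). assert (Lk := Hlen k ltac:(lia)).
  set (v1 := velocity W N p (fun j => x j t) (j - 1)) in *.
  set (v2 := velocity W N p (fun j => x j t) (k + 1)) in *.
  assert (E : dL t = velocity_coeff j / dj / (x j t - x (j - 1)%nat t)
    + velocity_coeff k / dk / (x k t - x (k - 1)%nat t)
    - (v1 * / dj + v2 * / dk)).
  { unfold dL. fold v1 v2. rewrite !velocity_coeffE. field. repeat split; lra. }
  rewrite E.
  assert (A1 : M + 1 < velocity_coeff j / dj / (x j t - x (j - 1)%nat t)).
  { apply Rlt_div_r; auto. unfold del in G1. apply Rlt_div_r in G1; lra. }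
  assert (A2 : 0 < velocity_coeff k / dk / (x k t - x (k - 1)%nat t))
    by (apply Rdiv_lt_0_compat; auto).
  assert (A3 : v1 * / dj + v2 * / dk <= M).
  { unfold M. apply Rle_trans with (1 := Rle_abs _).
    eapply Rle_trans. apply Rabs_triang. rewrite !Rabs_mult.
    apply Rplus_le_compat; apply Rmult_le_compat_r; auto; apply Rabs_pos. }
  lra. }
destruct (MVT_gen (fun t => xc k t - xc (j - 1) t) t0 e
  (fun t => if Rlt_dec t e then dL t else 1)) as (c & Hc & E).
- rewrite Rmin_left, Rmax_right by lra. intros t Ht.
  destruct (Rlt_dec t e); [|lra].
  apply (is_derive_minus (V := R_NormedModule)).
  + apply xc_derive. lra. apply (phase_corners _ _ _ _ _ _ _ _ Hphase). lia. lra.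
  + apply xc_derive. lra.
    assert (G := phase_corners _ _ _ _ _ _ _ _ Hphase (j - 1) t ltac:(lia) ltac:(lra)).
    replace (j - 1 + 1)%nat with j in G by lia. exact G.
- intros t _. apply continuity_pt_filterlim.
  apply (continuous_minus (V := R_NormedModule)); apply xc_continuous; lia.
- rewrite Rmin_left, Rmax_right in Hc by lra.
  assert (Hpos : 0 < (if Rlt_dec c e then dL c else 1)).
  { destruct (Rlt_dec c e). apply HdL; lra. lra. }
  assert (E0 : xc k e - xc (j - 1) e = 0).
  { rewrite !xc_id by lra.
    assert (G : forall h, (j - 1 + h <= k)%nat -> x (j - 1 + h)%nat e = x (j - 1)%nat e).
    { induction h as [|h IH]; intros Hh. now rewrite Nat.add_0_r.
      destruct (Hall (j - 1 + S h)%nat ltac:(lia)) as [G _]. rewrite G.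
      rewrite <- IH by lia. f_equal. lia. }
    specialize (G (k - (j - 1))%nat). rewrite <- G by lia.
    replace (j - 1 + (k - (j - 1)))%nat with k by lia. ring. }
  assert (P0 : 0 <= xc k t0 - xc (j - 1) t0).
  { rewrite !xc_id by lra.
    destruct (phase_closed t0 ltac:(lra)) as (_ & _ & Hcl).
    assert (G : forall h, (j - 1 + h <= k)%nat -> x (j - 1)%nat t0 <= x (j - 1 + h)%nat t0).
    { induction h as [|h IH]; intros Hh. rewrite Nat.add_0_r; lra.
      apply Rle_trans with (1 := IH ltac:(lia)).
      destruct (Hcl (j - 1 + S h)%nat ltac:(lia)) as [G _].
      now replace (j - 1 + S h - 1)%nat with (j - 1 + h)%nat in G by lia. }
    specialize (G (k - (j - 1))%nat ltac:(lia)).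
    replace (j - 1 + (k - (j - 1)))%nat with k in G by lia. lra. }
  assert (0 < (if Rlt_dec c e then dL c else 1) * (e - t0)) by (apply Rmult_lt_0_compat; lra).
  lra.
Qed.

End Phase.

(** * Configurations with adjacent slopes *)

(** Adjacent slopes at distance at most [m], both bounded by [P]. *)
Definition linked (S : R -> Prop) (m P p q : R) : Prop :=
  adjacent S p q /\ Rabs (q - p) <= m /\ Rabs p <= P /\ Rabs q <= P.

(** The invariant of the evolution: the first and the last slope are [a] and
    [b], and consecutive slopes are linked. *)
Definition good_config (S : R -> Prop) (a b m P : R) (N : nat) (p : nat -> R) : Prop :=
  (1 <= N)%nat /\ p 1%nat = a /\ p N = b /\
  forall i, (1 <= i < N)%nat -> linked S m P (p i) (p (i + 1)%nat).

(** As only faces with equal neighbours disappear, every pair of consecutive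
    slopes after the event already occurred before it. *)
Lemma good_config_after_event W S um T s e N p x N' p' X' a b m P :
  strictly_convex W -> 0 <= s -> s < e -> e <= T ->
  continuous_on (rect T) (fun z : R * R => um (fst z) (snd z)) ->
  phase W S um s e N p x ->
  good_config S a b m P N p ->
  faces N' p' X' = merge_faces (remove_vanished (faces N p (fun i => x i e))) ->
  good_config S a b m P N' p'.
Proof.
intros HW Hs Hse HeT Hum Hph (HN & Ha & Hb & Hl) Hf.
destruct (phase_ends _ _ _ _ _ _ _ _ Hph) as [E1 E2].
assert (Hcl := phase_closed W S um T s e N p x Hs Hse HeT Hum Hph e ltac:(lra)).
destruct Hcl as (_ & _ & Hcl).
set (len := fun i => x i e - x (i - 1)%nat e).
assert (Hfs : faces N p (fun i => x i e) =
  (p 1%nat, len 1%nat) :: map (fun i => (p i, len i)) (List.seq 2 (N - 1))).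
{ unfold faces. destruct N as [|n]; [lia|]. simpl. now rewrite Nat.sub_0_r. }
assert (Hlast : forall d, last (faces N p (fun i => x i e)) d = (p N, len N)).
{ intros d. unfold faces. now apply last_map_seq with (f := fun i => (p i, len i)). }
destruct (merge_remove_chain (linked S m P) (p 1%nat, len 1%nat)
  (map (fun i => (p i, len i)) (List.seq 2 (N - 1))) (0, 0)) as (d' & l' & G1 & G2 & G3).
- intros q r H. apply H.
- unfold len; simpl. lra.
- rewrite <- Hfs, Hlast. unfold len; simpl. lra.
- rewrite <- Hfs. apply Sorted_seq with (f := fun i => (p i, len i)).
  intros i H1 H2. apply Hl. lia.
- rewrite <- Hfs. apply triples_seq with (f := fun i => (p i, len i)).
  intros i H1 H2 H3. simpl in H3 |- *.
  assert (F := vanishing_face_flat W S um T s e N p x HW Hs Hse HeT Hum Hph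
    (fun i Hi => proj1 (Hl i Hi)) (i + 1)).
  replace (i + 1 - 1)%nat with i in F by lia.
  replace (i + 1 + 1)%nat with (i + 2)%nat in F by lia. apply F. lia.
  destruct (Hcl (i + 1)%nat ltac:(lia)) as [Hle _].
  unfold len in H3. replace (i + 1 - 1)%nat with i in H3, Hle by lia. lra.
- rewrite <- Hfs in G1, G3. rewrite Hlast in G3.
  rewrite G1 in Hf. rewrite <- Hf in G2, G3. unfold faces in G2, G3.
  assert (HN' : (1 <= N')%nat).
  { destruct N'; [|lia]. discriminate Hf. }
  split; auto. split; [|split].
  + destruct N' as [|n]; [lia|]. simpl in Hf. injection Hf as Hf1 _ _. now rewrite Hf1.
  + rewrite (last_map_seq (fun i => (p' i, X' i - X' (i - 1)%nat))) in G3 by exact HN'.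
    simpl in G3. congruence.
  + intros i Hi. apply (proj1 (Sorted_seq _ _ _ _) G2); lia.
Qed.

(** * The discrete flux *)

Section Flux.

Variables (W : R -> R) (K la La : R) (HT : taylor_bounds W K la La)
  (S : R -> Prop) (a b m P : R) (N : nat) (p : nat -> R)
  (Hgood : good_config S a b m P N p) (Hbd : boundary_slopes S N p)
  (m_pos : 0 <= m) (PK : P + m <= K) (aP : Rabs a <= P) (bP : Rabs b <= P)
  (Ha : forall q, adjacent S a q -> Rabs (q - a) <= m)
  (Hb : forall q, adjacent S b q -> Rabs (q - b) <= m).

Lemma slope_steps i : (i <= N)%nat ->
  p i <> p (i + 1)%nat /\ Rabs (p (i + 1)%nat - p i) <= m.
Proof.
destruct Hgood as (HN & E1 & EN & Hl). destruct Hbd as (B1 & _ & B2 & _).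
intros Hi. destruct (Nat.eq_dec i 0) as [->|].
{ simpl. rewrite E1 in *. split. apply B1.
  rewrite Rabs_minus_sym. apply Ha. now apply adjacent_sym. }
destruct (Nat.eq_dec i N) as [->|].
{ rewrite EN in *. apply adjacent_sym in B2. split. apply B2. now apply Hb. }
destruct (Hl i ltac:(lia)) as (A & A' & _). split; auto. apply A.
Qed.

Lemma slope_range i : (i <= N + 1)%nat -> Rabs (p i) <= K.
Proof.
destruct Hgood as (HN & E1 & EN & Hl). intros Hi.
destruct (Nat.eq_dec i 0) as [->|].
{ destruct (slope_steps 0 ltac:(lia)) as [_ H]. simpl in H. rewrite E1 in H.
  rewrite Rabs_minus_sym in H. assert (G := Rabs_triang (p 0%nat - a) a).
  replace (p 0%nat - a + a) with (p 0%nat) in G by ring. lra. }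
destruct (Nat.eq_dec i (N + 1)) as [->|].
{ destruct (slope_steps N ltac:(lia)) as [_ H]. rewrite EN in H.
  assert (G := Rabs_triang (p (N + 1)%nat - b) b).
  replace (p (N + 1)%nat - b + b) with (p (N + 1)%nat) in G by ring. lra. }
destruct (Nat.eq_dec i N) as [->|]. rewrite EN; lra.
destruct (Hl i ltac:(lia)) as (_ & _ & A & _). lra.
Qed.

(** The flux at the corners: the divided difference of [W] inside, and the
    exact value of [W'] at the two ends. *)
Definition flux (i : nat) : R :=
  if (i =? 0)%nat then Derive W a
  else if (i =? N)%nat then Derive W b else divdiff W (p i) (p (i + 1)%nat).

Lemma flux_0 : flux 0 = Derive W a.
Proof. reflexivity. Qed.

Lemma flux_N : flux N = Derive W b.
Proof.
unfold flux. rewrite Nat.eqb_refl. destruct (Nat.eqb_spec N 0); auto.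
destruct Hgood; lia.
Qed.

Lemma flux_interior i : (1 <= i < N)%nat -> flux i = divdiff W (p i) (p (i + 1)%nat).
Proof.
intros Hi. unfold flux. destruct (Nat.eqb_spec i 0); [lia|].
destruct (Nat.eqb_spec i N); [lia|auto].
Qed.

Lemma flux_close i : (1 <= i <= N)%nat ->
  Rabs (flux i - Derive W (p i)) <= La * m /\
  Rabs (flux (i - 1) - Derive W (p i)) <= La * m.
Proof.
destruct Hgood as (HN & E1 & EN & Hl). intros Hi.
assert (PL : 0 < La) by apply HT.
assert (Z : 0 <= La * m) by (apply Rmult_le_pos; lra).
split.
- destruct (Nat.eq_dec i N) as [->|].
  { rewrite flux_N, EN, Rminus_diag, Rabs_R0; auto. }
  rewrite flux_interior by lia. destruct (slope_steps i ltac:(lia)) as [A B].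
  eapply Rle_trans. apply (divdiff_close W K la La); auto; apply slope_range; lia.
  apply Rmult_le_compat_l; lra.
- destruct (Nat.eq_dec i 1) as [->|].
  { simpl. rewrite flux_0, E1, Rminus_diag, Rabs_R0; auto. }
  rewrite flux_interior by lia. destruct (slope_steps (i - 1) ltac:(lia)) as [A B].
  replace (i - 1 + 1)%nat with i in * by lia. rewrite divdiff_sym by auto.
  eapply Rle_trans. apply (divdiff_close W K la La); auto; apply slope_range; lia.
  apply Rmult_le_compat_l; try lra. now rewrite Rabs_minus_sym.
Qed.

(** The velocity of a face is [sqrt (1 + p^2)] times the slope of the flux, up
    to a relative error of order [m] on the first and on the last face. *)
Lemma velocity_flux X i : (1 <= i <= N)%nat -> X (i - 1)%nat < X i ->
  let s := (flux i - flux (i - 1)) / (X i - X (i - 1)%nat) in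
  Rabs (velocity W N p X i - sqrt (1 + p i ^ 2) * s)
   <= (1 + K) * (La / la) * m * Rabs s.
Proof.
intros Hi HX s. destruct Hgood as (HN & E1 & EN & Hl).
destruct Hbd as (_ & Sb1 & _ & SbN).
assert (Hpl : 0 < la /\ 0 < La) by (split; apply HT).
set (l := X i - X (i - 1)%nat) in *. assert (Pl : 0 < l) by (unfold l; lra).
assert (Hg := sqrt_1_sq_bounds (p i) K (slope_range i ltac:(lia))).
set (g := sqrt (1 + p i ^ 2)) in *.
assert (PC : 0 <= (1 + K) * (La / la) * m * Rabs s).
{ apply Rmult_le_pos; [|apply Rabs_pos]. apply Rmult_le_pos; auto.
  apply Rmult_le_pos. lra. apply Rdiv_le_0_compat; lra. }
assert (Gen : forall c, velocity W N p X i = g * (c / l) ->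
  Rabs (c - (flux i - flux (i - 1))) <= La / la * m * Rabs (flux i - flux (i - 1)) ->
  Rabs (velocity W N p X i - g * s) <= (1 + K) * (La / la) * m * Rabs s).
{ intros c -> Hc.
  replace (g * (c / l) - g * s) with (g * ((c - (flux i - flux (i - 1))) / l))
    by (unfold s; field; lra).
  unfold s, Rdiv at 1. unfold Rdiv at 2.
  rewrite !Rabs_mult, Rabs_inv, (Rabs_pos_eq l), (Rabs_pos_eq g) by lra.
  replace ((1 + K) * (La / la) * m * (Rabs (flux i - flux (i - 1)) * / l)) with
    ((1 + K) * (La / la * m * Rabs (flux i - flux (i - 1)) * / l)) by ring.
  assert (Pi : 0 < / l) by now apply Rinv_0_lt_compat.
  apply Rmult_le_compat; try lra.
  apply Rmult_le_pos. apply Rabs_pos. lra.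
  apply Rmult_le_compat_r; lra. }
destruct (Nat.eq_dec N 1) as [EN1|].
{ (* a single face does not move, and its flux is constant because [a = b] *)
  assert (i = 1)%nat by lia. subst i.
  assert (Eab : flux 1 - flux (1 - 1) = 0).
  { rewrite <- EN1 at 1. rewrite flux_N. simpl. rewrite flux_0.
    rewrite <- E1, <- EN, EN1. ring. }
  apply (Gen 0).
  - unfold velocity, ratio. rewrite EN1. simpl. field. unfold l in *; simpl in *; lra.
  - rewrite Eab, Rminus_diag, Rabs_R0. lra. }
assert (Hr1 : (N =? 1)%nat = false) by (apply Nat.eqb_neq; auto).
destruct (Nat.eq_dec i 1) as [->|Hi1].
{ change (1 - 1)%nat with 0%nat in *. change (1 + 1)%nat with 2%nat in *.
  apply (Gen ((p 2%nat - p 1%nat) / (p 2%nat - p 0%nat) *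
    (divdiff W (p 1%nat) (p 2%nat) - divdiff W (p 0%nat) (p 1%nat)))).
  - unfold velocity, ratio. rewrite Hr1. simpl Nat.eqb. unfold Defs.Delta.
    change (1 - 1)%nat with 0%nat. change (1 + 1)%nat with 2%nat.
    unfold divdiff. fold g l. unfold Rdiv. ring.
  - rewrite flux_interior by lia. rewrite flux_0, <- E1. change (1 + 1)%nat with 2%nat.
    apply (boundary_flux_ratio W K la La); auto; try (apply slope_range; lia).
    apply (slope_steps 0); lia. }
destruct (Nat.eq_dec i N) as [->|HiN].
{ apply (Gen ((p N - p (N - 1)%nat) / (p (N + 1)%nat - p (N - 1)%nat) *
    (divdiff W (p N) (p (N + 1)%nat) - divdiff W (p (N - 1)%nat) (p N)))).
  - unfold velocity, ratio. rewrite Hr1, Nat.eqb_refl.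
    destruct (Nat.eqb_spec N 1); [lia|]. unfold Defs.Delta, divdiff. fold g l. unfold Rdiv. ring.
  - rewrite flux_N, flux_interior by lia. replace (N - 1 + 1)%nat with N by lia.
    destruct (slope_steps (N - 1) ltac:(lia)) as [N1 _].
    destruct (slope_steps N ltac:(lia)) as [N2 M2].
    replace (N - 1 + 1)%nat with N in N1 by lia.
    (* reflection exchanges the roles of the two neighbours *)
    assert (Hsb : strictly_between (p (N + 1)%nat) (p N) (p (N - 1)%nat)).
    { unfold strictly_between in *; lra. }
    assert (G := boundary_flux_ratio W K la La m _ _ _ HT (slope_range (N + 1) ltac:(lia))
      (slope_range N ltac:(lia)) (slope_range (N - 1) ltac:(lia)) Hsb).
    rewrite (divdiff_sym W (p N) (p (N - 1)%nat)) in G by auto.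
    rewrite (divdiff_sym W (p (N + 1)%nat) (p N)) in G by auto.
    rewrite EN in *.
    rewrite (Rabs_minus_sym (Derive W b)).
    rewrite <- Rabs_Ropp.
    replace (- _) with ((p (N - 1)%nat - b) / (p (N - 1)%nat - p (N + 1)%nat) *
      (divdiff W (p (N - 1)%nat) b - divdiff W b (p (N + 1)%nat)) -
      (divdiff W (p (N - 1)%nat) b - Derive W b)).
    apply G. now rewrite Rabs_minus_sym.
    field. unfold strictly_between in Hsb. lra. }
apply (Gen (flux i - flux (i - 1))).
- rewrite !flux_interior by lia. replace (i - 1 + 1)%nat with i by lia.
  unfold velocity, ratio. rewrite Hr1.
  destruct (Nat.eqb_spec i 1); [lia|]. destruct (Nat.eqb_spec i N); [lia|].
  unfold Defs.Delta, divdiff. fold g l. ring.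
- rewrite Rminus_diag, Rabs_R0. apply Rmult_le_pos; [|apply Rabs_pos].
  apply Rmult_le_pos; auto. apply Rdiv_le_0_compat; lra.
Qed.

End Flux.

(** * The relative energy *)

(** The solution of the Neumann problem together with its derivatives, extended
    to the whole plane; [U i j t y] is the derivative of order [i] in space and
    [j] in time. *)
Record extended_solution (W : R -> R) (a b T : R) (U : nat -> nat -> R -> R -> R)
  : Prop := {
  sol_cont : forall i j, (i + j <= 3)%nat -> cont2 (U i j);
  sol_dt : forall i j t y, (i + j < 3)%nat -> 0 < t < T ->
    is_derive (fun r => U i j r y) t (U i (S j) t y);
  sol_dy : forall i j t y, (i + j < 3)%nat -> 0 < y < 1 ->
    is_derive (U i j t) y (U (S i) j t y);
  sol_pde : forall t y,
    U 0%nat 1%nat t y / sqrt (1 + U 1%nat 0%nat t y ^ 2) =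
    Derive_n W 2 (U 1%nat 0%nat t y) * U 2%nat 0%nat t y;
  sol_left : forall t, U 1%nat 0%nat t 0 = a;
  sol_right : forall t, U 1%nat 0%nat t 1 = b
}.

Lemma neumann_solution_extend W a b T u0 u D :
  0 <= T -> neumann_solution W a b T u0 u D ->
  extended_solution W a b T (fun i j => extend T (D i j)).
Proof.
intros HT ((H00 & Hc & Hd) & Hpde & _ & Ha & Hb).
split.
- intros i j Hij. apply cont2_extend; auto.
- intros i j t y Hij Ht. apply extend_derive_t with (ft := D i (S j)); auto.
  intros x r Hr. now apply Hd.
- intros i j t y Hij Hy. apply extend_derive_y; auto.
  intros x r Hr. now apply Hd.
- intros t y. unfold extend. apply Hpde; apply clamp_in; lra.
- intros t. unfold extend. rewrite (clamp_id 0 1 0) by lra. apply Ha, clamp_in; lra.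
- intros t. unfold extend. rewrite (clamp_id 0 1 1) by lra. apply Hb, clamp_in; lra.
Qed.

(** Density of the relative energy of a function with slope [p] and value
    [w t y] with respect to the exact solution. *)
Definition density (W : R -> R) (U : nat -> nat -> R -> R -> R)
    (w : R -> R -> R) (eps t p y : R) : R :=
  W p - W (U 1%nat 0%nat t y) - Derive W (U 1%nat 0%nat t y) * (p - U 1%nat 0%nat t y)
  + eps * (w t y - U 0%nat 0%nat t y) ^ 2.

(** Relative energy at time [t] of the configuration with slopes [p] and
    corners [X]. *)
Definition energy (W : R -> R) (U : nat -> nat -> R -> R -> R)
    (w : R -> R -> R) (eps t : R) (N : nat) (p X : nat -> R) : R :=
  fsum (fun i => RInt (density W U w eps t (p i)) (X (i - 1)%nat) (X i)) N.

Lemma cont2_density W U w eps p :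
  C3 W -> (forall i j, (i + j <= 3)%nat -> cont2 (U i j)) -> cont2 w ->
  cont2 (fun t y => density W U w eps t p y).
Proof.
intros HW HU Hw. unfold density.
apply cont2_plus; [apply cont2_minus; [apply cont2_minus|]|].
- apply cont2_const.
- apply (cont2_app W). apply W_continuous; auto. apply HU; lia.
- apply cont2_mult. apply (cont2_app (Derive W)). now apply W1_continuous. apply HU; lia.
  apply cont2_minus. apply cont2_const. apply HU; lia.
- apply cont2_mult. apply cont2_const. apply cont2_pow. apply cont2_minus; [auto|apply HU; lia].
Qed.

Lemma is_derive_density W (g k : R -> R) (pp eps t g' k' : R) :
  C3 W -> is_derive g t g' -> is_derive k t k' ->
  is_derive (fun r => W pp - W (g r) - Derive W (g r) * (pp - g r) + eps * k r ^ 2) t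
    (- (Derive_n W 2 (g t) * g' * (pp - g t)) + eps * (2 * k t * k')).
Proof.
intros HW Hg Hk.
evar_last.
- apply (is_derive_plus (V := R_NormedModule)).
  + apply (is_derive_minus (V := R_NormedModule)).
    * apply (is_derive_minus (V := R_NormedModule)).
      apply (is_derive_const (V := R_NormedModule)).
      apply (is_derive_comp W g). apply (W_derive W HW). exact Hg.
    * apply (is_derive_mult (fun r => Derive W (g r)) (fun r => pp - g r)).
      apply (is_derive_comp (Derive W) g). apply (W_derive2 W HW). exact Hg.
      apply (is_derive_minus (V := R_NormedModule)).
      apply (is_derive_const (V := R_NormedModule)). exact Hg.
      intros; apply Rmult_comm.
  + apply (is_derive_scal (fun r => k r ^ 2)).
    apply (is_derive_pow k 2). exact Hk.
- unfold plus, minus, opp, mult, scal, zero, plus, opp; simpl.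
  unfold mult; simpl. ring.
Qed.

Section Energy_estimate.

Variables (W : R -> R) (W_C3 : C3 W)
  (a b T : R) (U : nat -> nat -> R -> R -> R) (HU : extended_solution W a b T U)
  (K la La B eps m : R) (HTb : taylor_bounds W K la La).
Hypotheses (U10_bound : forall t y, Rabs (U 1%nat 0%nat t y) <= K)
  (U11_bound : forall t y, Rabs (U 1%nat 1%nat t y) <= B)
  (qx_bound : forall t y,
     Rabs (U 0%nat 1%nat t y / sqrt (1 + U 1%nat 0%nat t y ^ 2)) <= B)
  (K_pos : 0 <= K) (m_range : 0 <= m <= 1)
  (m_small : (1 + K) * (La / la) * m <= 1 / 2)
  (eps_range : 0 < eps <= 1) (eps_small : eps * (3 * (1 + K + 1) ^ 2) <= 1 / 4).

Variables (Sl : R -> Prop) (P : R) (PK : P + m <= K)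
  (aP : Rabs a <= P) (bP : Rabs b <= P)
  (Ha : forall q, adjacent Sl a q -> Rabs (q - a) <= m)
  (Hb : forall q, adjacent Sl b q -> Rabs (q - b) <= m)
  (um : R -> R -> R)
  (um_continuous : continuous_on (rect T) (fun z : R * R => um (fst z) (snd z))).

Variables (s e : R) (N : nat) (p : nat -> R) (x : nat -> R -> R)
  (s_pos : 0 <= s) (s_lt_e : s < e) (e_le_T : e <= T)
  (Hphase : phase W Sl um s e N p x)
  (Hgood : good_config Sl a b m P N p).

Let Um : R -> R -> R := extend T um.
Let xs : nat -> R -> R := xc s e x.
(** Velocity of the [i]-th face. *)
Let v (i : nat) (t : R) : R := velocity W N p (fun j => x j t) i.

Let HT : 0 <= T. Proof. lra. Qed.

Let cont2_Um : cont2 Um.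
Proof. now apply cont2_extend. Qed.

Let xs_continuous i t : (i <= N)%nat -> continuous (xs i) t.
Proof. intros Hi. apply (xc_continuous W Sl um s e N p x); auto. Qed.

Let xs_id i t : s <= t <= e -> xs i t = x i t.
Proof. apply xc_id. Qed.

Let Hclosed t : s <= t <= e -> closed_config N p (fun i => x i t) (fun y => um y t).
Proof. now apply (phase_closed W Sl um T s e N p x). Qed.

Let x_range i t : s <= t <= e -> (i <= N)%nat -> 0 <= x i t <= 1.
Proof. intros Ht Hi. now apply (closed_config_range _ _ _ _ _ (Hclosed t Ht)). Qed.

(** Value at [y = 0] of the affine function that coincides with [um] on the
    [i]-th face; it has the velocity of the face as derivative. *)
Let h (i : nat) (t : R) : R := Um t (xs i t) - p i * xs i t.

Let h_continuous i t : (i <= N)%nat -> continuous (h i) t.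
Proof.
intros Hi. apply (continuous_minus (V := R_NormedModule)).
apply (cont2_comp Um (fun t => t)); auto. apply continuous_id.
apply (continuous_mult (K := R_AbsRing)). apply continuous_const. auto.
Qed.

Let Um_face i t y : (1 <= i <= N)%nat -> s <= t <= e ->
  x (i - 1)%nat t <= y <= x i t -> Um t y = h i t + p i * y.
Proof.
intros Hi Ht Hy. unfold h. rewrite xs_id by auto.
assert (R1 := x_range (i - 1) t Ht ltac:(lia)). assert (R2 := x_range i t Ht ltac:(lia)).
unfold Um. rewrite !extend_id by lra.
destruct (Hclosed t Ht) as (_ & _ & H). destruct (H i Hi) as [H1 H2].
rewrite (H2 y Hy), (H2 (x i t)) by lra. ring.
Qed.

Let length_pos i t : (1 <= i <= N)%nat -> s <= t < e -> x (i - 1)%nat t < x i t.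
Proof.
intros Hi Ht. destruct (phase_admissible _ _ _ _ _ _ _ _ Hphase t Ht) as (_ & _ & _ & E).
now destruct (E i Hi).
Qed.

Let near_phase t : s < t < e -> locally t (fun r => s < r < e).
Proof.
intros Ht. apply (locally_interval _ t s e); try apply Ht.
intros r H1 H2; now split.
Qed.

Let h_derive i t : (1 <= i <= N)%nat -> s < t < e -> is_derive (h i) t (v i t).
Proof.
intros Hi Ht.
assert (L := length_pos i t Hi ltac:(lra)).
set (y := (x (i - 1)%nat t + x i t) / 2).
assert (Hy : x (i - 1)%nat t < y < x i t) by (unfold y; lra).
apply is_derive_ext_loc with (fun r => um y r - p i * y).
- assert (L1 : locally t (fun r => xs (i - 1) r < y)).
  { apply (xs_continuous (i - 1) t ltac:(lia) (fun z => z < y)). apply (open_lt y).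
    rewrite xs_id by lra. apply Hy. }
  assert (L2 : locally t (fun r => y < xs i r)).
  { apply (xs_continuous i t ltac:(lia) (fun z => y < z)). apply (open_gt y).
    rewrite xs_id by lra. apply Hy. }
  generalize (filter_and _ _ (near_phase t Ht) (filter_and _ _ L1 L2)).
  apply filter_imp. intros r (Hr & H1 & H2). rewrite xs_id in H1, H2 by lra.
  assert (E := Um_face i r y Hi ltac:(lra) ltac:(lra)).
  assert (R1 := x_range (i - 1) r ltac:(lra) ltac:(lia)).
  assert (R2 := x_range i r ltac:(lra) ltac:(lia)).
  unfold Um in E. rewrite extend_id in E by lra. lra.
- evar_last. apply (is_derive_minus (V := R_NormedModule)).
  apply (phase_velocity _ _ _ _ _ _ _ _ Hphase i t y Hi Ht Hy).
  apply (is_derive_const (V := R_NormedModule)).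
  unfold minus, plus, opp, zero; simpl. fold (v i t). unfold v. ring.
Qed.

Let v_continuous i t : (1 <= i <= N)%nat -> s < t < e -> continuous (v i) t.
Proof.
intros Hi Ht.
assert (L := length_pos i t Hi ltac:(lra)).
apply continuous_ext_loc with (fun r => velocity_coeff W N p i / (xs i r - xs (i - 1) r)).
- generalize (near_phase t Ht). apply filter_imp. intros r Hr.
  unfold v. rewrite (velocity_coeffE W N p x), !xs_id by lra. reflexivity.
- apply (continuous_mult (K := R_AbsRing)). apply continuous_const.
  apply (continuous_comp (fun r => xs i r - xs (i - 1) r) Rinv).
  apply (continuous_minus (V := R_NormedModule)); apply xs_continuous; lia.
  apply continuous_Rinv. rewrite !xs_id by lra. lra.
Qed.

(** Speed of the corners, the two ends being fixed. *)
Let xd (i : nat) (t : R) : R :=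
  if (i =? 0)%nat then 0 else if (i =? N)%nat then 0
  else - ((v (i + 1) t - v i t) / (p (i + 1)%nat - p i)).

Let xs_derive i t : (i <= N)%nat -> s < t < e -> is_derive (xs i) t (xd i t).
Proof.
intros Hi Ht. unfold xd.
assert (Hconst : forall c, (forall r, s <= r <= e -> x i r = c) -> is_derive (xs i) t 0).
{ intros c Hc. apply is_derive_ext_loc with (fun _ => c).
  generalize (near_phase t Ht). apply filter_imp. intros r Hr.
  rewrite xs_id by lra. symmetry. apply Hc. lra.
  apply (is_derive_const (V := R_NormedModule)). }
destruct (Nat.eqb_spec i 0) as [->|H0].
{ apply (Hconst 0). intros r Hr. apply (Hclosed r Hr). }
destruct (Nat.eqb_spec i N) as [->|HN].
{ apply (Hconst 1). intros r Hr. apply (Hclosed r Hr). }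
apply (xc_derive s e x). exact Ht.
apply (phase_corners _ _ _ _ _ _ _ _ Hphase); auto. lia.
Qed.

(** The energy density on the [i]-th face, with [um] replaced by its affine
    expression, and its time derivative. *)
Let f (i : nat) (t y : R) : R :=
  W (p i) - W (U 1%nat 0%nat t y) - Derive W (U 1%nat 0%nat t y) * (p i - U 1%nat 0%nat t y)
  + eps * (h i t + p i * y - U 0%nat 0%nat t y) ^ 2.

Let ft (i : nat) (t y : R) : R :=
  - (Derive_n W 2 (U 1%nat 0%nat t y) * U 1%nat 1%nat t y * (p i - U 1%nat 0%nat t y))
  + eps * (2 * (h i t + p i * y - U 0%nat 0%nat t y) * (v i t - U 0%nat 1%nat t y)).

Let density_f i t y : (1 <= i <= N)%nat -> s <= t <= e ->
  x (i - 1)%nat t <= y <= x i t -> density W U Um eps t (p i) y = f i t y.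
Proof.
intros Hi Ht Hy. unfold density, f. now rewrite (Um_face i t y Hi Ht Hy).
Qed.

Let sol_cont' i j : (i + j <= 3)%nat -> cont2 (U i j).
Proof. apply (sol_cont _ _ _ _ _ HU). Qed.

Let cont2_gap i : (i <= N)%nat -> cont2 (fun t y => h i t + p i * y - U 0%nat 0%nat t y).
Proof.
intros Hi. apply cont2_minus; [apply cont2_plus|].
- apply cont2_fst. intros; now apply h_continuous.
- apply cont2_mult. apply cont2_const. apply (cont2_snd (fun y => y)).
  intros; apply continuous_id.
- apply sol_cont'; lia.
Qed.

Let cont2_f i : (i <= N)%nat -> cont2 (f i).
Proof.
intros Hi. unfold f.
apply cont2_plus; [apply cont2_minus; [apply cont2_minus|]|].
- apply cont2_const.
- apply (cont2_app W). apply W_continuous; auto. apply sol_cont'; lia.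
- apply cont2_mult. apply (cont2_app (Derive W)). now apply W1_continuous. apply sol_cont'; lia.
  apply cont2_minus. apply cont2_const. apply sol_cont'; lia.
- apply cont2_mult. apply cont2_const. apply cont2_pow. now apply cont2_gap.
Qed.

Let f_derive i t y : (1 <= i <= N)%nat -> s < t < e ->
  is_derive (fun r => f i r y) t (ft i t y).
Proof.
intros Hi Ht. unfold f, ft.
apply (is_derive_density W (fun r => U 1%nat 0%nat r y)
  (fun r => h i r + p i * y - U 0%nat 0%nat r y)); auto.
- apply (sol_dt _ _ _ _ _ HU 1 0). lia. lra.
- evar_last. apply (is_derive_minus (V := R_NormedModule)).
  apply (is_derive_plus (V := R_NormedModule)).
  now apply h_derive. apply (is_derive_const (V := R_NormedModule)).
  apply (sol_dt _ _ _ _ _ HU 0 0). lia. lra.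
  unfold minus, plus, opp, zero; simpl. ring.
Qed.

Let ft_continuous i t y : (1 <= i <= N)%nat -> s < t < e ->
  continuous (fun z : R * R => ft i (fst z) (snd z)) (t, y).
Proof.
intros Hi Ht. unfold ft.
apply (continuous_plus (V := R_NormedModule)).
- assert (C : cont2 (fun t y => - (Derive_n W 2 (U 1%nat 0%nat t y) * U 1%nat 1%nat t y *
    (p i - U 1%nat 0%nat t y)))).
  { apply cont2_opp. apply cont2_mult. apply cont2_mult.
    apply (cont2_app (Derive_n W 2)). now apply W2_continuous. apply sol_cont'; lia.
    apply sol_cont'; lia. apply cont2_minus. apply cont2_const. apply sol_cont'; lia. }
  exact (C (t, y)).
- apply (continuous_mult (K := R_AbsRing)). apply continuous_const.
  apply (continuous_mult (K := R_AbsRing)).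
  + exact (cont2_mult (fun _ _ => 2) _ (cont2_const 2) (cont2_gap i ltac:(lia)) (t, y)).
  + apply (continuous_minus (V := R_NormedModule)).
    apply (continuous_comp fst (v i)). apply continuous_fst. now apply v_continuous.
    exact (sol_cont' 0 1 ltac:(lia) (t, y)).
Qed.

(** The discrete flux on the [i]-th face, its slope, and the exact flux. *)
Let sg (i : nat) : R := flux W a b N p i.
Let fs (i : nat) (t : R) : R := (sg i - sg (i - 1)) / (x i t - x (i - 1)%nat t).
Let sgl (i : nat) (t y : R) : R := sg (i - 1) + fs i t * (y - x (i - 1)%nat t).
Let q (t y : R) : R := Derive W (U 1%nat 0%nat t y).
Let qx (t y : R) : R := U 0%nat 1%nat t y / sqrt (1 + U 1%nat 0%nat t y ^ 2).

(** Density on the [i]-th face of the time derivative of the energy, after the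
    corner terms have been converted into an integral by means of [bdry]. *)
Let rate (i : nat) (t y : R) : R :=
  ft i t y + (U 1%nat 1%nat t y * (sgl i t y - q t y)
              + (U 0%nat 1%nat t y - v i t) * (fs i t - qx t y)).

(** Its values at the two ends of the faces cancel the terms produced by the
    motion of the corners. *)
Let bdry (i : nat) (t y : R) : R := (U 0%nat 1%nat t y - v i t) * (sgl i t y - q t y).

Let sqrt_pos t y : 0 < sqrt (1 + U 1%nat 0%nat t y ^ 2).
Proof. apply sqrt_lt_R0. nra. Qed.

Let cont2_q : cont2 q.
Proof. apply (cont2_app (Derive W)). now apply W1_continuous. apply sol_cont'; lia. Qed.

Let cont2_qx : cont2 qx.
Proof.
intros z. apply continuous_ext with (fun z : R * R => Derive_n W 2 (U 1%nat 0%nat (fst z) (snd z))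
  * U 2%nat 0%nat (fst z) (snd z)).
{ intros w. symmetry. apply (sol_pde _ _ _ _ _ HU). }
apply (cont2_mult (fun t y => Derive_n W 2 (U 1%nat 0%nat t y)) (U 2%nat 0%nat)).
apply (cont2_app (Derive_n W 2)). now apply W2_continuous. apply sol_cont'; lia.
apply sol_cont'; lia.
Qed.

Let sgl_continuous i t y : continuous (sgl i t) y.
Proof.
unfold sgl. apply (continuous_plus (V := R_NormedModule)). apply continuous_const.
apply (continuous_mult (K := R_AbsRing)). apply continuous_const.
apply (continuous_minus (V := R_NormedModule)). apply continuous_id. apply continuous_const.
Qed.

Let bdry_continuous i t y : continuous (bdry i t) y.
Proof.
unfold bdry. apply (continuous_mult (K := R_AbsRing)).
- apply (continuous_minus (V := R_NormedModule)). apply cont2_slice, sol_cont'; lia.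
  apply continuous_const.
- apply (continuous_minus (V := R_NormedModule)). apply sgl_continuous.
  now apply cont2_slice.
Qed.

Let dbdry_continuous i t y : continuous (fun y => U 1%nat 1%nat t y * (sgl i t y - q t y)
   + (U 0%nat 1%nat t y - v i t) * (fs i t - qx t y)) y.
Proof.
apply (continuous_plus (V := R_NormedModule)); apply (continuous_mult (K := R_AbsRing)).
- apply cont2_slice, sol_cont'; lia.
- apply (continuous_minus (V := R_NormedModule)). apply sgl_continuous. now apply cont2_slice.
- apply (continuous_minus (V := R_NormedModule)). apply cont2_slice, sol_cont'; lia.
  apply continuous_const.
- apply (continuous_minus (V := R_NormedModule)). apply continuous_const. now apply cont2_slice.
Qed.

Let bdry_derive i t y : 0 < y < 1 ->
  is_derive (bdry i t) y (U 1%nat 1%nat t y * (sgl i t y - q t y)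
   + (U 0%nat 1%nat t y - v i t) * (fs i t - qx t y)).
Proof.
intros Hy. unfold bdry. evar_last.
- apply (is_derive_mult (fun y => U 0%nat 1%nat t y - v i t) (fun y => sgl i t y - q t y)).
  + apply (is_derive_minus (V := R_NormedModule)).
    apply (sol_dy _ _ _ _ _ HU 0 1); auto. apply (is_derive_const (V := R_NormedModule)).
  + apply (is_derive_minus (V := R_NormedModule)).
    * unfold sgl. apply (is_derive_plus (V := R_NormedModule)).
      apply (is_derive_const (V := R_NormedModule)).
      apply (is_derive_scal (fun y => y - x (i - 1)%nat t)).
      apply (is_derive_minus (V := R_NormedModule)).
      apply (is_derive_id (K := R_AbsRing)). apply (is_derive_const (V := R_NormedModule)).
    * apply (is_derive_comp (Derive W) (U 1%nat 0%nat t)). apply (W_derive2 W W_C3).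
      apply (sol_dy _ _ _ _ _ HU 1 0); auto.
  + intros; apply Rmult_comm.
- unfold qx. rewrite (sol_pde _ _ _ _ _ HU).
  unfold plus, minus, opp, mult, scal, zero, one, plus, opp; simpl.
  unfold mult; simpl. ring.
Qed.

Let sgl_right i t : (1 <= i <= N)%nat -> s <= t < e -> sgl i t (x i t) = sg i.
Proof.
intros Hi Ht. assert (L := length_pos i t Hi Ht). unfold sgl, fs. field. lra.
Qed.

Let sgl_left i t : sgl i t (x (i - 1)%nat t) = sg (i - 1).
Proof. unfold sgl. ring. Qed.

(** Terms produced at a corner by the two adjacent faces cancel. *)
Let corner_cancel i t : (1 <= i < N)%nat -> s < t < e ->
  f (i + 1) t (x i t) * xd i t - bdry (i + 1) t (x i t) =
  f i t (x i t) * xd i t - bdry i t (x i t).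
Proof.
intros Hi Ht.
assert (E1 := Um_face i t (x i t) ltac:(lia) ltac:(lra)).
assert (L1 := length_pos i t ltac:(lia) ltac:(lra)).
assert (E2 := Um_face (i + 1) t (x i t) ltac:(lia) ltac:(lra)).
assert (L2 := length_pos (i + 1) t ltac:(lia) ltac:(lra)).
assert (SL := sgl_left (i + 1) t).
replace (i + 1 - 1)%nat with i in E2, L2, SL by lia.
unfold bdry. rewrite SL, sgl_right by (try lia; lra).
unfold f. rewrite <- E1, <- E2 by lra.
unfold xd, sg. rewrite flux_interior by lia.
destruct (Nat.eqb_spec i 0); [lia|]. destruct (Nat.eqb_spec i N); [lia|].
destruct (slope_steps Sl a b m P N p Hgood (phase_boundary _ _ _ _ _ _ _ _ Hphase)
  Ha Hb i ltac:(lia)) as [Hne _].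
unfold divdiff, q. field. lra.
Qed.

(** The boundary terms telescope: they cancel at the corners and vanish at the
    two ends, where the corners are at rest and the two fluxes agree. *)
Let energy_derive t : s < t < e ->
  is_derive (fun r => energy W U Um eps r N p (fun i => xs i r)) t
    (fsum (fun i => RInt (rate i t) (x (i - 1)%nat t) (x i t)) N).
Proof.
intros Ht.
apply is_derive_ext_loc with
  (fun r => fsum (fun i => RInt (f i r) (xs (i - 1) r) (xs i r)) N).
{ generalize (near_phase t Ht). apply filter_imp. intros r Hr.
  unfold energy. apply fsum_ext. intros i Hi. rewrite !xs_id by lra.
  assert (L := length_pos i r Hi ltac:(lra)).
  apply RInt_ext. rewrite Rmin_left, Rmax_right by lra. intros y Hy.
  symmetry. apply density_f; auto; lra. }
evar_last.
apply (is_derive_fsum (fun i r => RInt (f i r) (xs (i - 1) r) (xs i r))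
  (fun i t => RInt (ft i t) (xs (i - 1) t) (xs i t) +
     f i t (xs i t) * xd i t - f i t (xs (i - 1) t) * xd (i - 1) t)).
{ intros i Hi. apply (is_derive_RInt_moving (f i) (ft i) (xs (i - 1)) (xs i) s e); auto.
  - intros r y Hr. apply cont2_pt. apply cont2_f; lia.
  - intros r y Hr. apply continuity_2d_pt_filterlim. apply (ft_continuous i r y); auto.
  - apply xs_derive; auto; lia.
  - apply xs_derive; auto; lia. }
simpl.
assert (E : forall i, (1 <= i <= N)%nat ->
  RInt (ft i t) (xs (i - 1) t) (xs i t) + f i t (xs i t) * xd i t -
    f i t (xs (i - 1) t) * xd (i - 1) t =
  RInt (rate i t) (x (i - 1)%nat t) (x i t) +
   ((f i t (x i t) * xd i t - bdry i t (x i t)) -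
    (f i t (x (i - 1)%nat t) * xd (i - 1) t - bdry i t (x (i - 1)%nat t)))).
{ intros i Hi. rewrite !xs_id by lra.
  assert (L := length_pos i t Hi ltac:(lra)).
  assert (R1 := x_range (i - 1) t ltac:(lra) ltac:(lia)).
  assert (R2 := x_range i t ltac:(lra) ltac:(lia)).
  unfold rate.
  rewrite (RInt_plus (V := R_CompleteNormedModule) (ft i t)).
  rewrite (RInt_derive_interior (bdry i t)
    (fun y => U 1%nat 1%nat t y * (sgl i t y - q t y)
       + (U 0%nat 1%nat t y - v i t) * (fs i t - qx t y))); auto.
  unfold plus; simpl. ring.
  lra. intros y Hy. apply bdry_derive. lra.
  - apply (ex_RInt_continuous (V := R_CompleteNormedModule)). intros y _.
    apply (continuous_comp_2 (fun _ => t) (fun y : R => y) (ft i)).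
    apply continuous_const. apply continuous_id. now apply ft_continuous.
  - apply (ex_RInt_continuous (V := R_CompleteNormedModule)). intros y _.
    apply dbdry_continuous. }
rewrite (fsum_ext _ _ _ E), fsum_plus.
rewrite (fsum_telescope_ends (fun i => f i t (x i t) * xd i t - bdry i t (x i t))
  (fun i => f i t (x (i - 1)%nat t) * xd (i - 1) t - bdry i t (x (i - 1)%nat t))).
- assert (HN : (1 <= N)%nat) by apply Hgood.
  destruct (Hclosed t ltac:(lra)) as (X0 & XN & _).
  assert (EN : bdry N t (x N t) = 0).
  { unfold bdry. rewrite sgl_right by (try lia; lra). unfold sg, q.
    rewrite (flux_N W Sl a b m P N p Hgood). simpl in XN. rewrite XN.
    rewrite (sol_right _ _ _ _ _ HU). ring. }
  assert (E1 : bdry 1 t (x (1 - 1)%nat t) = 0).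
  { unfold bdry. rewrite sgl_left. unfold sg, q. simpl. rewrite flux_0.
    simpl in X0. rewrite X0, (sol_left _ _ _ _ _ HU). ring. }
  rewrite EN, E1. unfold xd. simpl. rewrite Nat.eqb_refl.
  destruct (N =? 0)%nat; ring.
- apply Hgood.
- intros i Hi. replace (i + 1 - 1)%nat with i by lia. now apply corner_cancel.
Qed.

(** Growth rate of the relative energy.  The constant [(1 + K) * (La / la)] is
    that of the relative error of the velocities of the boundary faces. *)
Definition growth : R :=
  (B * La + 5 * B ^ 2) / la + (B * La + 5 * ((1 + K) * (La / la)) ^ 2 * B ^ 2) + 1.

Let rate_le i t y : (1 <= i <= N)%nat -> s < t < e ->
  x (i - 1)%nat t < y < x i t -> rate i t y <= growth * f i t y + growth * m.
Proof.
intros Hi Ht Hy.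
assert (Hbd := phase_boundary _ _ _ _ _ _ _ _ Hphase).
assert (HTb' := HTb). destruct HTb' as (Pl & PL & Htay).
assert (Hpi : Rabs (p i) <= K).
{ apply (slope_range K Sl a b m P N p); auto; try lia; apply m_range. }
destruct (Htay _ _ Hpi (U10_bound t y)) as ([T1 _] & T2 & _).
set (ux := U 1%nat 0%nat t y) in *. set (ee := p i - ux) in *.
set (z := h i t + p i * y - U 0%nat 0%nat t y).
assert (PB : 0 <= B) by (eapply Rle_trans; [apply Rabs_pos|apply (U11_bound t y)]).
assert (Pk : 0 <= (1 + K) * (La / la)).
{ apply Rmult_le_pos. lra. apply Rdiv_le_0_compat; lra. }
assert (Hflux := flux_close W K la La HTb Sl a b m P N p Hgood Hbd
  (proj1 m_range) PK aP bP Ha Hb i Hi).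
assert (L := length_pos i t Hi ltac:(lra)).
assert (Hvel := velocity_flux W K la La HTb Sl a b m P N p Hgood Hbd
  (proj1 m_range) PK aP bP Ha Hb (fun j => x j t) i Hi L). simpl in Hvel.
assert (Hsg : Rabs (sgl i t y - q t y - Derive_n W 2 ux * ee) <= La * (m + ee ^ 2)).
{ replace (sgl i t y - q t y - Derive_n W 2 ux * ee) with
    ((sgl i t y - Derive W (p i)) + (Derive W (p i) - Derive W ux - Derive_n W 2 ux * ee))
    by (unfold q, ux; ring).
  eapply Rle_trans. apply Rabs_triang. rewrite Rmult_plus_distr_l.
  apply Rplus_le_compat; [|exact T2].
  (* on the face the flux is a convex combination of its values at the ends *)
  set (th := (y - x (i - 1)%nat t) / (x i t - x (i - 1)%nat t)).
  assert (Hth : 0 <= th <= 1).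
  { unfold th. split. apply Rdiv_le_0_compat; lra. apply Rle_div_l; lra. }
  replace (sgl i t y - Derive W (p i)) with
    (th * (sg i - Derive W (p i)) + (1 - th) * (sg (i - 1) - Derive W (p i)))
    by (unfold sgl, fs, th; field; lra).
  destruct Hflux as [F1 F2]. fold (sg i) in F1. fold (sg (i - 1)) in F2.
  eapply Rle_trans. apply Rabs_triang.
  rewrite !Rabs_mult, !(Rabs_pos_eq th), !(Rabs_pos_eq (1 - th)) by lra.
  assert (th * Rabs (sg i - Derive W (p i)) <= th * (La * m)) by (apply Rmult_le_compat_l; lra).
  assert ((1 - th) * Rabs (sg (i - 1) - Derive W (p i)) <= (1 - th) * (La * m))
    by (apply Rmult_le_compat_l; lra).
  lra. }
assert (M := rate_pointwise_bound B La (1 + K) ((1 + K) * (La / la)) m eps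
  (sqrt (1 + p i ^ 2)) (sqrt (1 + ux ^ 2)) (qx t y) (U 0%nat 1%nat t y) (U 1%nat 1%nat t y)
  (Derive_n W 2 ux) ee z (v i t) (fs i t) (sgl i t y) (q t y)
  (Rlt_le _ _ PL) Pk m_range m_small eps_range eps_small
  (sqrt_1_sq_bounds _ _ Hpi) (sqrt_1_sq_lipschitz _ _) (qx_bound t y)).
assert (Hut : U 0%nat 1%nat t y = sqrt (1 + ux ^ 2) * qx t y).
{ unfold qx. fold ux. field. apply Rgt_not_eq. apply (sqrt_pos t y). }
specialize (M Hut (U11_bound t y) Hsg Hvel).
unfold rate, ft. fold ux ee z.
eapply Rle_trans. exact M.
unfold f. fold ux ee z. unfold growth.
set (c1 := B * La + 5 * B ^ 2). set (c2 := B * La + 5 * ((1 + K) * (La / la)) ^ 2 * B ^ 2).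
set (g := W (p i) - W ux - Derive W ux * ee) in *.
assert (P1 : 0 <= c1).
{ unfold c1. assert (0 <= B * La) by (apply Rmult_le_pos; lra). generalize (pow2_ge_0 B). lra. }
assert (P2 : 0 <= c2).
{ unfold c2. assert (0 <= B * La) by (apply Rmult_le_pos; lra).
  assert (0 <= ((1 + K) * (La / la)) ^ 2 * B ^ 2) by (apply Rmult_le_pos; apply pow2_ge_0). lra. }
assert (P3 : 0 <= c1 / la) by (apply Rdiv_le_0_compat; lra).
assert (Pe2 := pow2_ge_0 ee). assert (Pz2 := pow2_ge_0 z).
assert (A1 : c1 * ee ^ 2 <= c1 / la * g).
{ replace (c1 * ee ^ 2) with (c1 / la * (la * ee ^ 2)) by (field; lra).
  apply Rmult_le_compat_l; lra. }
assert (Pg : 0 <= g).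
{ assert (0 <= la * ee ^ 2) by (apply Rmult_le_pos; lra). lra. }
assert (Pez : 0 <= eps * z ^ 2) by (apply Rmult_le_pos; lra).
assert (0 <= c1 / la * (eps * z ^ 2)) by (apply Rmult_le_pos; lra).
assert (0 <= c2 * (eps * z ^ 2)) by (apply Rmult_le_pos; lra).
assert (0 <= c2 * g) by (apply Rmult_le_pos; lra).
assert (0 <= c1 / la * m) by (apply Rmult_le_pos; lra).
lra.
Qed.

Let energy_rate_le t : s < t < e ->
  fsum (fun i => RInt (rate i t) (x (i - 1)%nat t) (x i t)) N <=
  growth * energy W U Um eps t N p (fun i => xs i t) + growth * m.
Proof.
intros Ht.
destruct (Hclosed t ltac:(lra)) as (X0 & XN & _). simpl in X0, XN.
apply Rle_trans with (fsum (fun i =>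
  growth * RInt (density W U Um eps t (p i)) (xs (i - 1) t) (xs i t)
  + growth * m * (x i t - x (i - 1)%nat t)) N).
- apply fsum_le. intros i Hi. rewrite !xs_id by lra.
  assert (L := length_pos i t Hi ltac:(lra)).
  rewrite (RInt_ext (density W U Um eps t (p i)) (f i t)).
  2:{ rewrite Rmin_left, Rmax_right by lra. intros y Hy. apply density_f; auto; lra. }
  assert (Exf : ex_RInt (f i t) (x (i - 1)%nat t) (x i t)).
  { apply cont2_ex_RInt, cont2_f; lia. }
  apply Rle_trans with (RInt (fun y => growth * f i t y + growth * m) (x (i - 1)%nat t) (x i t)).
  + apply RInt_le. lra.
    * apply (ex_RInt_plus (V := R_NormedModule)).
      apply (ex_RInt_continuous (V := R_CompleteNormedModule)). intros y _.
      apply (continuous_comp_2 (fun _ => t) (fun y : R => y) (ft i)).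
      apply continuous_const. apply continuous_id. now apply ft_continuous.
      apply (ex_RInt_continuous (V := R_CompleteNormedModule)). intros y _.
      apply dbdry_continuous.
    * apply (ex_RInt_plus (V := R_NormedModule)).
      now apply (ex_RInt_scal (V := R_NormedModule)). apply ex_RInt_const.
    * intros y Hy. now apply rate_le.
  + right.
    rewrite (RInt_plus (V := R_CompleteNormedModule) (fun y => growth * f i t y)).
    2: now apply (ex_RInt_scal (V := R_NormedModule)). 2: apply ex_RInt_const.
    rewrite (RInt_scal (V := R_CompleteNormedModule)) by exact Exf.
    rewrite (RInt_const (V := R_CompleteNormedModule)).
    unfold plus, scal; simpl. unfold mult; simpl. ring.
- right. rewrite fsum_plus, !fsum_scal, (fsum_telescope (fun i => x i t)), X0, XN.
  unfold energy. ring.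
Qed.

(** Exponential bound for the relative energy during a phase, its final time
    included. *)
Lemma phase_energy_bound t : s <= t <= e ->
  energy W U (extend T um) eps t N p (fun i => x i t) + m <=
  (energy W U (extend T um) eps s N p (fun i => x i s) + m) * exp (growth * (t - s)).
Proof.
intros Ht.
assert (E : forall r, s <= r <= e ->
  energy W U (extend T um) eps r N p (fun i => x i r) =
  energy W U Um eps r N p (fun i => xs i r)).
{ intros r Hr. unfold energy. apply fsum_ext. intros i Hi. now rewrite !xs_id. }
rewrite !E by lra.
apply (gronwall (fun r => energy W U Um eps r N p (fun i => xs i r))
  (fun t => fsum (fun i => RInt (rate i t) (x (i - 1)%nat t) (x i t)) N)).
- lra.
- intros r Hr. apply energy_derive. lra.
- intros r Hr. apply energy_rate_le. lra.
- intros r. unfold energy.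
  apply (continuous_fsum (fun i r => RInt (density W U Um eps r (p i)) (xs (i - 1) r) (xs i r))).
  intros i Hi. apply (continuous_RInt_bounds_param (fun r y => density W U Um eps r (p i) y)).
  apply cont2_density; auto.
  intros r'; apply xs_continuous; lia. intros r'; apply xs_continuous; lia.
Qed.

End Energy_estimate.

(** * The energy and the H1 norm *)

Lemma energy_ext W U w eps t N p X X' :
  (forall i, (i <= N)%nat -> X i = X' i) ->
  energy W U w eps t N p X = energy W U w eps t N p X'.
Proof.
intros H. unfold energy. apply fsum_ext. intros i Hi. now rewrite !H by lia.
Qed.

(** The energy depends only on the graph: removing vanished faces and merging
    faces of equal slope does not change it. *)
Lemma energy_after_event W U w eps t N p X N' p' X' f :
  C3 W -> (forall i j, (i + j <= 3)%nat -> cont2 (U i j)) -> cont2 w ->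
  closed_config N p X f -> X' 0%nat = 0 ->
  faces N' p' X' = merge_faces (remove_vanished (faces N p X)) ->
  energy W U w eps t N' p' X' = energy W U w eps t N p X.
Proof.
intros HW HU Hw (X0 & _ & Hcl) X0' Hf. unfold energy.
rewrite <- !faces_integral_faces with (phi := density W U w eps t).
rewrite X0, X0', Hf, faces_integral_merge.
2:{ intros q y. apply (cont2_slice (fun t y => density W U w eps t q y)).
    now apply cont2_density. }
apply faces_integral_remove.
unfold faces. apply List.Forall_map, List.Forall_forall. intros i Hi.
apply in_seq in Hi. simpl. destruct (Hcl i ltac:(lia)) as [H _]. lra.
Qed.

Lemma RInt_piecewise (f : R -> R) (g : nat -> R -> R) (X : nat -> R) N :
  (forall i, (1 <= i <= N)%nat -> X (i - 1)%nat <= X i) ->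
  (forall i y, (1 <= i <= N)%nat -> continuous (g i) y) ->
  (forall i y, (1 <= i <= N)%nat -> X (i - 1)%nat < y < X i -> f y = g i y) ->
  RInt f (X 0%nat) (X N) = fsum (fun i => RInt (g i) (X (i - 1)%nat) (X i)) N.
Proof.
intros HX Hg Hfg.
assert (E : forall i, (1 <= i <= N)%nat -> forall y,
  Rmin (X (i - 1)%nat) (X i) < y < Rmax (X (i - 1)%nat) (X i) -> f y = g i y).
{ intros i Hi y Hy. specialize (HX i Hi). rewrite Rmin_left, Rmax_right in Hy by lra. auto. }
apply is_RInt_unique.
rewrite (fsum_ext _ (fun i => RInt f (X (i - 1)%nat) (X i))).
2:{ intros i Hi. apply RInt_ext. intros y Hy. symmetry. now apply E. }
apply fsum_RInt_Chasles. intros i Hi.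
apply (ex_RInt_ext (g i)). intros y Hy. symmetry. now apply E.
apply (ex_RInt_continuous (V := R_CompleteNormedModule)). intros; now apply Hg.
Qed.

Lemma is_derive_face f X0 X1 p y :
  (forall y, X0 <= y <= X1 -> f y = f X0 + p * (y - X0)) -> X0 < y < X1 ->
  is_derive f y p.
Proof.
intros H Hy. apply is_derive_ext_loc with (fun y => f X0 + p * (y - X0)).
{ apply (locally_interval _ y X0 X1); try apply Hy.
  intros z H1 H2; simpl in H1, H2. symmetry. apply H. lra. }
auto_derive; auto; ring.
Qed.

Section Norms.

Variables (W : R -> R) (W_C3 : C3 W) (a b T : R) (u0 : R -> R) (u : R -> R -> R)
  (D : nat -> nat -> R -> R -> R) (Hsol : neumann_solution W a b T u0 u D)
  (T_pos : 0 <= T).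

Let U (i j : nat) : R -> R -> R := extend T (D i j).

Let HU : extended_solution W a b T U.
Proof. now apply neumann_solution_extend with u0 u. Qed.

Variables (K la La eps : R) (HTb : taylor_bounds W K la La) (eps_pos : 0 < eps)
  (U10_bound : forall t y, Rabs (U 1%nat 0%nat t y) <= K)
  (um : R -> R -> R)
  (um_continuous : continuous_on (rect T) (fun z : R * R => um (fst z) (snd z))).

Let U00_u t y : 0 <= t <= T -> 0 <= y <= 1 -> U 0%nat 0%nat t y = u y t.
Proof.
intros Ht Hy. unfold U. rewrite extend_id by lra. apply Hsol. now split.
Qed.

Let u_derive t y : 0 <= t <= T -> 0 < y < 1 -> is_derive (fun y => u y t) y (U 1%nat 0%nat t y).
Proof.
intros Ht Hy. apply is_derive_ext_loc with (U 0%nat 0%nat t).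
{ apply (locally_interval _ y 0 1); try apply Hy.
  intros z H1 H2; simpl in H1, H2. apply U00_u; lra. }
apply (sol_dy _ _ _ _ _ HU 0 0); auto.
Qed.

(** The energy controls the square of the H1 distance. *)
Lemma H1_norm_energy t N p X :
  0 <= t <= T -> closed_config N p X (fun y => um y t) ->
  (forall i, (1 <= i <= N)%nat -> Rabs (p i) <= K) ->
  H1_norm (fun y => u y t - um y t) <=
  sqrt ((/ la + / eps) * energy W U (extend T um) eps t N p X).
Proof.
intros Ht Hcc Hp.
assert (Hrange := fun i => closed_config_range N p X _ i Hcc).
destruct Hcc as (X0 & XN & Hcl).
destruct HTb as (Pl & PL & Htay).
assert (CUm : cont2 (extend T um)) by now apply cont2_extend.
assert (CU : forall i j, (i + j <= 3)%nat -> cont2 (U i j)) by apply (sol_cont _ _ _ _ _ HU).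
set (g1 := fun (i : nat) y => (extend T um t y - U 0%nat 0%nat t y) ^ 2).
set (g2 := fun i y => (U 1%nat 0%nat t y - p i) ^ 2).
assert (C1 : forall i y, continuous (g1 i) y).
{ intros i y. apply (cont2_slice (fun t y => (extend T um t y - U 0%nat 0%nat t y) ^ 2)).
  apply cont2_pow, cont2_minus; auto. }
assert (C2 : forall i y, continuous (g2 i) y).
{ intros i y. apply (cont2_slice (fun t y => (U 1%nat 0%nat t y - p i) ^ 2)).
  apply cont2_pow, cont2_minus; auto. apply cont2_const. }
unfold H1_norm. apply sqrt_le_1_alt.
rewrite <- X0, <- XN.
rewrite (RInt_piecewise _ g1 X N), (RInt_piecewise _ g2 X N); auto.
- rewrite <- fsum_plus. unfold energy. rewrite <- fsum_scal.
  apply fsum_le. intros i Hi. destruct (Hcl i Hi) as [Hle _].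
  assert (Exd : ex_RInt (density W U (extend T um) eps t (p i)) (X (i - 1)%nat) (X i)).
  { apply (cont2_ex_RInt (fun t y => density W U (extend T um) eps t (p i) y)).
    now apply cont2_density. }
  assert (Ex1 : ex_RInt (g1 i) (X (i - 1)%nat) (X i)).
  { apply (ex_RInt_continuous (V := R_CompleteNormedModule)); auto. }
  assert (Ex2 : ex_RInt (g2 i) (X (i - 1)%nat) (X i)).
  { apply (ex_RInt_continuous (V := R_CompleteNormedModule)); auto. }
  change (RInt (g1 i) (X (i - 1)%nat) (X i) + RInt (g2 i) (X (i - 1)%nat) (X i)) with
    (plus (RInt (g1 i) (X (i - 1)%nat) (X i)) (RInt (g2 i) (X (i - 1)%nat) (X i))).
  rewrite <- (RInt_plus (V := R_CompleteNormedModule)); auto.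
  change ((/ la + / eps) * RInt (density W U (extend T um) eps t (p i)) (X (i - 1)%nat) (X i))
    with (scal (/ la + / eps) (RInt (density W U (extend T um) eps t (p i)) (X (i - 1)%nat) (X i))).
  rewrite <- (RInt_scal (V := R_CompleteNormedModule)) by exact Exd.
  apply RInt_le; auto.
  + now apply (ex_RInt_plus (V := R_NormedModule)).
  + now apply (ex_RInt_scal (V := R_NormedModule)).
  + intros y _. unfold plus, scal; simpl. unfold mult; simpl.
    unfold g1, g2, density.
    destruct (Htay _ _ (Hp i Hi) (U10_bound t y)) as ([H1 _] & _).
    set (ux := U 1%nat 0%nat t y) in *. set (z := extend T um t y - U 0%nat 0%nat t y).
    set (w := W (p i) - W ux - Derive W ux * (p i - ux)) in *.
    assert (Pi1 := Rinv_0_lt_compat _ Pl). assert (Pi2 := Rinv_0_lt_compat _ eps_pos).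
    assert (Pe := pow2_ge_0 (p i - ux)). assert (Pz := pow2_ge_0 z).
    assert (Pw : 0 <= w). { assert (0 <= la * (p i - ux) ^ 2) by (apply Rmult_le_pos; lra). lra. }
    assert (Pez : 0 <= eps * z ^ 2) by (apply Rmult_le_pos; lra).
    assert (A1 : (p i - ux) ^ 2 <= / la * w).
    { replace ((p i - ux) ^ 2) with (/ la * (la * (p i - ux) ^ 2)) by (field; lra).
      apply Rmult_le_compat_l; lra. }
    assert (A2 : z ^ 2 = / eps * (eps * z ^ 2)) by (field; lra).
    replace (ux - p i) with (- (p i - ux)) by ring.
    replace ((- (p i - ux)) ^ 2) with ((p i - ux) ^ 2) by ring.
    assert (0 <= / la * (eps * z ^ 2)) by (apply Rmult_le_pos; lra).
    assert (0 <= / eps * w) by (apply Rmult_le_pos; lra).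
    change (z * (z * 1)) with (z ^ 2). change ((p i - ux) * ((p i - ux) * 1)) with ((p i - ux) ^ 2).
    lra.
- intros i Hi. now apply Hcl.
- intros i y Hi Hy. unfold g2.
  assert (R1 := Hrange (i - 1)%nat ltac:(lia)). assert (R2 := Hrange i ltac:(lia)).
  f_equal. apply is_derive_unique. apply (is_derive_minus (V := R_NormedModule)).
  apply u_derive; lra.
  apply (is_derive_face (fun y => um y t) (X (i - 1)%nat) (X i)); auto. apply (Hcl i Hi).
- intros i Hi. now apply Hcl.
- intros i y Hi Hy. unfold g1.
  assert (R1 := Hrange (i - 1)%nat ltac:(lia)). assert (R2 := Hrange i ltac:(lia)).
  rewrite U00_u by lra. rewrite (extend_id T um) by lra. ring.
Qed.

(** The essential bound on the slope error holds at every point of the open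
    faces, so the part of the energy due to the slopes is of order [m^2]; the
    part due to the values is bounded by the L2 hypothesis. *)
Lemma initial_energy_bound S c m N p X u0m :
  0 <= c -> 0 <= m <= 1 -> eps <= 1 ->
  admissible S N p X u0m ->
  (forall y, 0 <= y <= 1 -> um y 0 = u0m y) ->
  (forall i, (1 <= i <= N)%nat -> Rabs (p i) <= K) ->
  Linf_norm_le (fun x => Derive u0m x - Derive u0 x) m ->
  L2_norm (fun x => u0m x - u0 x) <= c * sqrt m ->
  energy W U (extend T um) eps 0 N p X <= (La + c ^ 2) * m.
Proof.
intros Hc Hm Heps (HN & X0 & XN & Hadm) Hum Hp HLinf HL2.
destruct HTb as (Pl & PL & Htay).
assert (Hcc : closed_config N p X u0m).
{ split; auto. split; auto. intros i Hi. destruct (Hadm i Hi) as (H1 & _ & H2).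
  split; auto. lra. }
assert (Hrange := fun i => closed_config_range N p X _ i Hcc).
assert (CUm : cont2 (extend T um)) by now apply cont2_extend.
assert (CU : forall i j, (i + j <= 3)%nat -> cont2 (U i j)) by apply (sol_cont _ _ _ _ _ HU).
assert (Hu0 : forall y, 0 <= y <= 1 -> u y 0 = u0 y) by apply Hsol.
set (z2 := fun y => (extend T um 0 y - U 0%nat 0%nat 0 y) ^ 2).
assert (Cz : forall y, continuous z2 y).
{ intros y. apply (cont2_slice (fun t y => (extend T um t y - U 0%nat 0%nat t y) ^ 2)).
  apply cont2_pow, cont2_minus; auto. }
assert (Hz : RInt z2 0 1 <= c ^ 2 * m).
{ unfold L2_norm in HL2.
  rewrite (RInt_ext (fun x => (u0m x - u0 x) ^ 2) z2) in HL2.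
  2:{ rewrite Rmin_left, Rmax_right by lra. intros y Hy. unfold z2.
      rewrite U00_u, extend_id, Hum, Hu0 by lra. reflexivity. }
  destruct (Rle_lt_dec (RInt z2 0 1) 0) as [Hneg|Hpos].
  { apply Rle_trans with (1 := Hneg). apply Rmult_le_pos. apply pow2_ge_0. lra. }
  rewrite <- (pow2_sqrt (RInt z2 0 1)) by lra.
  replace (c ^ 2 * m) with ((c * sqrt m) ^ 2).
  apply pow_incr. split; auto. apply sqrt_pos.
  rewrite Rpow_mult_distr, pow2_sqrt by lra. reflexivity. }
assert (Hslope : forall i y, (1 <= i <= N)%nat -> X (i - 1)%nat < y < X i ->
  Rabs (p i - U 1%nat 0%nat 0 y) <= m).
{ intros i y Hi Hy.
  assert (R1 := Hrange (i - 1)%nat ltac:(lia)). assert (R2 := Hrange i ltac:(lia)).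
  apply (Linf_bound_pointwise (fun x => Derive u0m x - Derive u0 x)
    (fun y => p i - U 1%nat 0%nat 0 y) m (X (i - 1)%nat) (X i) y); auto; try lra.
  - intros z Hz'. f_equal.
    + apply is_derive_unique. apply (is_derive_face u0m (X (i - 1)%nat) (X i)); auto.
      apply (Hadm i Hi).
    + apply is_derive_unique. apply is_derive_ext_loc with (fun y => u y 0).
      { apply (locally_interval _ z 0 1); simpl; try lra. intros; apply Hu0; simpl in *; lra. }
      apply u_derive; lra.
  - apply (continuous_minus (V := R_NormedModule)). apply continuous_const.
    apply cont2_slice. auto. }
replace ((La + c ^ 2) * m) with (La * m + c ^ 2 * m) by ring.
apply Rle_trans with (fsum (fun i => La * m * (X i - X (i - 1)%nat)
  + eps * RInt z2 (X (i - 1)%nat) (X i)) N).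
- apply fsum_le. intros i Hi. destruct (Hadm i Hi) as (Hlt & _).
  assert (Exz : ex_RInt z2 (X (i - 1)%nat) (X i)).
  { apply (ex_RInt_continuous (V := R_CompleteNormedModule)); auto. }
  apply Rle_trans with (RInt (fun y => La * m + eps * z2 y) (X (i - 1)%nat) (X i)).
  + apply RInt_le. lra.
    * apply (cont2_ex_RInt (fun t y => density W U (extend T um) eps t (p i) y)).
      now apply cont2_density.
    * apply (ex_RInt_plus (V := R_NormedModule)). apply ex_RInt_const.
      now apply (ex_RInt_scal (V := R_NormedModule)).
    * intros y Hy. unfold density. fold (z2 y). apply Rplus_le_compat_r.
      destruct (Htay _ _ (Hp i Hi) (U10_bound 0 y)) as ([_ H1] & _).
      apply Rle_trans with (1 := H1). apply Rmult_le_compat_l. lra.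
      rewrite <- pow2_abs. assert (G := Hslope i y Hi Hy).
      assert (P0 := Rabs_pos (p i - U 1%nat 0%nat 0 y)). nra.
  + right.
    rewrite (RInt_plus (V := R_CompleteNormedModule) (fun _ => La * m)).
    2: apply ex_RInt_const. 2: now apply (ex_RInt_scal (V := R_NormedModule)).
    rewrite (RInt_scal (V := R_CompleteNormedModule) z2) by exact Exz.
    rewrite (RInt_const (V := R_CompleteNormedModule)).
    unfold plus, scal; simpl. unfold mult; simpl. ring.
- rewrite fsum_plus, !fsum_scal, (fsum_telescope X), X0, XN.
  rewrite <- (RInt_piecewise z2 (fun _ => z2) X N); auto.
  2: intros i Hi; destruct (Hadm i Hi); lra.
  rewrite X0, XN.
  assert (P0 : 0 <= RInt z2 0 1).
  { apply RInt_ge_0. lra. apply (ex_RInt_continuous (V := R_CompleteNormedModule)); auto.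
    intros y _. apply pow2_ge_0. }
  assert (eps * RInt z2 0 1 <= 1 * RInt z2 0 1) by (apply Rmult_le_compat_r; lra).
  lra.
Qed.

End Norms.

Lemma evolves_start W S um T s N p X :
  evolves W S um T s N p X -> s < T /\ X 0%nat = 0.
Proof.
intros H. destruct H as [s N p X x Hs HX Hph|s e N p X x N' p' X' Hs HX Hph _ _ _].
- split; auto. rewrite <- HX by lia.
  apply (phase_admissible _ _ _ _ _ _ _ _ Hph s). lra.
- split. lra. rewrite <- HX by lia.
  apply (phase_admissible _ _ _ _ _ _ _ _ Hph s). lra.
Qed.

(** A slope adjacent to [a] is one of the two that surround it. *)
Lemma adjacent_gap S a r q q' m :
  adjacent S a q -> adjacent S a q' -> strictly_between q a q' ->
  Rabs (q - a) <= m -> Rabs (q' - a) <= m ->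
  adjacent S a r -> Rabs (r - a) <= m.
Proof.
intros Hq Hq' Hb Hm Hm' Hr.
destruct (Req_dec r q) as [->|Hne]; auto.
assert (Hsb := adjacent_dichotomy S r a q (adjacent_sym _ _ _ Hr) Hq Hne).
rewrite (adjacent_same_side S r a q' q); auto.
unfold strictly_between in *; lra.
Qed.

(** * The whole evolution *)

(** The bounds of the successive phases multiply, as the energy is unchanged by
    the events. *)
Lemma evolution_bound (W : R -> R) (a b T : R) (u0 : R -> R) (u : R -> R -> R)
  (D : nat -> nat -> R -> R -> R) (K la La B eps m P : R) (S : R -> Prop)
  (um : R -> R -> R) :
  let U := fun i j => extend T (D i j) in
  C3 W -> strictly_convex W -> 0 < T ->
  neumann_solution W a b T u0 u D -> taylor_bounds W K la La ->
  (forall t y, Rabs (U 1%nat 0%nat t y) <= K) ->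
  (forall t y, Rabs (U 1%nat 1%nat t y) <= B) ->
  (forall t y, Rabs (U 0%nat 1%nat t y / sqrt (1 + U 1%nat 0%nat t y ^ 2)) <= B) ->
  0 <= K -> 0 <= m <= 1 -> (1 + K) * (La / la) * m <= 1 / 2 ->
  0 < eps <= 1 -> eps * (3 * (1 + K + 1) ^ 2) <= 1 / 4 ->
  P + m <= K -> Rabs a <= P -> Rabs b <= P ->
  (forall q, adjacent S a q -> Rabs (q - a) <= m) ->
  (forall q, adjacent S b q -> Rabs (q - b) <= m) ->
  continuous_on (rect T) (fun z : R * R => um (fst z) (snd z)) ->
  forall s N p X, evolves W S um T s N p X -> 0 <= s ->
  good_config S a b m P N p ->
  forall t, s <= t <= T ->
    H1_norm (fun y => u y t - um y t) <=
    sqrt ((/ la + / eps) *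
      ((energy W U (extend T um) eps s N p X + m) * exp (growth K la La B * (t - s)))).
Proof.
intros U HW Hconv HT Hsol HTb H10 H11 Hqx HK Hm Hms Heps Heps2 HP Ha Hb Hga Hgb Hum.
assert (HU : extended_solution W a b T U).
{ apply neumann_solution_extend with u0 u; auto. lra. }
assert (PC : 0 <= / la + / eps).
{ assert (Pl : 0 < la) by apply HTb. assert (P1 := Rinv_0_lt_compat _ Pl).
  assert (P2 := Rinv_0_lt_compat _ (proj1 Heps)). lra. }
assert (Hrec : forall s e N p x X, 0 <= s -> s < e -> e <= T ->
  (forall i, (i <= N)%nat -> x i s = X i) -> phase W S um s e N p x ->
  good_config S a b m P N p -> forall t, s <= t <= e ->
  energy W U (extend T um) eps t N p (fun i => x i t) + m <=
  (energy W U (extend T um) eps s N p X + m) * exp (growth K la La B * (t - s))).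
{ intros s e N p x X Hs Hse HeT HX Hph Hg t Ht.
  rewrite <- (energy_ext W U (extend T um) eps s N p (fun i => x i s) X) by exact HX.
  now apply (phase_energy_bound W HW a b T U HU K la La B eps m HTb H10 H11 Hqx
    HK Hm Hms Heps Heps2 S P HP Ha Hb Hga Hgb um Hum s e N p x). }
assert (Hnorm : forall s e N p x X, 0 <= s -> s < e -> e <= T ->
  (forall i, (i <= N)%nat -> x i s = X i) -> phase W S um s e N p x ->
  good_config S a b m P N p -> forall t, s <= t <= e ->
  H1_norm (fun y => u y t - um y t) <=
    sqrt ((/ la + / eps) *
      ((energy W U (extend T um) eps s N p X + m) * exp (growth K la La B * (t - s))))).
{ intros s e N p x X Hs Hse HeT HX Hph Hg t Ht.
  apply Rle_trans with (sqrt ((/ la + / eps) *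
    energy W U (extend T um) eps t N p (fun i => x i t))).
  - apply (H1_norm_energy W HW a b T u0 u D Hsol ltac:(lra) K la La eps HTb
      (proj1 Heps) H10 um Hum t N p (fun i => x i t)). lra.
    now apply (phase_closed W S um T s e N p x).
    intros i Hi. apply (slope_range K S a b m P N p); auto; try lia.
    apply (phase_boundary _ _ _ _ _ _ _ _ Hph). apply Hm.
  - apply sqrt_le_1_alt. apply Rmult_le_compat_l; auto.
    assert (E := Hrec s e N p x X Hs Hse HeT HX Hph Hg t Ht). lra. }
intros s N p X Hev.
induction Hev as [s N p X x Hs HX Hph|s e N p X x N' p' X' Hs HX Hph _ Hf Hev IH];
  intros Hs0 Hg t Ht.
- apply (Hnorm s T N p x X); auto; lra.
- destruct (Rle_lt_dec t e) as [Hte|Hte].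
  { apply (Hnorm s e N p x X); auto; lra. }
  assert (Hg' : good_config S a b m P N' p').
  { apply (good_config_after_event W S um T s e N p x N' p' X'); auto; lra. }
  apply Rle_trans with (1 := IH ltac:(lra) Hg' t ltac:(lra)).
  apply sqrt_le_1_alt. apply Rmult_le_compat_l; auto.
  assert (E := Hrec s e N p x X Hs0 ltac:(lra) ltac:(lra) HX Hph Hg e ltac:(lra)).
  rewrite (energy_after_event W U (extend T um) eps e N p (fun i => x i e) N' p' X'
    (fun y => um y e)); auto.
  + replace (exp (growth K la La B * (t - s))) with
      (exp (growth K la La B * (e - s)) * exp (growth K la La B * (t - e)))
      by (rewrite <- exp_plus; f_equal; ring).
    rewrite <- Rmult_assoc. apply Rmult_le_compat_r; auto. left; apply exp_pos.
  + apply (sol_cont _ _ _ _ _ HU).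
  + apply cont2_extend; auto; lra.
  + apply (phase_closed W S um T s e N p x); auto; lra.
  + apply (evolves_start _ _ _ _ _ _ _ _ Hev).
Qed.

(** * Initial configuration *)

(** Going from the first face to any other takes at most [N] steps of size at
    most [m], and [N * m <= c]. *)
Lemma initial_slope_bound S a b N p X f m c :
  0 < m -> compatible_datum S a b N p X f -> INR N <= c / m ->
  (forall i, (1 <= i <= N + 1)%nat -> Rabs (p i - p (i - 1)%nat) <= m) ->
  forall i, (1 <= i <= N)%nat -> Rabs (p i) <= Rabs a + c.
Proof.
intros Hm (_ & HN & E1 & _) HNm Hstep i Hi.
assert (G : forall k, (k < N)%nat -> Rabs (p (1 + k)%nat - a) <= INR k * m).
{ induction k as [|k IH]; intros Hk.
  - simpl. rewrite E1, Rminus_diag, Rabs_R0. lra.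
  - assert (H1 := IH ltac:(lia)). assert (H2 := Hstep (1 + Datatypes.S k)%nat ltac:(lia)).
    replace (1 + Datatypes.S k - 1)%nat with (1 + k)%nat in H2 by lia.
    rewrite S_INR.
    replace (p (1 + Datatypes.S k)%nat - a) with
      ((p (1 + Datatypes.S k)%nat - p (1 + k)%nat) + (p (1 + k)%nat - a)) by ring.
    eapply Rle_trans. apply Rabs_triang. lra. }
assert (G1 := G (i - 1)%nat ltac:(lia)). replace (1 + (i - 1))%nat with i in G1 by lia.
assert (G2 : INR (i - 1) * m <= c).
{ apply Rle_trans with (INR N * m).
  apply Rmult_le_compat_r. lra. apply le_INR. lia.
  apply Rmult_le_compat_r with (r := m) in HNm; try lra.
  replace (c / m * m) with c in HNm by (field; lra). exact HNm. }
assert (G3 := Rabs_triang (p i - a) a). replace (p i - a + a) with (p i) in G3 by ring. lra.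
Qed.

Lemma initial_good_config S a b N p X f m P :
  compatible_datum S a b N p X f ->
  (forall i, (1 <= i <= N + 1)%nat -> Rabs (p i - p (i - 1)%nat) <= m) ->
  (forall i, (1 <= i <= N)%nat -> Rabs (p i) <= P) ->
  good_config S a b m P N p.
Proof.
intros (_ & HN & E1 & EN & Hadj & _) Hstep HP.
split; [lia|split; [auto|split; auto]].
intros i Hi. split; auto. split.
- assert (H := Hstep (i + 1)%nat ltac:(lia)). now replace (i + 1 - 1)%nat with i in H by lia.
- split; apply HP; lia.
Qed.

Lemma initial_boundary_gaps S a b N p X f m :
  compatible_datum S a b N p X f ->
  (forall i, (1 <= i <= N + 1)%nat -> Rabs (p i - p (i - 1)%nat) <= m) ->
  (forall q, adjacent S a q -> Rabs (q - a) <= m) /\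
  (forall q, adjacent S b q -> Rabs (q - b) <= m).
Proof.
intros (_ & HN & E1 & EN & Hadj & B1 & B2 & B3 & B4) Hstep. split; intros q Hq.
- assert (H1 := Hstep 1%nat ltac:(lia)). assert (H2 := Hstep 2%nat ltac:(lia)).
  assert (A := Hadj 1%nat ltac:(lia)). simpl in H1, H2, A. rewrite E1 in *.
  apply (adjacent_gap S a q (p 0%nat) (p 2%nat)); auto.
  now apply adjacent_sym. now rewrite Rabs_minus_sym.
- assert (H1 := Hstep N ltac:(lia)). assert (H2 := Hstep (N + 1)%nat ltac:(lia)).
  assert (A := Hadj (N - 1)%nat ltac:(lia)).
  replace (N - 1 + 1)%nat with N in A by lia. replace (N + 1 - 1)%nat with N in H2 by lia.
  rewrite EN in *.
  apply (adjacent_gap S b q (p (N - 1)%nat) (p (N + 1)%nat)); auto.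
  now apply adjacent_sym. now apply adjacent_sym. now rewrite Rabs_minus_sym.
Qed.

Lemma extend_bounded T f :
  0 <= T -> cont2 (extend T f) ->
  exists M, 0 < M /\ forall t y, Rabs (extend T f t y) <= M.
Proof.
intros HT Hf. destruct (cont2_bounded (extend T f) 0 T 0 1 Hf) as (M & PM & HM).
exists M. split; auto. intros t y.
assert (Ht := clamp_in 0 T t HT). assert (Hy := clamp_in 0 1 y Rle_0_1).
generalize (HM _ _ Ht Hy). rewrite extend_id by lra. auto.
Qed.

Theorem mainTheorem3 (W : R -> R) (a b T c : R) (u0 : R -> R)
    (u : R -> R -> R) (D : nat -> nat -> R -> R -> R)
    (W_C3 : C3 W)
    (W_convex : strictly_convex W)
    (W_pos : forall x : R, 0 < Derive_n W 2 x)
    (T_pos : 0 < T) (c_pos : 0 < c)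
    (u_sol : neumann_solution W a b T u0 u D) :
  exists m0 CT : R, 0 < m0 /\
    forall m : R, 0 < m <= m0 ->
    forall (S : R -> Prop) (N0 : nat) (p0 X0 : nat -> R) (u0m : R -> R)
           (um : R -> R -> R),
      slope_set S a b ->
      compatible_datum S a b N0 p0 X0 u0m ->
      crystalline_evolution W S T N0 p0 X0 u0m um ->
      INR N0 <= c / m ->
      Linf_norm_le (fun x => Derive u0m x - Derive u0 x) m ->
      (forall i : nat, (1 <= i <= N0 + 1)%nat ->
         Rabs (p0 i - p0 (i - 1)%nat) <= m) ->
      L2_norm (fun x => u0m x - u0 x) <= c * sqrt m ->
      forall t : R, 0 <= t <= T ->
        H1_norm (fun x => u x t - um x t) <= CT * sqrt m.
Proof.
assert (HT : 0 <= T) by lra.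
assert (HU := neumann_solution_extend W a b T u0 u D HT u_sol).
assert (Hc := sol_cont _ _ _ _ _ HU). simpl in Hc.
destruct (extend_bounded T (D 1%nat 0%nat) HT (Hc 1%nat 0%nat ltac:(lia))) as (M1 & PM1 & HM1).
destruct (extend_bounded T (D 1%nat 1%nat) HT (Hc 1%nat 1%nat ltac:(lia))) as (M2 & PM2 & HM2).
destruct (extend_bounded T (fun y t => Derive_n W 2 (D 1%nat 0%nat y t) * D 2%nat 0%nat y t) HT)
  as (M3 & PM3 & HM3).
{ apply (cont2_mult (extend T (fun y t => Derive_n W 2 (D 1%nat 0%nat y t)))).
  apply (cont2_app (Derive_n W 2) (extend T (D 1%nat 0%nat))).
  now apply W2_continuous. apply Hc; lia. apply (Hc 2%nat 0%nat); lia. }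
set (P := Rabs a + Rabs b + c). set (K := P + 1 + M1).
assert (Pa := Rabs_pos a). assert (Pb := Rabs_pos b).
assert (PK : 0 <= K) by (unfold K, P; lra).
destruct (taylor_bounds_exist W W_C3 W_pos K PK) as (la & La & HTb).
assert (Hpl : 0 < la /\ 0 < La) by (split; apply HTb).
set (B := M2 + M3).
set (kap := (1 + K) * (La / la)).
assert (Pkap : 0 <= kap).
{ apply Rmult_le_pos. lra. apply Rdiv_le_0_compat; lra. }
(* [eps] turns the smallness condition of [rate_pointwise_bound] into an
   equality *)
set (eps := / (12 * (1 + K + 1) ^ 2)).
assert (PK2 : 1 <= (1 + K + 1) ^ 2) by nra.
assert (Heps : 0 < eps <= 1).
{ unfold eps. split. apply Rinv_0_lt_compat; lra.
  apply Rle_trans with (/ 1). apply Rinv_le_contravar; lra. rewrite Rinv_1; lra. }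
assert (Heps2 : eps * (3 * (1 + K + 1) ^ 2) <= 1 / 4).
{ right. unfold eps. field. nra. }
set (C := (/ la + / eps) * ((La + c ^ 2 + 1) * exp (growth K la La B * T))).
exists (Rmin 1 (/ (2 * (kap + 1)))), (sqrt C). split.
{ apply Rmin_pos. lra. apply Rinv_0_lt_compat. lra. }
intros m [Pm Hm] S N0 p0 X0 u0m um _ Hcomp (Hum & Hum0 & Hev) HN0 HLinf Hgap HL2 t Ht.
assert (Hm1 : m <= 1) by (eapply Rle_trans; [exact Hm|apply Rmin_l]).
assert (Hm2 : kap * m <= 1 / 2).
{ assert (G : m <= / (2 * (kap + 1))) by (eapply Rle_trans; [exact Hm|apply Rmin_r]).
  apply Rle_trans with (kap * / (2 * (kap + 1))).
  now apply Rmult_le_compat_l. apply Rle_div_l; lra. }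
assert (HM3' : forall t y, Rabs (extend T (D 0%nat 1%nat) t y /
  sqrt (1 + extend T (D 1%nat 0%nat) t y ^ 2)) <= B).
{ intros t' y. rewrite (sol_pde _ _ _ _ _ HU). apply Rle_trans with M3.
  apply HM3. unfold B; lra. }
assert (Hslopes : forall i, (1 <= i <= N0)%nat -> Rabs (p0 i) <= P).
{ intros i Hi. apply Rle_trans with (Rabs a + c). 2: unfold P; lra.
  now apply (initial_slope_bound S a b N0 p0 X0 u0m m c). }
assert (Hgood := initial_good_config S a b N0 p0 X0 u0m m P Hcomp Hgap Hslopes).
destruct (initial_boundary_gaps S a b N0 p0 X0 u0m m Hcomp Hgap) as [Hga Hgb].
assert (HK10 : forall t y, Rabs (extend T (D 1%nat 0%nat) t y) <= K).
{ intros t' y. apply Rle_trans with M1. apply HM1. unfold K, P; lra. }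
assert (HK11 : forall t y, Rabs (extend T (D 1%nat 1%nat) t y) <= B).
{ intros t' y. apply Rle_trans with M2. apply HM2. unfold B; lra. }
assert (PmK : P + m <= K) by (unfold K; lra).
assert (Hfin := evolution_bound W a b T u0 u D K la La B eps m P S um W_C3 W_convex T_pos
  u_sol HTb HK10 HK11 HM3' PK (conj (Rlt_le _ _ Pm) Hm1) Hm2 Heps Heps2 PmK
  ltac:(unfold P; lra) ltac:(unfold P; lra) Hga Hgb Hum 0 N0 p0 X0 Hev (Rle_refl 0)
  Hgood t Ht).
assert (HpK : forall i, (1 <= i <= N0)%nat -> Rabs (p0 i) <= K).
{ intros i Hi. apply Rle_trans with P; [now apply Hslopes|lra]. }
assert (HE0 := initial_energy_bound W W_C3 a b T u0 u D u_sol HT K la La eps HTb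
  HK10 um Hum S c m N0 p0 X0 u0m ltac:(lra) ltac:(lra) (proj2 Heps)
  (proj1 Hcomp) Hum0 HpK HLinf HL2).
simpl in Hfin.
apply Rle_trans with (1 := Hfin). rewrite <- sqrt_mult_alt.
2:{ unfold C. assert (P1 := Rinv_0_lt_compat _ (proj1 Hpl)).
    assert (P2 := Rinv_0_lt_compat _ (proj1 Heps)).
    apply Rmult_le_pos. lra. apply Rmult_le_pos. generalize (pow2_ge_0 c); lra.
    left; apply exp_pos. }
apply sqrt_le_1_alt. unfold C. rewrite !Rmult_assoc. apply Rmult_le_compat_l.
{ assert (P1 := Rinv_0_lt_compat _ (proj1 Hpl)).
  assert (P2 := Rinv_0_lt_compat _ (proj1 Heps)). lra. }
set (E0 := energy _ _ _ _ _ _ _ _) in *.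
assert (Hg : 0 <= growth K la La B).
{ unfold growth. assert (PB : 0 <= B) by (unfold B; lra).
  assert (A1 : 0 <= B * La) by (apply Rmult_le_pos; lra).
  assert (A2 := pow2_ge_0 B).
  assert (A3 : 0 <= ((1 + K) * (La / la)) ^ 2 * B ^ 2) by (apply Rmult_le_pos; apply pow2_ge_0).
  assert (A4 : 0 <= (B * La + 5 * B ^ 2) / la) by (apply Rdiv_le_0_compat; lra).
  lra. }
apply Rle_trans with ((La + c ^ 2 + 1) * m * exp (growth K la La B * (t - 0))).
- apply Rmult_le_compat_r. left; apply exp_pos. lra.
- rewrite (Rmult_comm (exp _) m), <- (Rmult_assoc _ m). apply Rmult_le_compat_l.
  + apply Rmult_le_pos. generalize (pow2_ge_0 c); lra. lra.
  + assert (Hle : growth K la La B * (t - 0) <= growth K la La B * T)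
      by (apply Rmult_le_compat_l; lra).
    destruct Hle as [Hlt|Heq]. left; now apply exp_increasing. rewrite Heq; lra.
Qed.
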